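(* Let $d\ge 2$, let $R>r>0$ and let $f\in\mathcal{E}'(\mathbb{R}^d)$ be such that $\operatorname{spt}(f)\subset\overline{B}(0,R)\setminus B(0,r)$. If $Xf$ vanishes on all lines that intersect $B(0,r)$, then $f=0$.
   Context: $B(0,r)$ is the open ball and $\overline{B}(0,R)$ the closed ball in $\mathbb{R}^d$; $\operatorname{spt}$ denotes support. $\mathcal{E}$ denotes smooth functions, $\mathcal{D}$ compactly supported smooth functions, and $\mathcal{E}'(\mathbb{R}^d)$ the compactly supported distributions on $\mathbb{R}^d$. X-ray transform: let $\Gamma$ be the manifold of oriented lines in $\mathbb{R}^d$, parametrized by $\{(z,\theta):\theta\in S^{d-1},\ z\in\theta^\perp\}$ (identified with $TS^{d-1}$). For $\varphi\in\mathcal{D}(\mathbb{R}^d)$, $X\varphi(z,\theta)=\int_{\mathbb{R}}\varphi(z+s\theta)\,ds$; for $\psi\in\mathcal{E}(\Gamma)$, $X^*\psi(x)=\int_{S^{d-1}}\psi(x-(x\cdot\theta)\theta,\theta)\,d\theta$. For $f\in\mathcal{E}'(\mathbb{R}^d)$, $Xf\in\mathcal{E}'(\Gamma)$ is defined by $\langle Xf,\eta\rangle=\langle f,X^*\eta\rangle$ for all $\eta\in\mathcal{E}(\Gamma)$. For an open set $V$, ''$Xf$ vanishes on all lines that intersect $V$'' means that $Xf|_{\Gamma_V}=0$ as a distribution, where $\Gamma_V\subset\Gamma$ is the (open) set of all lines intersecting $V$. *)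

(* Defs.v *)
From HB Require Import structures.
From mathcomp Require Import all_boot all_order all_algebra.
From mathcomp Require Import complex.
From mathcomp Require Import all_classical all_reals all_analysis.

Set Implicit Arguments.
Unset Strict Implicit.
Unset Printing Implicit Defensive.

Import Order.TTheory GRing.Theory Num.Theory.
Import numFieldNormedType.Exports.

Local Open Scope classical_set_scope.
Local Open Scope ring_scope.
Local Open Scope complex_scope.

(* The library norm `|x| on 'rV[R]_d is the sup norm; it induces the usual
   topology, but balls and the sphere below are Euclidean. *)
Section euclidean.
Context {R : realType} {d : nat}.
Implicit Types x y : 'rV[R]_d.

Definition dot x y : R := \sum_(i < d) x 0 i * y 0 i.

Definition enorm x : R := Num.sqrt (dot x x).

Definition eball x (r : R) : set 'rV[R]_d := [set y | enorm (y - x) < r].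

Definition eclosed_ball x (r : R) : set 'rV[R]_d :=
  [set y | enorm (y - x) <= r].

End euclidean.

(* Lebesgue measure on R^n, as a measure on n-tuples: at rank n.+1, the image
   of the product measure on R * R^n under (x, t) |-> x :: t. *)
Section cons_measure.
Context {R : realType} {n : nat}.
Local Notation T := (measurableTypeR R).
Variable mu : {sigma_finite_measure set (n.-tuple T) -> \bar R}.

Definition tcons (p : T * n.-tuple T) : n.+1.-tuple T := [tuple of p.1 :: p.2].

Let measurable_tcons : measurable_fun setT tcons.
Proof. exact: measurable_cons. Qed.

Definition cons_measure : set (n.+1.-tuple T) -> \bar R :=
  pushforward (@lebesgue_measure R \x mu)%E tcons.

Let cons_measure0 : cons_measure set0 = 0%E.
Proof. by rewrite /cons_measure /pushforward preimage_set0 measure0. Qed.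

Let cons_measure_ge0 A : (0 <= cons_measure A)%E.
Proof. exact: measure_ge0. Qed.

Let cons_measure_sigma_additive : semi_sigma_additive cons_measure.
Proof. exact: measure_semi_sigma_additive. Qed.

HB.instance Definition _ := isMeasure.Build _ _ _ cons_measure
  cons_measure0 cons_measure_ge0 cons_measure_sigma_additive.

Let tuncons (t : n.+1.-tuple T) : T * n.-tuple T :=
  (thead t, [tuple of behead t]).

Let measurable_tuncons : measurable_fun setT tuncons.
Proof.
apply: measurable_fun_pair; last exact: measurable_behead.
exact: measurable_tnth.
Qed.

Let tconsK : cancel tcons tuncons.
Proof. by case=> x t; congr (_, _); apply: val_inj. Qed.

Let sigma_finite_cons : sigma_finite setT cons_measure.
Proof.
have /sigma_finiteP[F [TF ndF Foo]] := sigma_finiteT (@lebesgue_measure R).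
have /sigma_finiteP[G [TG ndG Goo]] := sigma_finiteT mu.
exists (fun i => tuncons @^-1` (F i `*` G i)).
  rewrite -preimage_bigcup (_ : \bigcup_i _ = setT) ?preimage_setT//.
  rewrite -setXTT TF TG predeqE => -[x t]; split.
    by move=> [i _ [/= ? ?]]; split; exists i.
  move=> [/= [i _ Fx] [k _ Gt]]; exists (maxn i k) => //; split.
    by move: x Fx; exact/subsetPset/ndF/leq_maxl.
  by move: t Gt; exact/subsetPset/ndG/leq_maxr.
move=> i; have [mF Fi] := Foo i; have [mG Gi] := Goo i; split.
  rewrite -[X in measurable X]setTI; apply: measurable_tuncons => //.
  exact: measurableX.
rewrite /cons_measure /pushforward (_ : tcons @^-1` _ = F i `*` G i).
  by rewrite product_measure1E// lte_mul_pinfty// ge0_fin_numE.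
by apply/seteqP; split => p; rewrite /preimage /mkset tconsK.
Qed.

HB.instance Definition _ :=
  Measure_isSigmaFinite.Build _ _ _ cons_measure sigma_finite_cons.

End cons_measure.

Fixpoint lebesgue_tuple (R : realType) (n : nat) :
    {sigma_finite_measure set (n.-tuple (measurableTypeR R)) -> \bar R} :=
  match n with
  | 0 => \d_[tuple]
  | n'.+1 => cons_measure (lebesgue_tuple R n')
  end.

(* The integral over the unit sphere S^(d-1) for the surface measure, in polar
   coordinates: a subset A of the sphere has surface measure d times the volume
   of the punctured cone {s *: theta | theta in A, 0 < s <= 1}. Only the values
   of h on the sphere matter. *)
Section sphere.
Context {R : realType} {d : nat}.

Definition row_of_tuple (t : d.-tuple (measurableTypeR R)) : 'rV[R]_d :=
  \row_i tnth t i.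

Definition sphere_integral (h : 'rV[R]_d -> R) : R :=
  d%:R * \int[lebesgue_tuple R d]_(t in [set t | 0 < enorm (row_of_tuple t) <= 1])
    h ((enorm (row_of_tuple t))^-1 *: row_of_tuple t).

Definition sphere_integralC (h : 'rV[R]_d -> R[i]) : R[i] :=
  sphere_integral (fun theta => complex.Re (h theta)) +i*
  sphere_integral (fun theta => complex.Im (h theta)).

End sphere.

Section smooth.
Context {R : realType} {V : normedModType R}.
Implicit Types (U : set V) (g : V -> R) (phi : V -> R[i]).

Definition iter_derive (vs : seq V) g : V -> R :=
  foldr (fun v h => 'D_v h) g vs.

(* C^oo on the open set U: iterated directional derivatives of all orders
   exist and are continuous on U. *)
Definition smooth_on U g : Prop :=
  forall (vs : seq V) (x : V), U x ->
    {for x, continuous (iter_derive vs g)} /\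
    forall v : V, derivable (iter_derive vs g) x v.

Definition smoothC_on U phi : Prop :=
  smooth_on U (fun x => complex.Re (phi x)) /\
  smooth_on U (fun x => complex.Im (phi x)).

Definition support phi : set V := closure [set x | phi x != 0].

End smooth.

Section distributions.
Context {R : realType} {d : nat}.
Local Notation Rd := 'rV[R]_d.
Implicit Types (phi : Rd -> R[i]) (U K : set Rd).

Definition smooth_fun : set (Rd -> R[i]) := [set phi | smoothC_on setT phi].

Definition test_fun : set (Rd -> R[i]) :=
  [set phi | smooth_fun phi /\ compact (support phi)].

(* The iterated partial derivative along a list of coordinates; a multi-index
   alpha corresponds to the lists containing each i exactly alpha_i times. *)
Definition partial (s : seq 'I_d) phi (x : Rd) : R[i] :=
  let vs := [seq delta_mx 0 i : Rd | i <- s] in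
  iter_derive vs (fun y => complex.Re (phi y)) x +i*
  iter_derive vs (fun y => complex.Im (phi y)) x.

(* The seminorms defining the Frechet topology of smooth functions. *)
Definition seminorm K (N : nat) phi : R :=
  sup [set r | exists s x,
    [/\ (size s <= N)%N, K x & r = Normc.normc (partial s phi x)]].

(* A compactly supported distribution is a continuous linear functional on the
   smooth functions. It is carried by a functional on all functions, whose
   values outside smooth_fun are irrelevant: equality with 0 is dist_eq0. *)
Record compact_distribution := CompactDistribution {
  pairing :> (Rd -> R[i]) -> R[i];
  pairing_linear : forall (a : R[i]) phi psi,
    smooth_fun phi -> smooth_fun psi ->
    pairing (fun x => a * phi x + psi x) = a * pairing phi + pairing psi;
  pairing_continuous : exists K (N : nat) (c : R), compact K /\
    forall phi, smooth_fun phi ->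
      Normc.normc (pairing phi) <= c * seminorm K N phi }.

Implicit Types f : compact_distribution.

Definition dist_eq0 f : Prop := forall phi, smooth_fun phi -> f phi = 0.

Definition dist_vanishes_on f U : Prop :=
  forall phi, test_fun phi -> support phi `<=` U -> f phi = 0.

Definition spt f : set Rd :=
  ~` \bigcup_(U in [set U | open U /\ dist_vanishes_on f U]) U.

End distributions.
Arguments compact_distribution : clear implicits.

(* Oriented lines z + R theta are encoded as pairs (z, theta), so that the
   manifold of lines is the closed submanifold TS^(d-1) of R^d * R^d. Functions
   on it are represented by functions on the ambient space, whose values
   elsewhere are irrelevant. *)
Section xray.
Context {R : realType} {d : nat}.
Local Notation Rd := 'rV[R]_d.
Implicit Types (p : Rd * Rd) (V : set Rd) (eta : Rd * Rd -> R[i]).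

Definition lines : set (Rd * Rd) :=
  [set p | enorm p.2 = 1 /\ dot p.1 p.2 = 0].

Definition line_points p : set Rd := range (fun s : R => p.1 + s *: p.2).

Definition lines_meeting V : set (Rd * Rd) :=
  [set p | lines p /\ line_points p `&` V !=set0].

(* Smoothness on an embedded submanifold: local smooth extensions exist. *)
Definition smooth_on_lines eta : Prop :=
  forall p, lines p -> exists (W : set (Rd * Rd)) (g : Rd * Rd -> R[i]),
    [/\ open W, W p, smoothC_on W g & {in W `&` lines, eta =1 g}].

Definition lines_support eta : set (Rd * Rd) :=
  lines `&` closure [set p | lines p /\ eta p != 0].

Definition test_on_lines eta : Prop :=
  smooth_on_lines eta /\ compact (lines_support eta).

Definition xray_adjoint eta (x : Rd) : R[i] :=
  sphere_integralC (fun theta => eta (x - dot x theta *: theta, theta)).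

(* For eta smooth on the lines, xray_adjoint eta is smooth, so the pairing with
   f does not involve irrelevant values. *)
Definition xray (f : compact_distribution R d) eta : R[i] :=
  f (xray_adjoint eta).

Definition xray_vanishes_on_lines_meeting (f : compact_distribution R d) V :=
  forall eta, test_on_lines eta -> lines_support eta `<=` lines_meeting V ->
    xray f eta = 0.

End xray.

(* Main.v *)
(* The support condition makes [f] a distribution off B(0, r), and the hypothesis
   says that [f] annihilates X^* eta for every test function eta on the lines
   meeting B(0, r). Let eta be, for y near 0, the function sending a line to its
   integral against a small radial bump centred at y. Polar coordinates show that
   X^* eta is a nonzero multiple of the convolution of the bump with |x|^(1-d),
   so, shrinking the bump, [f] annihilates |x - y|^(1-d) for all small y. It then
   annihilates all derivatives in y of these kernels; since the Laplacian of
   |x|^(2a) is 2a(2a + d - 2)|x|^(2a-2), it annihilates |x - y|^(1-d-2j) for all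
   j. Bernstein approximation in the variable |x - y|^(-2) reaches the even powers
   |x - y|^(2m), differentiation in y then all polynomials, and Bernstein
   approximation in each coordinate all smooth functions. *)

From HB Require Import structures.
From mathcomp Require Import all_boot all_order all_algebra.
From mathcomp Require Import finmap complex ring lra.
From mathcomp Require Import all_classical all_reals all_analysis measurable_realfun.
Require Import Defs.

Set Implicit Arguments.
Unset Strict Implicit.
Unset Printing Implicit Defensive.

Import Order.TTheory GRing.Theory Num.Theory.
Import numFieldNormedType.Exports.

Local Open Scope classical_set_scope.
Local Open Scope ring_scope.

(** * Smooth functions *)

(** A distribution accepts only globally smooth functions, while the kernels [|x - y|^(2a)] blow up
    at [y]. The argument therefore runs on functionals defined on functions smooth on an open set
    that avoids the poles; such a functional comes from [f] by inserting a cutoff equal to 1 near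
    the support. It has finite order on a compact set, so every limit is a C^N approximation on that
    set for arbitrary N, and Bernstein polynomials are needed together with the convergence of all
    their derivatives. Real and imaginary parts are separated at the end, which keeps the analysis
    real.

    Bernstein approximation in [s = |x - y|^(-2)] reaches even powers because
    [|x - y|^(2m) = |x - y|^(2a) s^(a - m)]: on the compact set [s] stays away from 0, so the power
    is smooth even when [a] is a half-integer, and polynomials in [s] times [|x - y|^(2a)] are
    combinations of kernels already annihilated.

    The sphere carries no measure of its own here, its integral being taken over the solid ball.
    Polar coordinates are thus an identity between integrals over a line times a ball, proved by
    Tonelli and affine substitutions. *)

Section smooth_calculus.
Context {R : realType} {V : normedModType R}.
Implicit Types (U O : set V) (f g u : V -> R) (x v : V).

(** A coinduction principle: if [C] is stable under directional derivatives up to equality on [U],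
    then by induction on [vs] every iterated derivative agrees on [U] with a member of [C]. Openness
    of [U] lets the agreement survive the next derivative. *)
Lemma smooth_on_coind U (C : set (V -> R)) : open U ->
  (forall g, C g -> forall x, U x -> {for x, continuous g}) ->
  (forall g, C g -> forall v, exists2 g', C g' &
     forall x, U x -> is_derive x v g (g' x)) ->
  forall g, C g -> smooth_on U g.
Proof.
move=> oU Cc Cd g Cg vs.
have [g' Cg' gE] : exists2 g', C g' & forall x, U x -> iter_derive vs g x = g' x.
  elim: vs => [|v vs [g' Cg' IH]] /=; first by exists g.
  have [g'' Cg'' dg'] := Cd _ Cg' v; exists g'' => // x Ux.
  have [_ <-] := dg' x Ux; apply: near_eq_derive.
  by apply: filterS (open_nbhs_nbhs (conj oU Ux)) => y /IH.
move=> x Ux.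
have nE : \forall y \near x, g' y = iter_derive vs g y.
  by apply: filterS (open_nbhs_nbhs (conj oU Ux)) => y /gE.
split; last first.
  move=> v; have [g'' _ dg'] := Cd _ Cg' v.
  by apply: near_eq_derivable nE _; have [] := dg' x Ux.
rewrite /prop_for /continuous_at gE//; apply: cvg_trans (Cc _ Cg' x Ux).
exact: near_eq_cvg.
Qed.

Lemma smooth_on_derive U g v : smooth_on U g -> smooth_on U ('D_v g).
Proof.
by move=> sg vs x Ux; have := sg (rcons vs v) x Ux; rewrite /iter_derive foldr_rcons.
Qed.

Lemma smooth_on_iter U g vs : smooth_on U g -> smooth_on U (iter_derive vs g).
Proof.
by move=> sg ws x Ux; have := sg (ws ++ vs) x Ux; rewrite /iter_derive foldr_cat.
Qed.

Lemma smooth_on_is_derive U g x v : smooth_on U g -> U x ->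
  is_derive x v g ('D_v g x).
Proof. by move=> sg Ux; apply: DeriveDef => //; have [_] := sg [::] x Ux. Qed.

Lemma smooth_on_continuous U g x : smooth_on U g -> U x -> {for x, continuous g}.
Proof. by move=> sg Ux; have [] := sg [::] x Ux. Qed.

Lemma smooth_onS U U' g : U' `<=` U -> smooth_on U g -> smooth_on U' g.
Proof. by move=> UU sg vs x /UU; exact: sg. Qed.

Lemma eq_iter_derive U f g vs x : open U -> (forall x, U x -> f x = g x) -> U x ->
  iter_derive vs f x = iter_derive vs g x.
Proof.
move=> oU fg; elim: vs x => [|v vs IH] x Ux /=; first exact: fg.
apply: near_eq_derive.
by apply: filterS (open_nbhs_nbhs (conj oU Ux)) => y /IH.
Qed.

Lemma eq_smooth_on U f g : open U -> (forall x, U x -> f x = g x) ->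
  smooth_on U f -> smooth_on U g.
Proof.
move=> oU fg sf; apply: (smooth_on_coind oU (C := [set h | exists2 k,
   smooth_on U k & forall x, U x -> k x = h x])); last by exists f.
- move=> h [k sk kh] x Ux; rewrite /prop_for /continuous_at -kh//.
  apply: cvg_trans (smooth_on_continuous sk Ux); apply: near_eq_cvg.
  by apply: filterS (open_nbhs_nbhs (conj oU Ux)) => y /kh.
- move=> h [k sk kh] v; exists ('D_v k).
    by exists ('D_v k); [exact: smooth_on_derive|].
  move=> x Ux; apply: near_eq_is_derive (smooth_on_is_derive v sk Ux).
  by apply: filterS (open_nbhs_nbhs (conj oU Ux)) => y /kh.
Qed.

Lemma smooth_onU U U' g : smooth_on U g -> smooth_on U' g -> smooth_on (U `|` U') g.
Proof. by move=> h h' vs x []; [exact: h|exact: h']. Qed.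

(** A directional derivative at [x] is the derivative at 0 along [h *: v + x], so the one-variable
    chain rule applies. *)
Lemma is_derive_comp1 (F : R -> R) u (x v : V) (dF du : R) :
  is_derive (u x) 1 F dF -> is_derive x v u du ->
  is_derive x v (F \o u) (dF * du).
Proof.
move=> [F1 F2] [u1 u2].
have u1' : is_derive (0:R) 1 (fun h : R => u (h *: v + x)) du.
  apply: DeriveDef; first exact: (proj1 (derivable1P u x v) u1).
  rewrite -u2 /derive; set F1' := (X in X @ _); set F2' := (X in _ = lim (X @ _)).
  suff -> : F1' = F2' by []. rewrite /F1' /F2'.
  by apply/funext => h /=; rewrite addr0 scale0r add0r [_%:A]mulr1.
have F1' : is_derive (u (0 *: v + x)) 1 F dF by rewrite scale0r add0r; split.
have [h1 h2] : is_derive (0:R) 1 (F \o (fun h : R => u (h *: v + x))) (dF * du).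
  exact: is_derive1_comp.
apply: DeriveDef; first exact: (proj2 (derivable1P (F \o u) x v) h1).
rewrite -h2 /derive; set F2' := (X in X @ _); set F3' := (X in _ = lim (X @ _)).
suff -> : F2' = F3' by []. rewrite /F2' /F3'.
by apply/funext => h /=; rewrite addr0 scale0r add0r [_%:A]mulr1.
Qed.

(** A smooth function [F 0] of one variable, given together with its successive derivatives. [O] may
    be a closed interval; the derivatives are two-sided even at its end points. *)
Definition deriv_seq (O : set R) (F : nat -> R -> R) :=
  forall k s, O s -> is_derive s 1 (F k) (F k.+1 s).

(** Closing under sums, products and composition simultaneously yields a class stable under
    derivation, by the Leibniz and chain rules, so that [smooth_on_coind] applies to it. *)
Inductive smooth_alg U : (V -> R) -> Prop :=
| salg_base g : smooth_on U g -> smooth_alg U g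
| salg_add f g : smooth_alg U f -> smooth_alg U g -> smooth_alg U (fun x => f x + g x)
| salg_mul f g : smooth_alg U f -> smooth_alg U g -> smooth_alg U (fun x => f x * g x)
| salg_comp (O : set R) F k u : deriv_seq O F -> smooth_on U u ->
   (forall x, U x -> O (u x)) -> smooth_alg U (fun x => F k (u x)).

Lemma is_derive_continuous (F : R -> R) (s d : R) : is_derive s 1 F d -> {for s, continuous F}.
Proof. by move=> [/derivable1_diffP/differentiable_continuous]. Qed.

Lemma smooth_algP U g : open U -> smooth_alg U g -> smooth_on U g.
Proof.
move=> oU; move: g; apply: smooth_on_coind => //.
- move=> g; elim=> {g}.
  + by move=> g sg x; exact: smooth_on_continuous.
  + by move=> f g _ cf _ cg x Ux; apply: cvgD; [exact: cf|exact: cg].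
  + by move=> f g _ cf _ cg x Ux; apply: cvgM; [exact: cf|exact: cg].
  + move=> O F k u dF su uO x Ux.
    apply: (@continuous_comp _ _ _ u (F k)); first exact: smooth_on_continuous Ux.
    by apply: is_derive_continuous; apply: dF; exact: uO.
- move=> g; elim=> {g}.
  + move=> g sg v; exists ('D_v g); first by constructor; exact: smooth_on_derive.
    by move=> x; exact: smooth_on_is_derive.
  + move=> f g _ df _ dg v; have [f' ? ?] := df v; have [g' ? ?] := dg v.
    exists (fun x => f' x + g' x); first exact: salg_add.
    by move=> x Ux; apply: is_deriveD; auto.
  + move=> f g af df ag dg v; have [f' ? hf] := df v; have [g' ? hg] := dg v.
    exists (fun x => f x * g' x + g x * f' x).
      by apply: salg_add; exact: salg_mul.
    by move=> x Ux; apply: is_deriveM; auto.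
  + move=> O F k u dF su uO v; exists (fun x => F k.+1 (u x) * 'D_v u x).
      by apply: salg_mul; [exact: salg_comp dF su uO|
         apply: salg_base; exact: smooth_on_derive].
    move=> x Ux; apply: is_derive_comp1; first by apply: dF; exact: uO.
    exact: smooth_on_is_derive su Ux.
Qed.

Lemma smooth_onD U f g : open U -> smooth_on U f -> smooth_on U g ->
  smooth_on U (fun x => f x + g x).
Proof. by move=> oU sf sg; apply: smooth_algP => //; apply: salg_add; constructor. Qed.

Lemma smooth_onM U f g : open U -> smooth_on U f -> smooth_on U g ->
  smooth_on U (fun x => f x * g x).
Proof. by move=> oU sf sg; apply: smooth_algP => //; apply: salg_mul; constructor. Qed.

Lemma smooth_on_comp U (O : set R) F k u : open U -> deriv_seq O F -> smooth_on U u ->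
   (forall x, U x -> O (u x)) -> smooth_on U (fun x => F k (u x)).
Proof. by move=> oU dF su uO; apply: smooth_algP => //; exact: salg_comp dF su uO. Qed.

Lemma smooth_on_cst U (c : R) : open U -> smooth_on U (fun=> c).
Proof.
move=> oU; apply: (smooth_on_coind oU (C := [set h | exists c, h = fun=> c])).
- by move=> g [k ->] x _; exact: cvg_cst.
- by move=> g [k ->] v; exists (fun=> 0); [exists 0|move=> x _; exact: is_derive_cst].
- by exists c.
Qed.

Lemma smooth_onZ U (c : R) g : open U -> smooth_on U g -> smooth_on U (fun x => c * g x).
Proof. by move=> oU sg; exact: smooth_onM oU (smooth_on_cst c oU) sg. Qed.

Lemma smooth_onN U g : open U -> smooth_on U g -> smooth_on U (fun x => - g x).
Proof.
move=> oU sg; apply: (eq_smooth_on oU (f := fun x => -1 * g x)).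
  by move=> x _; rewrite mulN1r.
exact: smooth_onZ oU sg.
Qed.

Lemma smooth_onB U f g : open U -> smooth_on U f -> smooth_on U g ->
  smooth_on U (fun x => f x - g x).
Proof. by move=> oU sf sg; apply: (smooth_onD oU sf); exact: smooth_onN oU sg. Qed.

Lemma smooth_on_sum U I (r : seq I) (F : I -> V -> R) : open U ->
  (forall i, smooth_on U (F i)) -> smooth_on U (fun x => \sum_(i <- r) F i x).
Proof.
move=> oU sF; elim: r => [|i r IH].
  rewrite (_ : (fun _ => _) = fun=> 0); first exact: smooth_on_cst.
  by apply/funext => x; rewrite big_nil.
rewrite (_ : (fun _ => _) = fun x => F i x + \sum_(i <- r) F i x).
  exact: smooth_onD oU (sF i) IH.
by apply/funext => x; rewrite big_cons.
Qed.

Lemma smooth_on_prod U I (r : seq I) (F : I -> V -> R) : open U ->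
  (forall i, smooth_on U (F i)) -> smooth_on U (fun x => \prod_(i <- r) F i x).
Proof.
move=> oU sF; elim: r => [|i r IH].
  rewrite (_ : (fun _ => _) = fun=> 1); first exact: smooth_on_cst.
  by apply/funext => x; rewrite big_nil.
rewrite (_ : (fun _ => _) = fun x => F i x * \prod_(i <- r) F i x).
  exact: smooth_onM oU (sF i) IH.
by apply/funext => x; rewrite big_cons.
Qed.

(** [l] is the linear part of [u]: the difference quotients along [v] are constantly [l v], and
    further derivatives are those of constants. *)
Lemma smooth_on_affine U u (l : V -> R) : open U -> continuous u ->
  (forall x v (h : R), u (h *: v + x) = h * l v + u x) -> smooth_on U u.
Proof.
move=> oU cu ul.
have du x v : is_derive x v u (l v).
  have cvl : (fun h : R => h^-1 *: ((u \o shift x) (h *: v) - u x)) @ 0^' --> (l v : R).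
    apply: (@cvg_trans _ ((fun=> l v) @ (0:R)^')); last exact: cvg_cst.
    apply: near_eq_cvg.
    near=> h; rewrite /= ul addrK /GRing.scale /= mulrA mulVf ?mul1r//.
    by near: h; exact: nbhs_dnbhs_neq.
  by split; [exact: (cvgP _ cvl)|exact: cvg_lim cvl].
apply: (smooth_on_coind oU (C := [set h | h = u \/ smooth_on U h])); last by left.
- by move=> g [->|sg] x Ux; [exact: cu|exact: smooth_on_continuous sg Ux].
- move=> g [->|sg] v.
    by exists (fun=> l v) => //; right; exact: smooth_on_cst.
  exists ('D_v g); first by right; exact: smooth_on_derive.
  by move=> x; exact: smooth_on_is_derive.
Unshelve. all: by end_near. Qed.

End smooth_calculus.

Section translations.
Context {R : realType} {V : normedModType R}.
Implicit Types (U O : set V) (f g u : V -> R) (x v : V).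

Lemma derive_translate f v a x :
  'D_v (fun y => f (y - a)) x = 'D_v f (x - a).
Proof.
rewrite /derive; set F1 := (X in X @ _); set F2 := (X in _ = lim (X @ _)).
by suff -> : F1 = F2 by []; apply/funext => h /=; rewrite /F1 /F2 /= addrA.
Qed.

Lemma iter_derive_translate f vs a x :
  iter_derive vs (fun y => f (y - a)) x = iter_derive vs f (x - a).
Proof.
elim: vs x => [//|v vs IH] x /=.
rewrite -derive_translate; congr ('D_v _ x).
by apply/funext => y; exact: IH.
Qed.

Lemma smooth_on_translate U f a :
  smooth_on U f -> smooth_on [set x | U (x - a)] (fun y => f (y - a)).
Proof.
move=> sf vs x Ux.
have -> : iter_derive vs (fun y => f (y - a)) = (iter_derive vs f) \o (fun y => y - a).
  by apply/funext => y /=; rewrite iter_derive_translate.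
have [c d] := sf vs (x - a) Ux; split.
  apply: (@continuous_comp _ _ _ (fun y => y - a)); last exact: c.
  by apply: cvgB; [exact: cvg_id|exact: cvg_cst].
move=> v; have := d v; rewrite /derivable.
set F1 := (X in X @ _); set F2 := (X in _ -> cvg (X @ _)).
by suff -> : F1 = F2 by []; apply/funext => h /=; rewrite /F1 /F2 /= addrA.
Qed.

End translations.

(** * Mean value theorem and symmetry of second derivatives *)

Section mean_value.
Context {R : realType} {V : normedModType R}.
Implicit Types (U O K : set V) (f g u : V -> R) (x v : V).

Lemma is_derive_line g x v (s d : R) : is_derive (s *: v + x) v g d ->
  is_derive s 1 (fun t : R => g (t *: v + x)) d.
Proof.
move=> [g1 g2].
have E : (fun h : R => h^-1 *: (((fun t : R => g (t *: v + x)) \o shift s) (h *: (1:R))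
     - g (s *: v + x))) =
   (fun h : R => h^-1 *: ((g \o shift (s *: v + x)) (h *: v) - g (s *: v + x))).
  by apply/funext => h /=; rewrite addrA -scalerDl [_%:A]mulr1.
by split; [rewrite /derivable E|rewrite /derive E].
Qed.

Lemma mean_value_dir U g x v (h : R) : smooth_on U g ->
  (forall t : R, `|t| <= `|h| -> U (t *: v + x)) ->
  exists2 t : R, `|t| <= `|h| & g (h *: v + x) - g x = h * 'D_v g (t *: v + x).
Proof.
move=> sg Uh.
(* Rescaling the segment to [[0, 1]] treats both signs of [h] at once. *)
have Uh1 (t : R) : 0 <= t <= 1 -> U ((h * t) *: v + x).
  move=> /andP[t0 t1]; apply: Uh; rewrite normrM (ger0_norm t0).
  exact: ler_piMr.
have d (t : R) : 0 <= t <= 1 -> is_derive t (1:R) (fun t : R => g ((h * t) *: v + x))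
    (h * 'D_v g ((h * t) *: v + x)).
  move=> t01; rewrite mulrC.
  apply: (@is_derive1_comp _ (fun t : R => g (t *: v + x)) (fun t => h * t)).
    by apply: is_derive_line; apply: smooth_on_is_derive sg (Uh1 _ t01).
  by apply: is_derive_eq; rewrite /GRing.scale /= mulr1.
have [||t t01 /=] := @MVT_segment R (fun t : R => g ((h * t) *: v + x))
   (fun t => h * 'D_v g ((h * t) *: v + x)) 0 1 ler01.
- by move=> t; rewrite in_itv /= => /andP[t0 t1]; apply: d; rewrite !ltW.
- apply: derivable_within_continuous => t; rewrite in_itv /= => t01.
  by have [] := d t t01.
rewrite mulr1 mulr0 scale0r add0r subr0 mulr1 => ->; exists (h * t) => //.
move: t01; rewrite in_itv /= => /andP[t0 t1].
rewrite normrM (ger0_norm t0); exact: ler_piMr.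
Qed.

Lemma uniform_continuity_compact O K (H : V -> R) (e : R) : open O -> compact K ->
  K `<=` O -> (forall x, O x -> {for x, continuous H}) -> 0 < e ->
  exists2 r : R, 0 < r & forall x w, K x -> `|w| < r ->
    O (w + x) /\ `|H (w + x) - H x| < e.
Proof.
move=> oO cK KO cH e0.
(* Near-covering form of compactness: what holds jointly near [(x, 0)] for each [x] in [K] holds for
   all [x] in [K] once [w] is small. *)
have : \forall w \near (0 : V), K `<=` (fun x => O (w + x) /\ `|H (w + x) - H x| < e).
  apply: (proj1 (compact_near_coveringP K) cK V (nbhs (0 : V))
    (fun w x => O (w + x) /\ `|H (w + x) - H x| < e)) => x Kx.
  have cx := cH x (KO x Kx).
  have [A nA AH] : exists2 A, nbhs x A & forall y, A y -> O y /\ `|H x - H y| < e / 2.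
    exists [set y | O y /\ `|H x - H y| < e / 2] => //.
    apply: filterI; first by apply: open_nbhs_nbhs; split => //; exact: KO.
    by move/cvgrPdist_lt : cx => /(_ (e / 2)); apply; rewrite divr_gt0.
  have addc : ((fun p : V * V => p.2 + p.1) @ (x, 0)) --> x.
    rewrite -[X in _ --> X]add0r.
    by apply: cvgD; [exact: cvg_snd|exact: cvg_fst].
  have nA2 := addc _ nA.
  near=> p.
  have [Op Hp] : O (p.2 + p.1) /\ `|H x - H (p.2 + p.1)| < e / 2.
    by apply: AH; near: p.
  have [_ Hp1] : O p.1 /\ `|H x - H p.1| < e / 2.
    by apply: AH; near: p; exact: cvg_fst nA.
  split => //; rewrite (splitr e) (_ : _ - _ = (H x - H p.1) - (H x - H (p.2 + p.1))); last by ring.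
  exact: le_lt_trans (ler_normB _ _) (ltrD Hp1 Hp).
move=> /nbhs_normP[r /= r0 Hr]; exists r => // x w Kx wr.
by apply: (Hr w) => //; rewrite /ball_/= sub0r normrN.
Unshelve. all: by end_near. Qed.

Lemma compact_smooth_bound U K g : compact K -> K `<=` U -> smooth_on U g ->
  exists2 M : R, 0 <= M & forall x, K x -> `|g x| <= M.
Proof.
move=> cK KU sg.
have cg : compact (g @` K).
  apply: continuous_compact => //; apply: continuous_in_subspaceT => x.
  by rewrite inE => /KU; exact: smooth_on_continuous.
have [M [Mr HM]] := compact_bounded cg.
exists (`|M| + 1) => [|x Kx]; first by rewrite addr_ge0.
apply: (HM (`|M| + 1)); last by exists x.
by rewrite ltr_pwDr// ler_norm.
Qed.

(** Two uses of the mean value theorem: along [v] for the difference of [g] and its translate by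
    [h *: w], then along [w] for ['D_v g]. *)
Lemma second_difference U g x v w (h : R) : open U -> smooth_on U g ->
  (forall s t : R, `|s| <= `|h| -> `|t| <= `|h| -> U (t *: w + (s *: v + x))) ->
  exists s t : R, [/\ `|s| <= `|h|, `|t| <= `|h| &
    g (h *: w + (h *: v + x)) - g (h *: v + x) - (g (h *: w + x) - g x) =
    h * (h * 'D_w ('D_v g) (t *: w + (s *: v + x)))].
Proof.
move=> oU sg Uh.
have h0 : `|0 : R| <= `|h| by rewrite normr0.
pose U' : set V := [set y | U y /\ U (y - (- (h *: w)))].
have sG : smooth_on U' (fun y => g (y - (- (h *: w))) - g y).
  have oU' : open U'.
    apply: openI => //; apply: (@open_comp _ _ (fun y => y - (- (h *: w)))) => // y _.
    by apply: cvgB; [exact: cvg_id|exact: cvg_cst].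
  apply: (smooth_onB oU'); last by apply: smooth_onS sg => y [].
  apply: smooth_onS (smooth_on_translate (a := - (h *: w)) sg) => y [] _ Uy; exact: Uy.
have [|s sh] := mean_value_dir (x := x) (v := v) (h := h) sG.
  move=> s sh; split; first by have := Uh s 0 sh h0; rewrite scale0r add0r.
  by rewrite opprK addrC; exact: Uh.
rewrite !opprK ![_ + h *: w]addrC => ->.
have Usx : U (s *: v + x) by have := Uh s 0 sh h0; rewrite scale0r add0r.
have Uhsx : U (h *: w + (s *: v + x)) by exact: Uh.
have [|t th] := mean_value_dir (x := s *: v + x) (v := w) (h := h) (smooth_on_derive v sg).
  by move=> t th; exact: Uh.
move=> E; exists s, t; split => //; rewrite -E; congr (_ * _).
have d1 : is_derive (s *: v + x) v (fun y => g (y - - (h *: w))) ('D_v g (h *: w + (s *: v + x))).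
  have E0 : (s *: v + x) - (- (h *: w)) = h *: w + (s *: v + x) by rewrite opprK addrC.
  have Uy : U ((s *: v + x) - (- (h *: w))) by rewrite E0.
  have := smooth_on_is_derive v (smooth_on_translate (a := - (h *: w)) sg) Uy.
  by rewrite derive_translate E0.
have d2 := smooth_on_is_derive v sg Usx.
have [_ d3] := is_deriveB d1 d2.
rewrite (_ : (fun y => g (y + h *: w) - g y) = (fun y => g (y - - (h *: w)) - g y)).
  exact: d3.
by apply/funext => y; rewrite opprK.
Qed.

(** Schwarz's theorem. The second difference of [g] is symmetric in [v] and [w], and it equals
    [h ^+ 2] times either mixed derivative at some point near [x]; continuity at [x] does the
    rest. *)
Lemma smooth_derive_comm U g x v w : open U -> smooth_on U g -> U x ->
  'D_v ('D_w g) x = 'D_w ('D_v g) x.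
Proof.
move=> oU sg Ux.
have cA := smooth_on_continuous (smooth_on_derive v (smooth_on_derive w sg)) Ux.
have cB := smooth_on_continuous (smooth_on_derive w (smooth_on_derive v sg)) Ux.
apply/eqP; rewrite -subr_eq0 -normr_eq0 eq_le normr_ge0 andbT.
apply/ler_addgt0Pr => e e0; rewrite add0r.
have e2 : 0 < e / 2 by rewrite divr_gt0.
have /nbhs_normP[r /= r0 Hr] : \forall y \near x,
    [/\ U y, `|'D_v ('D_w g) x - 'D_v ('D_w g) y| < e / 2 &
     `|'D_w ('D_v g) x - 'D_w ('D_v g) y| < e / 2].
  have nU := open_nbhs_nbhs (conj oU Ux).
  have nA : \forall y \near x, `|'D_v ('D_w g) x - 'D_v ('D_w g) y| < e / 2.
    by move/cvgrPdist_lt : cA => /(_ _ e2).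
  have nB : \forall y \near x, `|'D_w ('D_v g) x - 'D_w ('D_v g) y| < e / 2.
    by move/cvgrPdist_lt : cB => /(_ _ e2).
  by apply: filterS3 nU nA nB => y.
(* Small enough that all points [t *: w + (s *: v + x)] with [s] and [t] bounded by [h] stay within
   [r] of [x]. *)
pose h := r / 2 / (`|v| + `|w| + 1).
have d0 : 0 < `|v| + `|w| + 1 by rewrite ltr_wpDl ?addr_ge0.
have h0 : 0 < h by rewrite !divr_gt0.
have near_x (s t : R) : `|s| <= `|h| -> `|t| <= `|h| -> ball_ Num.Def.normr x r (t *: w + (s *: v + x)).
  rewrite (gtr0_norm h0) => sh th; rewrite /ball_/= addrA opprD [X in _ + X]addrC addrA subrr sub0r normrN.
  apply: le_lt_trans (ler_normD _ _) _; rewrite !normrZ.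
  apply: (@le_lt_trans _ _ (h * (`|v| + `|w| + 1))).
    rewrite [leRHS](_ : _ = h * `|w| + h * `|v| + h); last by ring.
    by apply: ler_wpDr; [exact: ltW|apply: lerD; exact: ler_wpM2r].
  by rewrite /h divfK ?gt_eqF// ltr_pdivrMr// mulr_natr mulr2n ltrDl.
have near_x' (s t : R) : `|s| <= `|h| -> `|t| <= `|h| -> ball_ Num.Def.normr x r (t *: v + (s *: w + x)).
  by move=> sh th; rewrite addrCA; exact: near_x.
have [s [t [sh th E1]]] := second_difference (x := x) (v := v) (w := w) (h := h) oU sg
  (fun s t sh th => let: And3 a _ _ := Hr _ (near_x s t sh th) in a).
have [s' [t' [sh' th' E2]]] := second_difference (x := x) (v := w) (w := v) (h := h) oU sg
  (fun s t sh th => let: And3 a _ _ := Hr _ (near_x' s t sh th) in a).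
have [_ _ B1] := Hr _ (near_x _ _ sh th).
have [_ B2 _] := Hr _ (near_x' _ _ sh' th').
have E12 : g (h *: w + (h *: v + x)) - g (h *: v + x) - (g (h *: w + x) - g x) =
    g (h *: v + (h *: w + x)) - g (h *: w + x) - (g (h *: v + x) - g x).
  by rewrite [in LHS]addrCA; ring.
have hI := mulfI (lt0r_neq0 h0).
have E := hI _ _ (hI _ _ (etrans (esym E1) (etrans E12 E2))).
rewrite E in B1.
have tri (a b c : R) : `|a - c| < e / 2 -> `|b - c| < e / 2 -> `|a - b| <= e.
  move=> ac bc; rewrite (splitr e) (_ : a - b = (a - c) - (b - c)); last by ring.
  exact: le_trans (ler_normB _ _) (ltW (ltrD ac bc)).
exact: tri B2 B1.
Qed.

End mean_value.

(** * Partial derivatives and C^N bounds *)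

Section partials.
Context {R : realType} {d : nat}.
Local Notation V := 'rV[R]_d.
Implicit Types (U O K : set V) (f g u : V -> R) (x : V) (s : seq 'I_d).

Definition pd s g : V -> R := iter_derive [seq delta_mx 0 i : V | i <- s] g.

(** The C^N norm on [K] is at most [M], as a family of bounds, so that no supremum has to be formed.
    Words in the coordinates replace multi-indices, as in [partial]. *)
Definition CN_le K N g (M : R) :=
  forall s x, (size s <= N)%N -> K x -> `|pd s g x| <= M.

Lemma pd_cons i s g : pd (i :: s) g = 'D_(delta_mx 0 i) (pd s g).
Proof. by []. Qed.

Lemma pd_rcons s i g : pd (rcons s i) g = pd s ('D_(delta_mx 0 i) g).
Proof. by rewrite /pd map_rcons /iter_derive foldr_rcons. Qed.

Lemma smooth_on_pd U s g : smooth_on U g -> smooth_on U (pd s g).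
Proof. exact: smooth_on_iter. Qed.

Lemma eq_pd U f g s x : open U -> (forall y, U y -> f y = g y) -> U x ->
  pd s f x = pd s g x.
Proof. by move=> oU fg Ux; exact: eq_iter_derive oU fg Ux. Qed.

Lemma pd_swap U s i g x : open U -> smooth_on U g -> U x ->
  pd (rcons s i) g x = pd (i :: s) g x.
Proof.
move=> oU sg; elim: s x => [//|j s IH] x Ux.
rewrite rcons_cons pd_cons.
rewrite (_ : 'D_(delta_mx 0 j) (pd (rcons s i) g) x = 'D_(delta_mx 0 j) (pd (i :: s) g) x).
  by rewrite !pd_cons; exact: smooth_derive_comm oU (smooth_on_pd s sg) Ux.
by apply: near_eq_derive; apply: filterS (open_nbhs_nbhs (conj oU Ux)) => y /IH.
Qed.

(** The induction peels off the last letter, that is the innermost derivative: the rule for one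
    derivative holds on the open set [U] and can be rewritten under [pd s]. *)
Lemma pdD U s f g x : open U -> smooth_on U f -> smooth_on U g -> U x ->
  pd s (fun y => f y + g y) x = pd s f x + pd s g x.
Proof.
move=> oU; elim/last_ind: s f g => [//|s i IH] f g sf sg Ux; rewrite !pd_rcons.
rewrite -(IH _ _ (smooth_on_derive _ sf) (smooth_on_derive _ sg) Ux).
apply: (eq_pd s oU _ Ux) => y Uy.
have := is_deriveD (smooth_on_is_derive (delta_mx 0 i) sf Uy)
  (smooth_on_is_derive (delta_mx 0 i) sg Uy).
by case.
Qed.

Lemma pdM_rcons U s i f g x : open U -> smooth_on U f -> smooth_on U g -> U x ->
  pd (rcons s i) (fun y => f y * g y) x =
  pd s (fun y => f y * 'D_(delta_mx 0 i) g y) x +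
  pd s (fun y => 'D_(delta_mx 0 i) f y * g y) x.
Proof.
move=> oU sf sg Ux; rewrite pd_rcons.
rewrite -(pdD s oU (smooth_onM oU sf (smooth_on_derive _ sg))
  (smooth_onM oU (smooth_on_derive _ sf) sg) Ux).
apply: (eq_pd s oU _ Ux) => y Uy.
have [_ ->] := is_deriveM (smooth_on_is_derive (delta_mx 0 i) sf Uy)
  (smooth_on_is_derive (delta_mx 0 i) sg Uy).
by congr (_ + _); rewrite [_ *: _]mulrC.
Qed.

Lemma pdZ U s (c : R) g x : open U -> smooth_on U g -> U x ->
  pd s (fun y => c * g y) x = c * pd s g x.
Proof.
move=> oU; elim/last_ind: s g => [//|s i IH] g sg Ux; rewrite !pd_rcons.
rewrite -(IH _ (smooth_on_derive _ sg) Ux).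
apply: (eq_pd s oU _ Ux) => y Uy.
by have [_ ->] := is_deriveZ c (smooth_on_is_derive (delta_mx 0 i) sg Uy).
Qed.

Lemma pdB U s f g x : open U -> smooth_on U f -> smooth_on U g -> U x ->
  pd s (fun y => f y - g y) x = pd s f x - pd s g x.
Proof.
move=> oU sf sg Ux.
rewrite (_ : (fun y => _) = fun y => f y + -1 * g y); last first.
  by apply/funext => y; rewrite mulN1r.
by rewrite (pdD s oU sf (smooth_onZ _ oU sg) Ux) (pdZ s _ oU sg Ux) mulN1r.
Qed.

Lemma pd_translate s g a x : pd s (fun y => g (y - a)) x = pd s g (x - a).
Proof. exact: iter_derive_translate. Qed.

Lemma near_lists T (F : set_system T) (P : seq 'I_d -> T -> Prop) N : Filter F ->
  (forall s, \forall t \near F, P s t) ->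
  \forall t \near F, forall s, (size s <= N)%N -> P s t.
Proof.
move=> FF; elim: N P => [|N IH] P FP.
  by apply: filterS (FP [::]) => t Pt [|].
have H : \forall t \near F, forall i s, (size s <= N)%N -> P (i :: s) t.
  by apply: filter_forall => i; apply: IH => s; exact: FP.
by apply: filterS (filterI (FP [::]) H) => t [P0 P1] [|i s]//; exact: P1.
Qed.

Lemma CN_bound U K N g : open U -> compact K -> K `<=` U -> smooth_on U g ->
  exists2 M : R, 0 <= M & CN_le K N g M.
Proof.
move=> oU cK KU sg.
have H : \forall M \near +oo, forall s, (size s <= N)%N -> forall x, K x -> `|pd s g x| <= M.
  apply: near_lists => s.
  have [M M0 HM] := compact_smooth_bound cK KU (smooth_on_pd s sg).
  near=> M' => x Kx; apply: le_trans (HM x Kx) _.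
  by near: M'; apply: nbhs_pinfty_ge; rewrite num_real.
have [M [M0 HM]] : exists M : R, 0 <= M /\
    forall s, (size s <= N)%N -> forall x, K x -> `|pd s g x| <= M.
  suff : \forall M \near +oo, 0 <= M /\
    forall s, (size s <= N)%N -> forall x, K x -> `|pd s g x| <= M.
    by move=> /filter_ex.
  by near=> M; split; near: M => //; apply: nbhs_pinfty_ge; rewrite num_real.
by exists M => // s x /HM; apply.
Unshelve. all: by end_near. Qed.

Lemma CN_leS K N N' g M M' : (N' <= N)%N -> M <= M' -> CN_le K N g M -> CN_le K N' g M'.
Proof.
by move=> NN MM H s x sN Kx; apply: le_trans MM; apply: H => //; exact: leq_trans NN.
Qed.

(** [C] depends on [u], [K] and [N] but not on [g]. The Leibniz rule for the innermost derivative
    leaves [u * 'D_i g] and ['D_i u * g], both covered by induction because [u] is generalized. *)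
Lemma CN_le_product U K u N : open U -> compact K -> K `<=` U -> smooth_on U u ->
  exists2 C : R, 0 <= C & forall g M, smooth_on U g -> CN_le K N g M ->
    CN_le K N (fun x => u x * g x) (C * M).
Proof.
move=> oU cK KU; elim: N u => [|N IH] u su.
  have [C C0 HC] := compact_smooth_bound cK KU su.
  exists C => // g M sg gM [|//] x _ Kx.
  by rewrite /pd/= normrM ler_pM//; [exact: HC|exact: (gM [::])].
have [C C0 HC] := IH u su.
have [C' HC'] : exists C' : 'I_d -> R, forall i, 0 <= C' i /\ forall g M, smooth_on U g ->
    CN_le K N g M -> CN_le K N (fun x => 'D_(delta_mx 0 i) u x * g x) (C' i * M).
  have /choice[C' HC'] : forall i : 'I_d, exists C, 0 <= C /\ forall g M, smooth_on U g ->
    CN_le K N g M -> CN_le K N (fun x => 'D_(delta_mx 0 i) u x * g x) (C * M).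
    by move=> i; have [C1 ? ?] := IH _ (smooth_on_derive (delta_mx 0 i) su); exists C1.
  by exists C'.
have S0 : 0 <= \sum_i C' i by apply: sumr_ge0 => i _; have [] := HC' i.
exists (C + \sum_i C' i) => [|g M sg gM s x sN Kx]; first by rewrite addr_ge0.
have M0 : 0 <= M by apply: le_trans (gM [::] x _ Kx).
have gM' := CN_leS (leqnSn N) (lexx M) gM.
case/lastP: s sN => [_|s i].
  apply: le_trans (HC g M sg gM' [::] x _ Kx) _ => //.
  by apply: ler_wpM2r => //; rewrite lerDl.
rewrite size_rcons => sN; rewrite (pdM_rcons s i oU su sg (KU _ Kx)).
apply: le_trans (ler_normD _ _) _; rewrite mulrDl; apply: lerD.
  apply: (HC _ M (smooth_on_derive _ sg) _ s x sN Kx).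
  by move=> s' x' s'N Kx'; rewrite -pd_rcons; apply: gM => //; rewrite size_rcons.
have [Ci0 HCi] := HC' i.
apply: le_trans (HCi _ _ sg gM' s x sN Kx) _.
apply: ler_wpM2r => //; rewrite (bigD1 i)//= lerDl; apply: sumr_ge0 => j _.
by have [] := HC' j.
Qed.

(** The chain rule for the innermost derivative gives ['D_i u] times [E 1] of [u], so the induction
    hypothesis applies to the shifted sequence of derivatives and no formula for higher derivatives
    of a composite is needed. *)
Lemma CN_le_comp U K (O : set R) u N : open U -> compact K -> K `<=` U -> smooth_on U u ->
  (forall x, U x -> O (u x)) ->
  exists2 C : R, 0 <= C & forall E e, deriv_seq O E ->
    (forall k x, (k <= N)%N -> K x -> `|E k (u x)| <= e) ->
    CN_le K N (fun x => E 0%N (u x)) (C * e).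
Proof.
move=> oU cK KU su uO; elim: N => [|N [C C0 HC]].
  exists 1 => // E e _ HE [|//] x _ Kx; rewrite mul1r; exact: HE.
have /choice[C' HC'] : forall i : 'I_d, exists C1, 0 <= C1 /\ forall g M, smooth_on U g ->
    CN_le K N g M -> CN_le K N (fun x => 'D_(delta_mx 0 i) u x * g x) (C1 * M).
  by move=> i; have [C1 ? ?] := CN_le_product N oU cK KU (smooth_on_derive (delta_mx 0 i) su);
    exists C1.
have S0 : 0 <= \sum_i C' i by apply: sumr_ge0 => i _; have [] := HC' i.
exists (1 + (\sum_i C' i) * C) => [|E e dE HE s x sN Kx].
  by rewrite addr_ge0// mulr_ge0.
have e0 : 0 <= e by apply: le_trans (HE 0%N x _ Kx).
case/lastP: s sN => [_|s i].
  apply: le_trans (HE 0%N x _ Kx) _ => //.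
  by rewrite mulrDl mul1r lerDl !mulr_ge0.
rewrite size_rcons => sN; rewrite pd_rcons.
have [Ci0 HCi] := HC' i.
rewrite (eq_pd s oU (g := fun y => 'D_(delta_mx 0 i) u y * E 1%N (u y)) _ (KU _ Kx)); last first.
  move=> y Uy.
  have [_ ->] := is_derive_comp1 (dE 0%N _ (uO _ Uy)) (smooth_on_is_derive (delta_mx 0 i) su Uy).
  by rewrite mulrC.
apply: le_trans (HCi _ (C * e) _ _ s x sN Kx) _.
- exact: smooth_on_comp dE su uO.
- apply: (HC (fun k => E k.+1)) => [k t /dE//|k y kN Ky]; exact: HE.
rewrite mulrDl -[leLHS]add0r; apply: lerD; first by rewrite mul1r.
rewrite -mulrA; apply: ler_wpM2r; first by rewrite mulr_ge0.
by rewrite (bigD1 i)//= lerDl; apply: sumr_ge0 => j _; have [] := HC' j.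
Qed.

End partials.

(** * Functionals continuous for a C^N norm *)

Section functionals.
Context {R : realType} {d : nat}.
Local Notation V := 'rV[R]_d.
Implicit Types (U O K B : set V) (f g G : V -> R) (x y v : V).

(** A real form of a compactly supported distribution on [U], of finite order, with seminorms taken
    on the compact [K]. Its arguments only have to be smooth on [U], which leaves room for kernels
    with poles outside. *)
Record local_functional U K (L : (V -> R) -> R) : Prop := LocalFunctional {
  lf_open : open U;
  lf_compact : compact K;
  lf_sub : K `<=` U;
  lf_add : forall f g, smooth_on U f -> smooth_on U g ->
    L (fun x => f x + g x) = L f + L g;
  lf_scale : forall (c : R) g, smooth_on U g -> L (fun x => c * g x) = c * L g;
  lf_bound : exists N (c : R), 0 <= c /\
    forall g M, smooth_on U g -> 0 <= M -> CN_le K N g M -> `|L g| <= c * M }.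

Section fixed_functional.
Variables (U K : set V) (L : (V -> R) -> R).
Hypothesis HL : local_functional U K L.
Let oU := lf_open HL.
Let cK := lf_compact HL.
Let KU := lf_sub HL.

Lemma lf_sub_eq f g : smooth_on U f -> smooth_on U g ->
  L (fun x => f x - g x) = L f - L g.
Proof.
move=> sf sg.
rewrite (_ : (fun x => f x - g x) = fun x => f x + -1 * g x); last first.
  by apply/funext => y; rewrite mulN1r.
by rewrite (lf_add HL sf (smooth_onZ _ oU sg)) (lf_scale HL _ sg) mulN1r.
Qed.

Lemma eq_lf f g : smooth_on U f -> (forall x, U x -> f x = g x) -> L f = L g.
Proof.
move=> sf fg; have sg := eq_smooth_on oU fg sf.
have [N [c [c0 Lc]]] := lf_bound HL.
apply/eqP; rewrite -subr_eq0 -lf_sub_eq// -normr_eq0 eq_le normr_ge0 andbT.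
rewrite -(mulr0 c); apply: (Lc _ 0 (smooth_onB oU sf sg)) => // s x sN Kx.
by rewrite (pdB s oU sf sg (KU Kx)) (eq_pd s oU fg (KU Kx)) subrr normr0.
Qed.

(** All density arguments go through this form of continuity. The order of [L] is hidden in an
    existential, so approximants are required for every [N]. *)
Lemma lf_cvg0 g : smooth_on U g ->
  (forall N (e : R), 0 < e -> exists h, [/\ smooth_on U h, L h = 0 &
     CN_le K N (fun x => h x - g x) e]) -> L g = 0.
Proof.
move=> sg Hg; have [N [c [c0 Lc]]] := lf_bound HL.
apply/eqP; rewrite -normr_eq0 eq_le normr_ge0 andbT.
apply/ler_addgt0Pr => e e0; rewrite add0r.
have c1 : 0 < c + 1 by rewrite ltr_wpDl.
have [h [sh Lh hg]] := Hg N (e / (c + 1)) (divr_gt0 e0 c1).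
have := Lc _ _ (smooth_onB oU sh sg) (ltW (divr_gt0 e0 c1)) hg.
rewrite lf_sub_eq// Lh sub0r normrN => /le_trans; apply.
by rewrite mulrCA ler_piMr ?ltW// ltr_pdivrMr// mul1r ltrDl.
Qed.

Lemma lf_sum0 I (r : seq I) (F : I -> V -> R) : (forall i, smooth_on U (F i)) ->
  (forall i, L (F i) = 0) -> L (fun x => \sum_(i <- r) F i x) = 0.
Proof.
move=> sF LF; elim: r => [|i r IH].
  rewrite (_ : (fun _ => _) = fun=> 0 * 0); last first.
    by apply/funext => x; rewrite big_nil mulr0.
  by rewrite (lf_scale HL 0 (smooth_on_cst 0 oU)) mul0r.
rewrite (_ : (fun _ => _) = fun x => F i x + \sum_(i <- r) F i x); last first.
  by apply/funext => x; rewrite big_cons.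
by rewrite (lf_add HL (sF i) (smooth_on_sum r oU sF)) IH LF addr0.
Qed.

(* The annihilator of [L] is closed under limits in C^N, so if [L] kills the
   translates of [G] by all [y] in an open set, it also kills the difference
   quotients of [G] in [y] and their limits. *)
Definition kills_translates B G := forall y, B y -> L (fun x => G (x - y)) = 0.

Lemma smooth_on_translates O B G y : (forall x y, U x -> B y -> O (x - y)) ->
  smooth_on O G -> B y -> smooth_on U (fun x => G (x - y)).
Proof.
move=> UBO sG By; have := smooth_on_translate (a := y) sG; apply: smooth_onS.
by move=> x Ux; apply: UBO.
Qed.

Lemma kills_translates_derive O B G i : open O -> open B ->
  (forall x y, U x -> B y -> O (x - y)) -> smooth_on O G ->
  kills_translates B G -> kills_translates B ('D_(delta_mx 0 i) G).
Proof.
move=> oO oB UBO sG HG y By; set v : V := delta_mx 0 i.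
have sGy := smooth_on_translates UBO sG.
have sDGy := smooth_on_translates UBO (smooth_on_derive v sG).
apply: lf_cvg0; first exact: sDGy.
move=> N e e0.
have H1 : \forall t \near (0:R)^', B (y - t *: v).
  have ct : (fun t : R => y - t *: v) @ (0:R)^' --> y.
    rewrite -[X in _ --> X]subr0 -(scale0r v); apply: cvgB; first exact: cvg_cst.
    apply: cvg_within_filter; apply: cvgZr_tmp; exact: cvg_id.
  by apply: ct; apply: open_nbhs_nbhs.
(* Uniform continuity on [K] of derivatives of order up to [N.+1], in the form that the mean value
   theorem calls for: every intermediate [tau] between 0 and [t] is allowed. *)
have H2 : \forall t \near (0:R)^', forall s, (size s <= N)%N -> forall x, K x ->
    forall tau, `|tau| <= `|t| -> U (tau *: v + x) /\
    `|'D_v (pd s G) (tau *: v + (x - y)) - 'D_v (pd s G) (x - y)| <= e.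
  apply: near_lists => s.
  have [r r0 Hr] := uniform_continuity_compact (H := 'D_v (pd s (fun x => G (x - y))))
    oU cK KU (fun x Ux => smooth_on_continuous (smooth_on_derive v
       (smooth_on_pd s (sGy y By))) Ux) e0.
  have nt : \forall t \near (0:R)^', `|t| * `|v| < r.
    have v0 : 0 < `|v| + 1 by rewrite ltr_wpDl.
    apply: filterS (dnbhs0_lt (divr_gt0 r0 v0)) => t; rewrite ltr_pdivlMr//.
    by apply: le_lt_trans; rewrite mulrDr lerDl mulr1.
  apply: filterS nt => t tr x Kx tau taut.
  have [|Ux Hx] := Hr x (tau *: v) Kx.
    by rewrite normrZ; apply: le_lt_trans tr; exact: ler_wpM2r.
  split => //; apply: ltW; move: Hx.
  have E z : 'D_v (pd s (fun x => G (x - y))) z = 'D_v (pd s G) (z - y).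
    exact: (pd_translate (i :: s) G y z).
  by rewrite !E addrA.
have H3 : \forall t \near (0:R)^', t != 0 by exact: nbhs_dnbhs_neq.
have [t [Bt Ht t0]] : exists t, [/\ B (y - t *: v), forall s, (size s <= N)%N -> forall x, K x ->
    forall tau, `|tau| <= `|t| -> U (tau *: v + x) /\
    `|'D_v (pd s G) (tau *: v + (x - y)) - 'D_v (pd s G) (x - y)| <= e & t != 0].
  suff : \forall t \near (0:R)^', [/\ B (y - t *: v), forall s, (size s <= N)%N -> forall x, K x ->
    forall tau, `|tau| <= `|t| -> U (tau *: v + x) /\
    `|'D_v (pd s G) (tau *: v + (x - y)) - 'D_v (pd s G) (x - y)| <= e & t != 0].
    by move=> /filter_ex.
  by apply: filterS3 H1 H2 H3.
have sd := smooth_onB oU (sGy _ Bt) (sGy y By).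
(* Moving [y] by [- t *: v] moves the argument of [G] by [t *: v], so that this quotient tends to
   ['D_v G] with the right sign. *)
exists (fun x => t^-1 * (G (x - (y - t *: v)) - G (x - y))); split.
- exact: smooth_onZ oU sd.
- by rewrite (lf_scale HL _ sd) (lf_sub_eq (sGy _ Bt) (sGy y By)) !HG// subr0 mulr0.
move=> s x sN Kx; have Ux := KU Kx.
rewrite (pdB s oU (smooth_onZ _ oU sd) (sDGy y By) Ux) (pdZ s _ oU sd Ux).
rewrite (pdB s oU (sGy _ Bt) (sGy y By) Ux).
rewrite (pd_translate s G (y - t *: v) x) (pd_translate s G y x).
(* Derivatives commute, so [pd s] of ['D_v G] becomes the derivative along [v] of [pd s G], to which
   the mean value theorem applies. *)
rewrite (pd_translate s ('D_v G) y x) -pd_rcons (pd_swap s i oO sG (UBO _ _ Ux By)) pd_cons.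
have [|tau taut E] := mean_value_dir (x := x - y) (v := v) (h := t) (smooth_on_pd s sG).
  move=> tau taut; have [Uxt _] := Ht [::] isT x Kx tau taut.
  by rewrite addrA; exact: UBO.
rewrite (_ : x - (y - t *: v) = t *: v + (x - y)); last by rewrite opprB addrCA.
rewrite E mulrA mulVf// mul1r.
by have [_] := Ht s sN x Kx tau taut.
Qed.

End fixed_functional.
End functionals.

(** * Bernstein approximation with derivatives *)

Section bernstein.
Context {R : realType}.
Implicit Types (a b : nat -> R) (t x w : R) (F : R -> R) (H : nat -> R -> R).

(* The Bernstein polynomial of degree [n] with control values [a 0, ..., a n],
   defined by de Casteljau's recursion. *)
Fixpoint bernstein n a : {poly R} :=
  if n is n'.+1 then
    (1 - 'X) * bernstein n' a + 'X * bernstein n' (fun k => a k.+1)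
  else (a 0%N)%:P.

Lemma bernsteinD n a b :
  bernstein n (fun k => a k + b k) = bernstein n a + bernstein n b.
Proof.
elim: n a b => [|n IH] a b /=; first by rewrite polyCD.
by rewrite IH (IH (fun k => a k.+1)); ring.
Qed.

Lemma bernsteinZ n (c : R) a : bernstein n (fun k => c * a k) = c *: bernstein n a.
Proof.
elim: n a => [|n IH] a /=; first by rewrite polyCM mul_polyC.
by rewrite IH (IH (fun k => a k.+1)) scalerDr -!mul_polyC; ring.
Qed.

Lemma bernsteinB n a b :
  bernstein n (fun k => a k - b k) = bernstein n a - bernstein n b.
Proof.
elim: n a b => [|n IH] a b /=; first by rewrite polyCB.
by rewrite IH (IH (fun k => a k.+1)); ring.
Qed.

Lemma deriv_bernstein n a :
  (bernstein n.+1 a)^`() = n.+1%:R *: bernstein n (fun k => a k.+1 - a k).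
Proof.
elim: n a => [|n IH] a.
  by rewrite /= derivD !derivM derivB !derivC derivX scale1r polyCB; ring.
have -> : bernstein n.+2 a =
  (1 - 'X) * bernstein n.+1 a + 'X * bernstein n.+1 (fun k => a k.+1) by [].
rewrite derivD !derivM derivB derivC derivX !IH.
have -> : bernstein n.+1 (fun k => a k.+1 - a k) =
  (1 - 'X) * bernstein n (fun k => a k.+1 - a k)
  + 'X * bernstein n (fun k => a k.+2 - a k.+1) by [].
have E : bernstein n.+1 (fun k => a k.+1) - bernstein n.+1 a =
  (1 - 'X) * bernstein n (fun k => a k.+1 - a k)
  + 'X * bernstein n (fun k => a k.+2 - a k.+1) by rewrite -bernsteinB.
(* Differentiating the weights contributes one more copy of the degree [n.+1] polynomial of
   differences and so turns the factor [n.+1] into [n.+2]. *)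
rewrite -[n.+2]addn1 natrD scalerDl scale1r -{2}E -!mul_polyC; ring.
Qed.

Lemma derivn_bernstein n m a :
  (bernstein (n + m) a)^`(m) =
  ((n + m) ^_ m)%:R *: bernstein n (iter m (fun b k => b k.+1 - b k) a).
Proof.
elim: m a => [|m IH] a; first by rewrite addn0 ffactn0 scale1r.
rewrite addnS derivSn deriv_bernstein derivnZ IH scalerA -natrM ffactnS /= -iterSr.
by [].
Qed.

(** For [t] in [[0, 1]] each step of the recursion is a convex combination, hence monotone in the
    control values. *)
Lemma bernstein_le n a b t : 0 <= t <= 1 -> (forall k, (k <= n)%N -> a k <= b k) ->
  (bernstein n a).[t] <= (bernstein n b).[t].
Proof.
move=> /andP[t0 t1]; elim: n a b => [|n IH] a b ab /=; first by rewrite !hornerE ab.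
rewrite !hornerE; apply: lerD; apply: ler_wpM2l => //; try by rewrite subr_ge0.
  by apply: IH => k kn; apply: ab; exact: leqW.
by apply: (IH (fun k => a k.+1)) => k kn; exact: ab.
Qed.

Lemma bernstein1 n t c : (bernstein n (fun=> c)).[t] = c.
Proof. by elim: n => [|n IH] /=; rewrite !hornerE// IH; ring. Qed.

(** The second moment about [x] of the binomial law with parameters [n] and [t]: squared bias plus
    variance. *)
Lemma bernstein_sqr n t x :
  (bernstein n (fun k => (k%:R - x) ^+ 2)).[t] = (n%:R * t - x) ^+ 2 + n%:R * (t * (1 - t)).
Proof.
elim: n x => [|n IH] x /=; first by rewrite hornerC; ring.
rewrite !hornerE IH (_ : (fun k => _) = fun k : nat => (k%:R - (x - 1)) ^+ 2).
  by rewrite IH -[n.+1]addn1 natrD /=; ring.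
by apply/funext => k; rewrite -[k.+1]addn1 natrD; ring.
Qed.

(** The induction hypothesis is applied to the first differences [H k (t + w) - H k t], which are
    defined up to [be - w]; one mean value theorem follows. *)
Lemma finite_difference m H (al be x w : R) :
  deriv_seq [set t | al <= t <= be] H -> 0 <= w -> al <= x -> x + m%:R * w <= be ->
  exists2 xi, x <= xi <= x + m%:R * w &
    iter m (fun F t => F (t + w) - F t) (H 0%N) x = w ^+ m * H m xi.
Proof.
move=> dH w0; elim: m H al be x dH => [|m IH] H al be x dH alx xbe.
  by exists x; rewrite ?mul0r ?addr0 ?lexx// expr0 mul1r.
rewrite iterSr.
have mw : m.+1%:R * w = m%:R * w + w by rewrite -[m.+1]addn1 natrD mulrDl mul1r.
have [|//||xi /andP[xi1 xi2]] := IH (fun k t => H k (t + w) - H k t) al (be - w) x.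
- move=> k s /= /andP[s1 s2].
  have ds := dH k s; have dsw := dH k (s + w).
  have d1 : is_derive s 1 (fun t => H k (t + w)) (H k.+1 (s + w)).
    rewrite -[X in is_derive _ _ _ X]mulr1.
    apply: (@is_derive1_comp _ (H k) (fun t => t + w)).
      by apply: dsw => /=; lra.
    by apply: is_derive_eq; rewrite addr0.
  by apply: is_deriveB d1 _; apply: ds => /=; lra.
- by rewrite lerBrDr -addrA -mw.
have m0 : 0 <= m%:R * w by rewrite mulr_ge0.
have [|||c] := @MVT_segment R (H m) (H m.+1) xi (xi + w).
- by rewrite lerDl.
- by move=> s; rewrite in_itv /= => /andP[s1 s2]; apply: dH => /=; lra.
- apply: derivable_within_continuous => s; rewrite in_itv /= => /andP[s1 s2].
  by have [|] := dH m s => //=; lra.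
rewrite in_itv /= => /andP[c1 c2] E -> ; exists c.
  by apply/andP; split; lra.
by rewrite E addrAC subrr add0r exprSr; ring.
Qed.

(** The ratio of the factor produced by [m] differentiations in degree [N] to [N ^+ m]. Passing to
    [m.+1] multiplies it by [1 - m / N], a loss absorbed by the growth of [m ^ 2]. *)
Lemma ffact_ratio_ge N m : (m <= N)%N -> (0 < N)%N ->
  0 <= ((N ^_ m)%:R / N%:R ^+ m : R) <= 1 /\
  1 - (m ^ 2)%:R / N%:R <= ((N ^_ m)%:R / N%:R ^+ m : R).
Proof.
move=> + N0; have N0' : 0 < N%:R :> R by rewrite ltr0n.
elim: m => [_|m IH mN].
  by rewrite ffactn0 expr0 divr1 ler01 lexx /= mul0r subr0.
have [/andP[c0 c1] IH2] := IH (ltnW mN).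
have E : (N ^_ m.+1)%:R / N%:R ^+ m.+1 =
    (N ^_ m)%:R / N%:R ^+ m * (1 - m%:R / N%:R) :> R.
  rewrite ffactnSr natrM natrB 1?ltnW// exprS.
  by field; rewrite expf_neq0 ?gt_eqF.
have q0 : 0 <= m%:R / N%:R :> R by rewrite divr_ge0.
have q1 : m%:R / N%:R <= 1 :> R by rewrite ler_pdivrMr// mul1r ler_nat ltnW.
rewrite E; set c := (N ^_ m)%:R / _ in c0 c1 IH2 *; set q := m%:R / _ in q0 q1 *.
split; first by apply/andP; split; nra.
have -> : (m.+1 ^ 2)%:R / N%:R = (m ^ 2)%:R / N%:R + q + q + N%:R^-1 :> R.
  rewrite /q -[m.+1]addn1 !natrX natrD; field; exact: lt0r_neq0.
have : 0 <= N%:R^-1 :> R by rewrite invr_ge0.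
by move: IH2; set z := (m ^ 2)%:R / _; nra.
Qed.

(** The threshold on [N] depends on [H] only through [M]; this uniformity later allows the other
    coordinates as parameters. As in Bernstein's proof, the [m]-th derivative is essentially an
    average of values of [H m] near [k / N], and Chebyshev's inequality with the binomial variance
    controls the indices [k] far from [N t]. *)
Lemma bernstein_derivn_cvg m (M e : R) : 0 < e ->
  \forall N \near \oo, forall H, deriv_seq [set t | 0 <= t <= 1] H ->
    (forall k t, (k <= m.+1)%N -> 0 <= t <= 1 -> `|H k t| <= M) ->
    forall t, 0 <= t <= 1 ->
    `|(bernstein N (fun k => H 0%N (k%:R / N%:R)))^`(m).[t] - H m t| <= e.
Proof.
move=> e0.
(* [M1] is positive whatever [M] is. With [w = 1 / N] the total error will be
   [M1 * (C * w) + M1 * del], at most [2 * (M1 * del) = e]. The terms of [C] come from the offset of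
   the nodes, the variance and [ffact_ratio_ge]. *)
pose M1 : R := `|M| + 1; have M10 : 0 < M1 by rewrite ltr_wpDl.
pose del := e / (2 * M1); have del0 : 0 < del by rewrite divr_gt0 ?mulr_gt0.
pose C : R := 2 * m%:R + del^-1 + (m ^ 2)%:R.
have C0 : 0 < C by rewrite /C ltr_pwDl// ltr_wpDl ?mulr_ge0 ?invr_gt0.
near=> N.
move=> H dH HM t t01.
have N0 : (0 < N)%N by near: N; exact: nbhs_infty_gt.
have mN : (m <= N)%N by near: N; exact: nbhs_infty_ge.
have N0' : 0 < N%:R :> R by rewrite ltr0n.
pose w : R := N%:R^-1; have w0 : 0 < w by rewrite invr_gt0.
have Cw : C * w <= del.
  rewrite ler_pdivrMr// mulrC -ler_pdivrMr//; near: N.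
  exact: nbhs_infty_ger.
have Nm : (N - m + m = N)%N by rewrite subnK.
set n := (N - m)%N in Nm.
have MM1 : M <= M1 by rewrite /M1 ler_wpDr// ler_norm.
have t0 : 0 <= t by case/andP: t01.
have t1 : t <= 1 by case/andP: t01.
have nmR : n%:R + m%:R = N%:R :> R by rewrite -natrD Nm.
have wN : w * N%:R = 1 by rewrite mulVf// gt_eqF.
pose a' := iter m (fun b k => b k.+1 - b k) (fun k => H 0%N (k%:R / N%:R)).
have a'E k : a' k = iter m (fun F t => F (t + w) - F t) (H 0%N) (k%:R * w).
  have iterE m' (F : R -> R) j : iter m' (fun b k => b k.+1 - b k) (fun k => F (k%:R * w)) j =
      iter m' (fun F t => F (t + w) - F t) F (j%:R * w).
    elim: m' F j => [//|m' IH] F j; rewrite !iterSr -IH.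
    congr (iter m' _ _ j); apply/funext => i.
    by rewrite -[i.+1]addn1 natrD mulrDl mul1r.
  exact: iterE.
have kmw k : (k <= n)%N -> k%:R * w + m%:R * w <= 1.
  by move=> kn; rewrite -mulrDl -natrD ler_pdivrMr// mul1r ler_nat -Nm leq_add2r.
(* Up to [w ^+ m], the control values of the [m]-th derivative are values of [H m] at most [m / N]
   to the right of [k / N]. *)
have a'b k : (k <= n)%N -> exists2 xi, k%:R * w <= xi <= k%:R * w + m%:R * w &
    a' k = w ^+ m * H m xi.
  move=> kn; rewrite a'E; apply: (finite_difference (al := 0) (be := 1)) => //.
  - exact: ltW.
  - by rewrite mulr_ge0 ?(ltW w0).
  - exact: kmw.
have Nmk k : (k <= n)%N -> `|a' k / w ^+ m - H m t| <=
     M1 * (2 * m%:R * w + del) + M1 * (w ^+ 2 / del) * (k%:R - n%:R * t) ^+ 2.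
  move=> kn; have [xi /andP[xi1 xi2] ->] := a'b k kn.
  rewrite mulrC mulKf ?expf_neq0 ?gt_eqF//.
  have xi01 : 0 <= xi <= 1.
    have kw0 : 0 <= k%:R * w by rewrite mulr_ge0 ?(ltW w0).
    by have kw1 := kmw k kn; apply/andP; split; lra.
  have Hlip (p q : R) : 0 <= p <= 1 -> 0 <= q <= 1 -> p <= q ->
      `|H m q - H m p| <= M1 * `|q - p|.
    move=> /andP[p0 p1] /andP[q0 q1] pq.
    have [||c] := @MVT_segment R (H m) (H m.+1) p q pq.
    + by move=> s; rewrite in_itv /= => /andP[s1 s2]; apply: dH => /=; lra.
    + apply: derivable_within_continuous => s; rewrite in_itv /= => /andP[s1 s2].
      by have [|] := dH m s => //=; lra.
    rewrite in_itv /= => /andP[c1 c2] ->; rewrite normrM ler_wpM2r//.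
    by apply: le_trans MM1; apply: HM => //; lra.
  have lip : `|H m xi - H m t| <= M1 * `|xi - t|.
    have [xt|/ltW tx] := leP xi t; last exact: (Hlip t xi).
    by have := Hlip xi t xi01 t01 xt; rewrite distrC (distrC t xi).
  apply: le_trans lip _; rewrite -[X in _ <= _ + X]mulrA -mulrDr ler_wpM2l ?(ltW M10)//.
  pose z := w * `|k%:R - n%:R * t|.
  have z0 : 0 <= z by rewrite mulr_ge0// ltW.
  have kwt : `|k%:R * w - t| <= z + m%:R * w.
    have -> : k%:R * w - t = w * (k%:R - n%:R * t) - m%:R * w * t.
      have tE : t = w * (n%:R + m%:R) * t by rewrite nmR wN mul1r.
      by rewrite [X in _ - X = _]tE; ring.
    apply: le_trans (ler_normB _ _) _; rewrite normrM (gtr0_norm w0) lerD2l.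
    by rewrite ger0_norm ?mulr_ge0 ?(ltW w0)// ler_piMr ?mulr_ge0 ?(ltW w0).
  have xit : `|xi - t| <= z + 2 * m%:R * w.
    rewrite (_ : xi - t = (xi - k%:R * w) + (k%:R * w - t)); last by ring.
    apply: le_trans (ler_normD _ _) _; rewrite ger0_norm ?subr_ge0//; lra.
  (* Chebyshev's device: [z] is at most [del] or else at most [z ^+ 2 / del], whose average is
     known. *)
  have zdel : z <= del + z ^+ 2 / del.
    have zd0 : 0 <= z ^+ 2 / del by rewrite divr_ge0 ?sqr_ge0 ?ltW.
    have [zd|dz] := leP z del; first by rewrite ler_wpDr.
    by rewrite ler_wpDl ?ltW// ltr_pdivlMr// expr2 ltr_pM2l//; lra.
  have -> : w ^+ 2 / del * (k%:R - n%:R * t) ^+ 2 = z ^+ 2 / del.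
    by rewrite /z exprMn real_normK ?num_real//; ring.
  by apply: le_trans xit _; rewrite [leLHS]addrC -addrA lerD2l.
rewrite -Nm derivn_bernstein Nm hornerZ -/a'.
pose h := H m t; pose c : R := (N ^_ m)%:R * w ^+ m.
have [c01 cge] := ffact_ratio_ge mN N0.
have cE : (N ^_ m)%:R / N%:R ^+ m = c by rewrite /c exprVn.
rewrite cE in c01 cge.
pose B := (bernstein n (fun k => a' k / w ^+ m)).[t].
have -> : (N ^_ m)%:R * (bernstein n a').[t] = c * B.
  rewrite /B (_ : (fun k => _) = fun k => (w ^+ m)^-1 * a' k); last first.
    by apply/funext => k; rewrite mulrC.
  by rewrite bernsteinZ hornerZ /c; field; rewrite expf_neq0 ?gt_eqF.
pose E1 := M1 * (2 * m%:R * w + del) ; pose E2 := M1 * (w ^+ 2 / del).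
have Bd : `|B - h| <= E1 + E2 * (n%:R * (t * (1 - t))).
  have bE : (bernstein n (fun k : nat => E1 + E2 * (k%:R - n%:R * t) ^+ 2)).[t] =
      E1 + E2 * (n%:R * (t * (1 - t))).
    by rewrite bernsteinD bernsteinZ hornerD hornerZ bernstein1 bernstein_sqr; ring.
  have Bh : B - h = (bernstein n (fun k => a' k / w ^+ m - h)).[t].
    by rewrite bernsteinB hornerD hornerN bernstein1.
  rewrite ler_norml -bE Bh; apply/andP; split.
    rewrite -hornerN -scaleN1r -bernsteinZ; apply: bernstein_le => // k kn.
    by have := Nmk k kn; rewrite ler_norml mulN1r => /andP[].
  apply: bernstein_le => // k kn.
  by have := Nmk k kn; rewrite ler_norml => /andP[].
have hM : `|h| <= M1 by apply: le_trans MM1; apply: HM.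
have wn1 : w * n%:R <= 1 by rewrite mulrC ler_pdivrMr// mul1r ler_nat leq_subr.
have E20 : 0 <= M1 * (w / del) by apply: mulr_ge0; [exact: ltW|apply: divr_ge0; exact: ltW].
have E2b : E2 * (n%:R * (t * (1 - t))) <= M1 * (w / del).
  have -> : E2 * (n%:R * (t * (1 - t))) = M1 * (w / del) * (w * n%:R * (t * (1 - t))).
    by rewrite /E2 expr2; ring.
  rewrite ler_piMr//.
  have tt : 0 <= t * (1 - t) <= 1 by apply/andP; split; nra.
  have wn0 : 0 <= w * n%:R by rewrite mulr_ge0 ?(ltW w0).
  by case/andP: tt => tt0 tt1; apply: mulr_ile1.
(* Two errors: that of the average [B] against [h], and that of the ratio [c] against 1. *)
have -> : c * B - H m t = c * (B - h) - (1 - c) * h by rewrite /h; ring.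
case/andP: c01 => c0 c1.
apply: le_trans (ler_normB _ _) _; rewrite (normrM c) (normrM (1 - c)) (ger0_norm c0).
have c1' : 0 <= 1 - c by rewrite subr_ge0.
rewrite (ger0_norm c1').
have T1 : c * `|B - h| <= E1 + M1 * (w / del).
  by apply: le_trans (ler_piMl _ c1) _ => //; apply: le_trans Bd _; rewrite lerD2l.
have T2 : (1 - c) * `|h| <= (m ^ 2)%:R * w * M1.
  by apply: ler_pM => //; rewrite /w; lra.
have T3 : M1 * (C * w) <= M1 * del by rewrite ler_pM2l.
have T4 : 2 * (M1 * del) = e by rewrite /del; field; exact: lt0r_neq0.
have T5 : E1 + M1 * (w / del) + (m ^ 2)%:R * w * M1 = M1 * (C * w) + M1 * del.
  by rewrite /E1 /C; ring.
by move: T1 T2 T3 T4 T5; lra.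
Unshelve. all: by end_near. Qed.

End bernstein.

(** * Monomials, and approximation of composite functions *)

Section density.
Context {R : realType} {d : nat}.
Local Notation V := 'rV[R]_d.
Implicit Types (U O K B : set V) (f g G : V -> R) (x y v : V) (i j : 'I_d) (s : seq 'I_d).

Lemma smooth_on_coord U i : open U -> smooth_on U (fun x => x 0 i).
Proof.
move=> oU; apply: (smooth_on_affine (l := fun v => v 0 i)) => //.
  exact: coord_continuous.
by move=> x v h; rewrite !mxE.
Qed.

Definition mono s x : R := \prod_(i <- s) x 0 i.

Lemma smooth_on_mono U s : open U -> smooth_on U (mono s).
Proof. by move=> oU; apply: smooth_on_prod => // i; exact: smooth_on_coord. Qed.

Lemma deriv_seq_poly (p : {poly R}) : deriv_seq setT (fun k t => (p^`(k)).[t]).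
Proof. by move=> k t _; rewrite derivnS; exact: is_derive_poly. Qed.

Lemma deriv_seqB (O : set R) (F G : nat -> R -> R) : deriv_seq O F -> deriv_seq O G ->
  deriv_seq O (fun k t => F k t - G k t).
Proof. by move=> dF dG k t Ot; apply: is_deriveB; [exact: dF|exact: dG]. Qed.

Lemma deriv_seqS (O O' : set R) (F : nat -> R -> R) : O' `<=` O ->
  deriv_seq O F -> deriv_seq O' F.
Proof. by move=> OO dF k t /OO; exact: dF. Qed.

Lemma deriv_seq_bounded (F : nat -> R -> R) m :
  deriv_seq [set t | 0 <= t <= 1] F ->
  exists M, forall k t, (k <= m)%N -> 0 <= t <= 1 -> `|F k t| <= M.
Proof.
move=> dF.
have H k : exists2 M, 0 <= M & forall t, 0 <= t <= 1 -> `|F k t| <= M.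
  have cF : compact (F k @` `[0, 1]).
    apply: continuous_compact; last exact: segment_compact.
    apply: derivable_within_continuous => t; rewrite in_itv /= => t01.
    by have [] := dF k t t01.
  have [M [Mr HM]] := compact_bounded cF.
  exists (`|M| + 1) => [|t t01]; first by rewrite addr_ge0.
  apply: (HM (`|M| + 1)); first by rewrite ltr_pwDr// ler_norm.
  by exists t => //=; rewrite in_itv.
elim: m => [|m [M HM]].
  by have [M _ HM] := H 0%N; exists M => -[|//] t _; exact: HM.
have [M' M'0 HM'] := H m.+1; exists (`|M| + M') => k t.
rewrite leq_eqVlt => /orP[/eqP->|km] t01.
  by apply: le_trans (HM' t t01) _; rewrite lerDr.
by apply: le_trans (HM k t km t01) _; apply: le_trans (ler_norm _) _; rewrite lerDl.
Qed.

Section fixed_functional.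
Variables (U K : set V) (L : (V -> R) -> R).
Hypothesis HL : local_functional U K L.
Let oU := lf_open HL.
Let cK := lf_compact HL.
Let KU := lf_sub HL.

(** The Bernstein polynomials of [F 0] converge with all derivatives on [[0, 1]], where [tau] takes
    its values on [K]; composition with [tau] and multiplication by [W] preserve C^N smallness. On
    the rest of [U] it is enough that [tau] stays where [F] is smooth. *)
Lemma lf_kills_comp (O : set R) W tau (F : nat -> R -> R) :
  smooth_on U W -> smooth_on U tau -> (forall x, U x -> O (tau x)) ->
  (forall x, K x -> 0 <= tau x <= 1) -> [set t | 0 <= t <= 1] `<=` O -> deriv_seq O F ->
  (forall p : {poly R}, L (fun x => W x * p.[tau x]) = 0) ->
  L (fun x => W x * F 0%N (tau x)) = 0.
Proof.
move=> sW st tO tK O01 dF Lp.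
apply: (lf_cvg0 HL); first exact: smooth_onM oU sW (smooth_on_comp 0 oU dF st tO).
move=> N e e0.
have [C C0 HC] := CN_le_comp N oU cK KU st tO.
have [C' C'0 HC'] := CN_le_product N oU cK KU sW.
have CC0 : 0 < C' * C + 1 by rewrite ltr_wpDl ?mulr_ge0.
have [M HM] := deriv_seq_bounded N.+1 (deriv_seqS O01 dF).
have e'0 := divr_gt0 e0 CC0.
have [n Hn] : exists n, forall (k : 'I_N.+1) t, 0 <= t <= 1 ->
    `|(bernstein n (fun k => F 0%N (k%:R / n%:R)))^`(k).[t] - F k t| <= e / (C' * C + 1).
  have H : \forall n \near \oo, forall (k : 'I_N.+1), forall t, 0 <= t <= 1 ->
    `|(bernstein n (fun k => F 0%N (k%:R / n%:R)))^`(k).[t] - F k t| <= e / (C' * C + 1).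
    apply: filter_forall => k.
    apply: filterS (bernstein_derivn_cvg k M e'0) => n; apply.
      exact: deriv_seqS dF.
    by move=> j t jk; apply: HM; exact: leq_trans jk (ltn_ord k).
  by have [n Hn] := filter_ex H; exists n.
set p := bernstein n _ in Hn.
have dE : deriv_seq O (fun k t => (p^`(k)).[t] - F k t).
  by apply: deriv_seqB dF; exact: deriv_seqS (deriv_seq_poly p).
have sp : smooth_on U (fun x => p.[tau x]).
  exact: (@smooth_on_comp _ _ U setT (fun k t => (p^`(k)).[t]) 0 tau oU (deriv_seq_poly p) st).
exists (fun x => W x * p.[tau x]); split; [exact: smooth_onM oU sW sp|exact: Lp|].
rewrite (_ : (fun x => _) = fun x => W x * ((p^`(0)).[tau x] - F 0%N (tau x))); last first.
  by apply/funext => x; rewrite mulrBr.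
have B1 : CN_le K N (fun x => (p^`(0)).[tau x] - F 0%N (tau x)) (C * (e / (C' * C + 1))).
  apply: (HC _ _ dE) => k x kN Kx.
  exact: (Hn (Ordinal (kN : (k < N.+1)%N))) (tK x Kx).
have := HC' _ _ (smooth_on_comp 0 oU dE st tO) B1.
apply: CN_leS => //; rewrite mulrA mulrCA ler_piMr ?ltW//.
by rewrite ltr_pdivrMr// mul1r ltrDl.
Qed.

End fixed_functional.

Definition set_coord i (t : R) x : V := \row_j if j == i then t else x 0 j.

Lemma set_coordE i t x j : set_coord i t x 0 j = if j == i then t else x 0 j.
Proof. by rewrite mxE. Qed.

Lemma set_coord_id i x : set_coord i (x 0 i) x = x.
Proof. by apply/rowP => j; rewrite mxE; case: eqP => // ->. Qed.

Lemma set_coord_same i t x (h : R) :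
  set_coord i t (h *: delta_mx 0 i + x) = set_coord i t x.
Proof.
apply/rowP => j; rewrite !mxE /=; case: (eqVneq j i) => // ji.
by rewrite mulr0 add0r.
Qed.

Lemma set_coord_other i j t x (h : R) : j != i ->
  set_coord i t (h *: delta_mx 0 j + x) = h *: delta_mx 0 j + set_coord i t x.
Proof.
move=> ji; apply/rowP => k; rewrite !mxE /=; case: (eqVneq k i) => // ki.
by rewrite ki eq_sym (negPf ji) mulr0 add0r.
Qed.

Lemma set_coord_move i t x (h : R) :
  set_coord i (h + t) x = h *: delta_mx 0 i + set_coord i t x.
Proof.
apply/rowP => k; rewrite !mxE /=; case: (eqVneq k i) => _ /=.
  by rewrite mulr1.
by rewrite mulr0 add0r.
Qed.

Lemma derive_const_dir g x v : (forall h : R, g (h *: v + x) = g x) -> is_derive x v g 0.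
Proof.
move=> gc.
have gE : (fun h : R => h^-1 *: ((g \o shift x) (h *: v) - g x)) = fun=> 0.
  by apply/funext => h /=; rewrite gc subrr scaler0.
have cvl : (fun h : R => h^-1 *: ((g \o shift x) (h *: v) - g x)) @ 0^' --> (0 : R).
  by rewrite gE; exact: cvg_cst.
by split; [exact: (cvgP _ cvl)|exact: cvg_lim cvl].
Qed.

Lemma is_derive_set_coord i j t g x c : j != i ->
  is_derive (set_coord i t x) (delta_mx 0 j) g c ->
  is_derive x (delta_mx 0 j) (fun y => g (set_coord i t y)) c.
Proof.
move=> ji [g1 g2].
have E : (fun h : R => h^-1 *: (((fun y => g (set_coord i t y)) \o shift x) (h *: delta_mx 0 j)
     - g (set_coord i t x))) =
   (fun h : R => h^-1 *: ((g \o shift (set_coord i t x)) (h *: delta_mx 0 j) - g (set_coord i t x))).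
  by apply/funext => h /=; rewrite set_coord_other.
by split; [rewrite /derivable E|rewrite /derive E].
Qed.

Lemma is_derive_coord i x v : is_derive x v (fun y => y 0 i) (v 0 i).
Proof.
have cvl : (fun h : R => h^-1 *: (((fun y : V => y 0 i) \o shift x) (h *: v) - x 0 i)) @ 0^'
   --> (v 0 i : R).
  apply: (@cvg_trans _ ((fun=> v 0 i) @ (0:R)^')); last exact: cvg_cst.
  apply: near_eq_cvg; near=> h; rewrite /= !mxE addrK /GRing.scale /= mulrA mulVf ?mul1r//.
  by near: h; exact: nbhs_dnbhs_neq.
by split; [exact: (cvgP _ cvl)|exact: cvg_lim cvl].
Unshelve. all: by end_near. Qed.

End density.

Section tensor_bernstein.
Context {R : realType}.
Implicit Types (a b : nat -> R).

Lemma eq_bernstein n a b : (forall k, (k <= n)%N -> a k = b k) ->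
  bernstein n a = bernstein n b.
Proof.
elim: n a b => [|n IH] a b ab /=; first by rewrite ab.
rewrite (IH a b) ?(IH (fun k => a k.+1) (fun k => b k.+1))// => k kn; apply: ab => //.
exact: leqW.
Qed.

Lemma bernstein_sum n I (r : seq I) (F : I -> nat -> R) :
  bernstein n (fun k => \sum_(i <- r) F i k) = \sum_(i <- r) bernstein n (F i).
Proof.
elim: r => [|i r IH].
  rewrite big_nil (_ : (fun k => _) = fun k : nat => 0 * 0).
    by rewrite bernsteinZ scale0r.
  by apply/funext => k; rewrite big_nil mulr0.
rewrite big_cons -IH -bernsteinD; congr (bernstein n _).
by apply/funext => k; rewrite big_cons.
Qed.

Definition bernstein_basis n k : {poly R} := bernstein n (fun j => (j == k)%:R).

(** Separates the control values from the variable; the control values will be functions of the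
    remaining coordinates. *)
Lemma bernsteinE n a :
  bernstein n a = \sum_(k < n.+1) a k *: bernstein_basis n k.
Proof.
under eq_bigr do rewrite -bernsteinZ.
rewrite -bernstein_sum; apply: eq_bernstein => k kn.
rewrite (bigD1 (Ordinal (kn : (k < n.+1)%N)))//= eqxx mulr1 big1 ?addr0// => j jk.
case: eqP => kj; last by rewrite mulr0.
by case/eqP: jk; apply: val_inj.
Qed.

End tensor_bernstein.

Lemma continuous_shear {R : realType} {V : normedModType R} (u : V -> R) (a : V) (t : R) :
  continuous u -> continuous (fun y => (t - u y) *: a + y).
Proof.
move=> cu x; apply: cvgD; last exact: cvg_id.
by apply: cvgZr_tmp; apply: cvgB; [exact: cvg_cst|exact: cu].
Qed.

(** * Density of polynomials in several variables *)

Section polynomial_density.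
Context {R : realType} {d : nat}.
Local Notation V := 'rV[R]_d.
Implicit Types (U O K : set V) (f g phi psi : V -> R) (x y v : V) (i j : 'I_d) (s : seq 'I_d).

Section one_variable.
Variables (i : 'I_d) (B : R) (N : nat).
Hypothesis B0 : 0 < B.

Definition node (k : nat) : R := 2 * B * (k%:R / N%:R) - B.
Definition rescale (t : R) : R := (t + B) / (2 * B).

(** The Bernstein operator on [[- B, B]] in the [i]-th variable, the other coordinates being
    parameters. *)
Definition bernstein_coord phi x : R :=
  (bernstein N (fun k => phi (set_coord i (node k) x))).[rescale (x 0 i)].

Let e j : V := delta_mx 0 j.

Lemma is_derive_rescale (p : {poly R}) j x :
  is_derive x (e j) (fun y => p.[rescale (y 0 i)])
    ((j == i)%:R * (2 * B)^-1 * p^`().[rescale (x 0 i)]).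
Proof.
have d1 : is_derive x (e j) (fun y : V => y 0 i) ((j == i)%:R : R).
  by have := is_derive_coord i x (e j); rewrite /e mxE eqxx eq_sym.
have d2 (t : R) : is_derive t (1:R) rescale (2 * B)^-1.
  rewrite /rescale; apply: is_derive_eq.
  by rewrite !(addr0, scaler0, add0r) /GRing.scale /= mulr1.
have d3 : is_derive x (e j) (rescale \o (fun y : V => y 0 i)) ((2 * B)^-1 * (j == i)%:R).
  exact: is_derive_comp1.
have := @is_derive_comp1 _ _ (horner p) _ x (e j) _ _ (is_derive_poly p _) d3.
by rewrite mulrC [(2 * B)^-1 * _]mulrC.
Qed.

Definition bernstein_term m phi x : R :=
  (bernstein N (fun k => phi (set_coord i (node k) x)))^`(m).[rescale (x 0 i)].

Lemma bernstein_termE m phi x : bernstein_term m phi x =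
  \sum_(k < N.+1) phi (set_coord i (node k) x)
     * (bernstein_basis N k)^`(m).[rescale (x 0 i)].
Proof.
rewrite /bernstein_term bernsteinE linear_sum horner_sum /=.
by apply: eq_bigr => k _; rewrite derivnZ hornerZ.
Qed.

(** A derivative along [i] acts on the polynomial and costs the factor [(2 * B)^-1] of the
    rescaling; along any other coordinate it passes to [phi]. *)
Lemma is_derive_bernstein_term m phi j x : smooth_on setT phi ->
  is_derive x (e j) (bernstein_term m phi)
   (if j == i then (2 * B)^-1 * bernstein_term m.+1 phi x
    else bernstein_term m ('D_(e j) phi) x).
Proof.
move=> sphi.
rewrite (_ : bernstein_term m phi = \sum_(k < N.+1) (fun x => phi (set_coord i (node k) x)
     * (bernstein_basis N k)^`(m).[rescale (x 0 i)])); last first.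
  by apply/funext => y; rewrite bernstein_termE fct_sumE.
have [ji|ji] := eqVneq j i.
  rewrite bernstein_termE mulr_sumr; apply: is_derive_sum => k.
  have d1 : is_derive x (e j) (fun y => phi (set_coord i (node k) y)) 0.
    by apply: derive_const_dir => h; rewrite /e ji set_coord_same.
  have := is_deriveM d1 (is_derive_rescale (bernstein_basis N k)^`(m) j x).
  rewrite ji eqxx mul1r scaler0 addr0 -derivnS => D.
  by apply: is_derive_eq; rewrite /GRing.scale /= mulrCA.
rewrite bernstein_termE; apply: is_derive_sum => k.
have d1 := is_derive_set_coord ji (smooth_on_is_derive (e j) sphi (I : setT (set_coord i (node k) x))).
have := is_deriveM d1 (is_derive_rescale (bernstein_basis N k)^`(m) j x).
rewrite (negPf ji) !mul0r scaler0 add0r => D.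
by apply: is_derive_eq; rewrite /GRing.scale /= mulrC.
Qed.

Lemma pd_bernstein_coord s phi x : smooth_on setT phi ->
  pd s (bernstein_coord phi) x =
  ((2 * B)^-1) ^+ count (pred1 i) s *
    bernstein_term (count (pred1 i) s) (pd (seq.filter (predC1 i) s) phi) x.
Proof.
move=> sphi; elim: s x => [|j s IH] x; first by rewrite /= expr0 mul1r.
rewrite pd_cons.
have E : pd s (bernstein_coord phi) = fun x => ((2 * B)^-1) ^+ count (pred1 i) s *
    bernstein_term (count (pred1 i) s) (pd (seq.filter (predC1 i) s) phi) x.
  by apply/funext => y; exact: IH.
have sp := smooth_on_pd (seq.filter (predC1 i) s) sphi.
have [_ D] := is_deriveZ (((2 * B)^-1) ^+ count (pred1 i) s)
  (is_derive_bernstein_term (count (pred1 i) s) j x sp).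
rewrite E; have -> : (fun x => ((2 * B)^-1) ^+ count (pred1 i) s *
    bernstein_term (count (pred1 i) s) (pd (seq.filter (predC1 i) s) phi) x) =
    ((2 * B)^-1) ^+ count (pred1 i) s \*:
    bernstein_term (count (pred1 i) s) (pd (seq.filter (predC1 i) s) phi) by [].
rewrite D /=; case: (eqVneq j i) => ji /=.
  by rewrite add1n exprSr /GRing.scale /= mulrA.
by rewrite add0n.
Qed.

End one_variable.

Lemma pd_move U i s1 s2 g x : open U -> smooth_on U g -> U x ->
  pd (s1 ++ i :: s2) g x = pd (i :: s1 ++ s2) g x.
Proof.
move=> oU sg Ux.
have pdc (t1 t2 : seq 'I_d) : pd (t1 ++ t2) g = pd t1 (pd t2 g).
  by rewrite /pd map_cat /iter_derive foldr_cat.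
rewrite -cat_cons !pdc -(pd_swap s1 i oU (smooth_on_pd s2 sg) Ux).
by rewrite pd_rcons.
Qed.

(** By symmetry of mixed derivatives all letters [i] can be moved to the front. *)
Lemma pd_count i s g x : smooth_on setT g ->
  pd s g x = pd (nseq (count (pred1 i) s) i ++ seq.filter (predC1 i) s) g x.
Proof.
move=> sg; elim: s x => [//|j s IH] x.
have E : pd s g = pd (nseq (count (pred1 i) s) i ++ seq.filter (predC1 i) s) g.
  by apply/funext => y; exact: IH.
have -> : pd (j :: s) g x =
    pd (j :: nseq (count (pred1 i) s) i ++ seq.filter (predC1 i) s) g x.
  by rewrite (pd_cons j s) E.
rewrite /=; case: (eqVneq j i) => [->|ji] //=.
by rewrite add0n [RHS](pd_move _ _ _ openT sg).
Qed.

Lemma is_derive_set_coord_line psi i (B t : R) x : smooth_on setT psi ->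
  is_derive t (1:R) (fun t => psi (set_coord i (2 * B * t - B) x))
    (2 * B * 'D_(delta_mx 0 i) psi (set_coord i (2 * B * t - B) x)).
Proof.
move=> sp.
have E (s : R) : set_coord i s x = s *: delta_mx 0 i + set_coord i 0 x.
  by rewrite -set_coord_move addr0.
have d1 (s : R) : is_derive s (1:R) (fun s : R => psi (set_coord i s x))
    ('D_(delta_mx 0 i) psi (set_coord i s x)).
  rewrite (_ : (fun s : R => _) = fun s : R => psi (s *: delta_mx 0 i + set_coord i 0 x)).
    by rewrite (E s); apply: is_derive_line; exact: smooth_on_is_derive sp I.
  by apply/funext => u; rewrite -E.
have d2 : is_derive t (1:R) (fun t => 2 * B * t - B) (2 * B).
  by apply: is_derive_eq; rewrite subr0 /GRing.scale /= mulr1.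
have D := @is_derive1_comp _ _ (fun t : R => 2 * B * t - B) t _ _ (d1 (2 * B * t - B)) d2.
by apply: (is_derive_eq D); rewrite [LHS]mulrC.
Qed.

Lemma coord_norm_le x j : `|x 0 j| <= `|x|.
Proof.
rewrite [leRHS]/Num.norm /= mx_normrE.
exact: (le_bigmax _ (fun ij => `|x ij.1 ij.2|) (ord0, j)).
Qed.

Lemma row_norm_le x (B : R) : 0 <= B -> (forall j, `|x 0 j| <= B) -> `|x| <= B.
Proof.
move=> B0 xB; rewrite [leLHS]/Num.norm /= mx_normrE.
by apply: bigmax_le => // -[k j] _ /=; rewrite (ord1 k).
Qed.

Lemma set_coord_ball i (B t : R) x : `|x| <= B -> `|t| <= B -> `|set_coord i t x| <= B.
Proof.
move=> xB tB; have B0 : 0 <= B by apply: le_trans xB.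
apply: row_norm_le => // j; rewrite set_coordE; case: eqP => // _.
exact: le_trans (coord_norm_le x j) xB.
Qed.

Lemma smooth_on_set_coord psi i t : smooth_on setT psi ->
  smooth_on setT (fun x => psi (set_coord i t x)).
Proof.
move=> sp; apply: (@smooth_on_coind _ _ setT
   [set g | exists2 h, smooth_on setT h & g = fun x => h (set_coord i t x)] openT).
- move=> g [h sh ->] x _.
  apply: (@continuous_comp _ _ _ (set_coord i t) h); last exact: smooth_on_continuous sh I.
  rewrite (_ : set_coord i t = fun y => (t - y 0 i) *: delta_mx 0 i + y); last first.
    apply/funext => y; apply/rowP => j; rewrite !mxE /=.
    by case: (eqVneq j i) => [->|_] /=; rewrite ?mulr1 ?mulr0 ?add0r// subrK.
  exact: continuous_shear (@coord_continuous _ _ _ _ _) x.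
- move=> g [h sh ->] v.
  pose v0 := set_coord i 0 v.
  have setD x (h' : R) : set_coord i t (h' *: v + x) = h' *: v0 + set_coord i t x.
    by apply/rowP => j; rewrite !mxE; case: (eqVneq j i) => _; rewrite ?mulr0 ?add0r.
  exists (fun x => 'D_v0 h (set_coord i t x)).
    by exists ('D_v0 h); [exact: smooth_on_derive|].
  move=> x _; have [h1 h2] := smooth_on_is_derive v0 sh (I : setT (set_coord i t x)).
  have E : (fun k : R => k^-1 *: (((fun y => h (set_coord i t y)) \o shift x) (k *: v)
     - h (set_coord i t x))) =
     (fun k : R => k^-1 *: ((h \o shift (set_coord i t x)) (k *: v0) - h (set_coord i t x))).
    by apply/funext => k /=; rewrite setD.
  by split; [rewrite /derivable E|rewrite /derive E].
- by exists psi.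
Qed.

Lemma smooth_on_bernstein_sum i B n phi (c : nat -> {poly R}) : smooth_on setT phi ->
  smooth_on setT (fun x => \sum_(k < n.+1)
      phi (set_coord i (node B n k) x) * (c k).[rescale B (x 0 i)]).
Proof.
move=> sphi; apply: (smooth_on_sum _ openT) => k; apply: (smooth_onM openT).
  exact: smooth_on_set_coord.
have sr : smooth_on setT (fun x : V => rescale B (x 0 i)).
  apply: (smooth_onM openT); last exact: (smooth_on_cst (2 * B)^-1 openT).
  exact: smooth_onD openT (smooth_on_coord i openT) (smooth_on_cst B openT).
exact: (smooth_on_comp 0 openT (deriv_seq_poly (c k)) sr).
Qed.

(** The one-variable theorem on the line through [x] in direction [i], for derivatives of [phi]
    along the other coordinates. The degree does not depend on [x], since these derivatives are
    bounded on a box that contains [K] and is stable under the relevant [set_coord]. *)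
Lemma bernstein_coord_cvg K i (B : R) N phi (e : R) : 1 <= B ->
  (forall x, K x -> `|x| <= B) -> smooth_on setT phi -> 0 < e ->
  exists n, CN_le K N (fun x => bernstein_coord i B n phi x - phi x) e.
Proof.
move=> B1 KB sphi e0.
have B0 : 0 < B by exact: lt_le_trans B1.
pose box : set V := [set x | `|x| <= B].
have cbox : compact box.
  apply: bounded_closed_compact.
    by exists B; split; [rewrite num_real|move=> b Bb x /= xB; apply: le_trans xB (ltW Bb)].
  apply: (@closed_comp _ _ (fun x : V => `|x|) [set t | t <= B]); last exact: closed_le.
  by move=> x _; exact: norm_continuous.
(* At most [N] derivatives along the other coordinates and [N.+1] along [i], because the
   one-variable estimate of order [m] involves order [m.+1]. The power of [2 * B] in [M] is the
   chain rule for the rescaling; it dominates the lower powers as [2 * B] is at least 1. *)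
have [M0 M00 HM0] := CN_bound (N + N.+1) openT cbox (@subsetT _ _) sphi.
pose M := (2 * B) ^+ N.+1 * M0.
have B2 : 1 <= 2 * B by lra.
have [n Hn] : exists n, forall (m : 'I_N.+1) H, deriv_seq [set t | 0 <= t <= 1] H ->
    (forall k t, (k <= m.+1)%N -> 0 <= t <= 1 -> `|H k t| <= M) ->
    forall t, 0 <= t <= 1 ->
    `|(bernstein n (fun k => H 0%N (k%:R / n%:R)))^`(m).[t] - H m t| <= e.
  have H : \forall n \near \oo, forall (m : 'I_N.+1), forall H, deriv_seq [set t | 0 <= t <= 1] H ->
    (forall k t, (k <= m.+1)%N -> 0 <= t <= 1 -> `|H k t| <= M) ->
    forall t, 0 <= t <= 1 ->
    `|(bernstein n (fun k => H 0%N (k%:R / n%:R)))^`(m).[t] - H m t| <= e.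
    by apply: filter_forall => m; exact: bernstein_derivn_cvg.
  by have [n Hn] := filter_ex H; exists n.
exists n => s x sN Kx.
have sb : smooth_on setT (bernstein_coord i B n phi).
  rewrite (_ : bernstein_coord i B n phi = fun x => \sum_(k < n.+1)
      phi (set_coord i (node B n k) x) * (bernstein_basis n k).[rescale B (x 0 i)]); last first.
    by apply/funext => y; exact: (bernstein_termE i B n 0).
  exact: smooth_on_bernstein_sum.
rewrite (pdB s openT sb sphi I) (pd_bernstein_coord i B n s x sphi) (pd_count i s x sphi).
set m := count (pred1 i) s; set s' := seq.filter (predC1 i) s.
have mN : (m < N.+1)%N by rewrite ltnS (leq_trans _ sN)// count_size.
have s'N : (size s' <= N)%N by rewrite (leq_trans _ sN)// size_filter count_size.
(* The successive derivatives of [pd s' phi] along [i], reparametrized by [t] in [[0, 1]]. *)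
pose H k t := (2 * B) ^+ k * pd (nseq k i ++ s') phi (set_coord i (2 * B * t - B) x).
have xB := KB x Kx.
have dH : deriv_seq [set t | 0 <= t <= 1] H.
  move=> k t _; rewrite /H exprSr -mulrA.
  exact: is_deriveZ (is_derive_set_coord_line i B t x (smooth_on_pd (nseq k i ++ s') sphi)).
have HM k t : (k <= m.+1)%N -> 0 <= t <= 1 -> `|H k t| <= M.
  move=> km /andP[t0 t1]; rewrite /H /M normrM; apply: ler_pM => //.
    rewrite ger0_norm ?exprn_ge0 ?mulr_ge0 ?(ltW B0)//.
    by apply: ler_weXn2l => //; exact: leq_trans km _.
  apply: HM0; last by apply: set_coord_ball => //; rewrite ler_norml; apply/andP; split; nra.
  by rewrite size_cat size_nseq addnC leq_add// (leq_trans km).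
pose t := rescale B (x 0 i).
have xi : - B <= x 0 i <= B.
  by rewrite -ler_norml; exact: le_trans (coord_norm_le x i) xB.
have t01 : 0 <= t <= 1.
  by case/andP: xi => x1 x2; rewrite /t /rescale ler_pdivrMr ?divr_ge0; lra.
have tE : 2 * B * t - B = x 0 i by rewrite /t /rescale; field; exact: lt0r_neq0.
have := Hn (Ordinal mN) H dH HM t t01.
rewrite /H tE set_coord_id /= expr0.
set P := (bernstein n _)^`(m).[t].
have -> : bernstein_term i B n m (pd s' phi) x = P.
  rewrite /P /bernstein_term -/t; congr ((bernstein n _)^`(m).[t]).
  by apply/funext => k; rewrite mul1r.
set D := pd _ phi x => HP.
have Bm : 1 <= (2 * B) ^+ m by exact: exprn_ege1.
have Bm0 : 0 < (2 * B) ^+ m by exact: lt_le_trans Bm.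
(* Undoing the rescaling divides the error by [(2 * B) ^+ m], which is at least 1. *)
have -> : (2 * B)^-1 ^+ m * P - D = ((2 * B) ^+ m)^-1 * (P - (2 * B) ^+ m * D).
  by rewrite exprVn; field; exact: lt0r_neq0.
rewrite normrM ger0_norm ?invr_ge0 ?(ltW Bm0)//.
by apply: le_trans HP; rewrite ler_piMl// invf_le1.
Qed.

Section fixed_functional.
Variables (U K : set V) (L : (V -> R) -> R).
Hypothesis HL : local_functional U K L.
Let oU := lf_open HL.
Let cK := lf_compact HL.
Let KU := lf_sub HL.

Lemma lf_kills_smooth : (forall s, L (mono s) = 0) ->
  forall phi, smooth_on setT phi -> L phi = 0.
Proof.
move=> Lmono phi sphi.
have sU psi : smooth_on setT psi -> smooth_on U psi by apply: smooth_onS.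
have [B [B1 KB]] : exists B : R, 1 <= B /\ forall x, K x -> `|x| <= B.
  have [M [_ HM]] := compact_bounded cK.
  exists (`|M| + 1); split; first by rewrite lerDr.
  by move=> x; apply: HM; rewrite ltr_pwDr// ler_norm.
have B0 : 0 < B by exact: lt_le_trans B1.
(* Coordinates are made polynomial one at a time: [psi] depends on the last [n] only, and [mono s]
   collects the powers produced so far. The claim is the case [n = d] with the empty word. *)
suff gen n : (n <= d)%N -> forall psi s, smooth_on setT psi ->
    (forall x y, (forall j : 'I_d, (d - n <= j)%N -> x 0 j = y 0 j) -> psi x = psi y) ->
    L (fun x => mono s x * psi x) = 0.
  rewrite (_ : phi = fun x => mono [::] x * phi x).
    apply: (gen d) => // x y xy; congr phi; apply/rowP => j; apply: xy.
    by rewrite subnn.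
  by apply/funext => x; rewrite /mono big_nil mul1r.
elim: n => [_ psi s sp psic|n IH nd psi s sp psic].
  rewrite (_ : (fun x => _) = fun x => psi 0 * mono s x).
    by rewrite (lf_scale HL _ (smooth_on_mono s oU)) Lmono mulr0.
  apply/funext => x; rewrite mulrC; congr (_ * _); apply: psic => j.
  by rewrite subn0 leqNgt ltn_ord.
have id : (d - n.+1 < d)%N by rewrite ltn_subrL /= (leq_trans _ nd).
(* The first coordinate on which [psi] may still depend. *)
pose i := Ordinal id.
apply: (lf_cvg0 HL); first exact: smooth_onM oU (smooth_on_mono s oU) (sU _ sp).
move=> N e e0.
have [C C0 HC] := CN_le_product N oU cK KU (smooth_on_mono s oU).
have C1 : 0 < C + 1 by rewrite ltr_wpDl.
have [m Hm] := bernstein_coord_cvg i N B1 KB sp (divr_gt0 e0 C1).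
have bE : bernstein_coord i B m psi = fun x => \sum_(k < m.+1)
      psi (set_coord i (node B m k) x) * (bernstein_basis m k).[rescale B (x 0 i)].
  by apply/funext => y; exact: (bernstein_termE i B m 0).
have sb : smooth_on setT (bernstein_coord i B m psi).
  by rewrite bE; exact: smooth_on_bernstein_sum.
exists (fun x => mono s x * bernstein_coord i B m psi x); split.
- exact: smooth_onM oU (smooth_on_mono s oU) (sU _ sb).
- rewrite bE.
  (* The basis polynomial rewritten in [x 0 i] itself: its monomials merge into [mono s], and the
     remaining factor [psi (set_coord i _ x)] no longer depends on coordinate [i]. *)
  pose q k : {poly R} := bernstein_basis m k \Po ((2 * B)^-1%:P * ('X + B%:P)).
  have qE k (x : V) : (bernstein_basis m k).[rescale B (x 0 i)] = (q k).[x 0 i].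
    by rewrite /q horner_comp !hornerE mulrC.
  rewrite (_ : (fun x => _) = fun x => \sum_(k < m.+1) \sum_(l < size (q k))
     (q k)`_l * (mono (nseq l i ++ s) x * psi (set_coord i (node B m k) x))); last first.
    apply/funext => x; rewrite mulr_sumr; apply: eq_bigr => k _.
    rewrite qE horner_coef !mulr_sumr; apply: eq_bigr => l _.
    rewrite /mono big_cat /= big_nseq -/(mono s x).
    have -> : iter l ( *%R (x 0 i)) 1 = x 0 i ^+ l.
      by elim: (nat_of_ord l) => [|l' IHl] /=; rewrite ?expr0// exprS IHl.
    by ring.
  have sm k l : smooth_on U (fun x => mono (nseq l i ++ s) x * psi (set_coord i (node B m k) x)).
    exact: smooth_onM oU (smooth_on_mono _ oU) (sU _ (smooth_on_set_coord i _ sp)).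
  apply: (lf_sum0 HL) => k.
    by apply: (smooth_on_sum _ oU) => l; exact: smooth_onZ oU (sm _ _).
  apply: (lf_sum0 HL) => l; first exact: smooth_onZ oU (sm _ _).
  rewrite (lf_scale HL _ (sm _ _)).
  suff -> : L (fun x => mono (nseq l i ++ s) x * psi (set_coord i (node B m k) x)) = 0.
    by rewrite mulr0.
  apply: (IH (ltnW nd) (fun x => psi (set_coord i (node B m k) x))).
    exact: smooth_on_set_coord.
  move=> x y xy; apply: psic => j jn; rewrite !set_coordE; case: eqP => // ji.
  apply: xy; move: jn; rewrite leq_eqVlt => /orP[/eqP jd|].
    by case: ji; apply: val_inj.
  by rewrite /i /= subnSK.
- rewrite (_ : (fun x => _) = fun x => mono s x * (bernstein_coord i B m psi x - psi x)).
    have := HC _ _ (smooth_onB oU (sU _ sb) (sU _ sp)) Hm; apply: CN_leS => //.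
    by rewrite mulrCA ler_piMr ?ltW// ltr_pdivrMr// mul1r ltrDl.
  by apply/funext => x; rewrite mulrBr.
Qed.

End fixed_functional.
End polynomial_density.

(** * Powers of the distance *)

Section riesz_kernel.
Context {R : realType} {d : nat}.
Local Notation V := 'rV[R]_d.
Implicit Types (U O K B : set V) (f g G : V -> R) (x y v : V) (i j : 'I_d) (s : seq 'I_d).

Definition away0 : set V := [set x | 0 < dot x x].

Lemma smooth_on_dot U y : open U -> smooth_on U (fun x => dot (x - y) (x - y)).
Proof.
move=> oU; apply: (smooth_on_sum _ oU) => i.
have sc : smooth_on U (fun x => (x - y) 0 i).
  apply: (eq_smooth_on oU (f := fun x => x 0 i - y 0 i)); first by move=> x _; rewrite !mxE.
  exact: smooth_onB oU (smooth_on_coord i oU) (smooth_on_cst _ oU).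
exact: (smooth_onM oU sc sc).
Qed.

Lemma smooth_on_dot0 U : open U -> smooth_on U (fun x => dot x x).
Proof.
move=> oU; have := smooth_on_dot 0 oU.
by apply: eq_smooth_on => // x _; rewrite subr0.
Qed.

Lemma open_away0 : open away0.
Proof.
apply: (@open_comp _ _ (fun x : V => dot x x) [set t | 0 < t]); last exact: open_gt.
by move=> x _; exact: smooth_on_continuous (smooth_on_dot0 openT) I.
Qed.

Lemma is_derive_dot i x : is_derive x (delta_mx 0 i : V) (fun y => dot y y) (2 * x 0 i).
Proof.
rewrite (_ : (fun y => _) = \sum_(j < d) (fun y : V => y 0 j * y 0 j)); last first.
  by apply/funext => y; rewrite fct_sumE.
have -> : 2 * x 0 i = \sum_(j < d) (x 0 j * (j == i)%:R + x 0 j * (j == i)%:R).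
  rewrite (bigD1 i)//= eqxx mulr1 big1 ?addr0 => [|j ji]; first by ring.
  by rewrite (negPf ji) mulr0 addr0.
apply: is_derive_sum => j.
have D := is_derive_coord j x (delta_mx 0 i : V).
rewrite mxE eqxx /= in D.
have := is_deriveM D D; exact.
Qed.

Definition powR_seq (a : R) (k : nat) (s : R) : R :=
  (\prod_(l < k) (a - l%:R)) * s `^ (a - k%:R).

Lemma deriv_seq_powR (a : R) : deriv_seq [set s | 0 < s] (powR_seq a).
Proof.
move=> k s s0; rewrite /powR_seq big_ord_recr /=.
have := is_deriveZ (\prod_(l < k) (a - l%:R)) (is_derive1_powR (a - k%:R) s0).
move=> D; apply: (is_derive_eq D); rewrite /GRing.scale /= -mulrA; congr (_ * (_ * _)).
by congr (_ `^ _); rewrite -[k.+1]addn1 natrD; ring.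
Qed.

Lemma deriv_seq_affine (O : set R) (F : nat -> R -> R) (al be : R) : deriv_seq O F ->
  deriv_seq [set t | O (al + be * t)] (fun k t => be ^+ k * F k (al + be * t)).
Proof.
move=> dF k t /= Ot.
have d2 : is_derive t (1:R) (fun t : R => al + be * t) be.
  by apply: is_derive_eq; rewrite add0r mul1r [_%:A]mulr1.
have D := @is_derive1_comp _ _ (fun t : R => al + be * t) t _ _ (dF k _ Ot) d2.
apply: (is_derive_eq (is_deriveZ (be ^+ k) D)).
by rewrite exprSr /GRing.scale /=; ring.
Qed.

(** The kernel [|x|^(2a)], a real power of a polynomial; [a = (1 - d) / 2] gives [|x|^(1 - d)]. *)
Definition riesz (a : R) x : R := dot x x `^ a.

Lemma smooth_on_riesz a : smooth_on away0 (riesz a).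
Proof.
have := smooth_on_comp 0 open_away0 (deriv_seq_powR a) (smooth_on_dot0 open_away0) (fun x h => h).
apply: eq_smooth_on; first exact: open_away0.
by move=> x _; rewrite /powR_seq big_ord0 mul1r subr0.
Qed.

Lemma is_derive_riesz a i x : away0 x ->
  is_derive x (delta_mx 0 i : V) (riesz a) (2 * a * (x 0 i * riesz (a - 1) x)).
Proof.
move=> x0.
have D := @is_derive_comp1 _ _ _ (fun y : V => dot y y) x _ _ _ (is_derive1_powR a x0) (is_derive_dot i x).
by apply: (is_derive_eq D); rewrite /riesz; ring.
Qed.

Lemma rieszS a x : away0 x -> dot x x * riesz (a - 1) x = riesz a x.
Proof.
move=> x0; rewrite /riesz -[X in X * _](powRr1 (ltW x0)) -powRD ?subrKC//.
by apply/implyP => _; rewrite (gt_eqF x0).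
Qed.

Lemma laplacian_riesz a x : away0 x ->
  \sum_i 'D_(delta_mx 0 i) ('D_(delta_mx 0 i) (riesz a)) x =
  2 * a * (d%:R + 2 * a - 2) * riesz (a - 1) x.
Proof.
move=> x0.
have E i : 'D_(delta_mx 0 i) ('D_(delta_mx 0 i) (riesz a)) x =
   2 * a * (riesz (a - 1) x + 2 * (a - 1) * (x 0 i * x 0 i) * riesz (a - 1 - 1) x).
  rewrite (near_eq_derive _ (g := fun x => 2 * a * (x 0 i * riesz (a - 1) x))); last first.
    apply: filterS (open_nbhs_nbhs (conj open_away0 x0)) => y y0.
    by have [_ ->] := is_derive_riesz a i y0.
  have D1 := is_derive_coord i x (delta_mx 0 i : V).
  have D := is_deriveZ (2 * a) (is_deriveM D1 (is_derive_riesz (a - 1) i x0)).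
  have [_ DE] := D; rewrite mxE !eqxx in DE.
  have -> : (fun x => 2 * a * (x 0 i * riesz (a - 1) x)) =
    (2 * a \*: ((fun y : V => y 0 i) * riesz (a - 1))) by [].
  by rewrite DE /GRing.scale /=; ring.
rewrite (eq_bigr _ (fun i _ => E i)) -mulr_sumr big_split /= sumr_const card_ord.
rewrite -mulr_suml -mulr_sumr -/(dot x x) -(mulrA (2 * (a - 1))) rieszS//.
by rewrite -mulr_natr; ring.
Qed.

(** The words obtained by deleting one occurrence of [i] from [s], one for each occurrence: the
    Leibniz rule for the monomial of [s]. *)
Fixpoint deriv_mono i s : seq (seq 'I_d) :=
  if s is j :: s' then
    (if j == i then [:: s'] else [::]) ++ [seq j :: t | t <- deriv_mono i s']
  else [::].

Lemma size_deriv_mono i s t : t \in deriv_mono i s -> (size t < size s)%N.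
Proof.
elim: s t => [//|j s IH] t /=; rewrite mem_cat => /orP[|/mapP[t' /IH h ->]]//.
by case: eqP => // _; rewrite inE => /eqP ->.
Qed.

Lemma is_derive_mono i s x : is_derive x (delta_mx 0 i : V) (mono s)
  (\sum_(t <- deriv_mono i s) mono t x).
Proof.
elim: s => [|j s IH].
  rewrite /= big_nil (_ : mono [::] = fun=> 1); first exact: is_derive_cst.
  by apply/funext => y; rewrite /mono big_nil.
rewrite (_ : mono (j :: s) = (fun y : V => y 0 j) * mono s); last first.
  by apply/funext => y; rewrite /mono big_cons.
have D := is_deriveM (is_derive_coord j x (delta_mx 0 i : V)) IH.
apply: (is_derive_eq D); rewrite /= mxE eqxx /= big_cat /= big_map addrC.
congr (_ + _); last first.
  by case: (j == i); rewrite /= ?big_seq1 ?big_nil /GRing.scale /= ?mulr1 ?mulr0.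
rewrite /GRing.scale /= mulr_sumr; apply: eq_bigr => t _.
by rewrite /mono big_cons.
Qed.

Section fixed_functional.
Variables (U K : set V) (L : (V -> R) -> R) (B : set V).
Hypothesis HL : local_functional U K L.
Hypothesis oB : open B.
Hypothesis UB : forall x y, U x -> B y -> away0 (x - y).
Let oU := lf_open HL.
Let cK := lf_compact HL.
Let KU := lf_sub HL.
Let sT g y : smooth_on away0 g -> B y -> smooth_on U (fun x => g (x - y)).
Proof. exact: smooth_on_translates UB. Qed.

Lemma kills_translates_laplacian g : smooth_on away0 g -> kills_translates L B g ->
  kills_translates L B (fun x => \sum_i 'D_(delta_mx 0 i) ('D_(delta_mx 0 i) g) x).
Proof.
move=> sg Lg y By.
have s1 i := smooth_on_derive (delta_mx 0 i) sg.
have s2 i := smooth_on_derive (delta_mx 0 i) (s1 i).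
apply: (@lf_sum0 _ _ _ _ _ HL _ (index_enum _)
  (fun i x => 'D_(delta_mx 0 i) ('D_(delta_mx 0 i) g) (x - y))) => i.
  exact: sT (s2 i) By.
exact: (kills_translates_derive HL i open_away0 oB UB (s1 i)
  (kills_translates_derive HL i open_away0 oB UB sg Lg) By).
Qed.

Lemma kills_riesz_pred a : 2 * a * (d%:R + 2 * a - 2) != 0 ->
  kills_translates L B (riesz a) -> kills_translates L B (riesz (a - 1)).
Proof.
move=> a0 La y By; set c := 2 * a * _ in a0.
have sy := sT (smooth_on_riesz (a - 1)) By.
apply: (mulfI a0); rewrite mulr0 -(lf_scale HL c sy).
rewrite -(kills_translates_laplacian (smooth_on_riesz a) La By); apply/(eq_lf HL).
  exact: smooth_onZ oU sy.
by move=> x Ux; rewrite laplacian_riesz//; exact: UB.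
Qed.

Lemma kills_riesz_nat (a : R) (m : nat) :
  (forall j : nat, kills_translates L B (riesz (a - j%:R))) ->
  kills_translates L B (fun x => dot x x ^+ m).
Proof.
move=> La y By.
have soq := smooth_on_dot y oU.
have q0 x : U x -> 0 < dot (x - y) (x - y) by move=> Ux; exact: UB.
have ss : smooth_on U (fun x => riesz (-1) (x - y)) by exact: sT (smooth_on_riesz _) By.
have [M M0 HM] := compact_smooth_bound cK KU soq.
have [M' M'0 HM'] := compact_smooth_bound cK KU ss.
(* An affine change brings [|x - y|^(-2)] into [[0, 1]] on [K]: [al] lies below its values there and
   [al + be] above them. Positivity of [al] keeps [al + be * t] inside the domain of the power
   function for all [t] in [[0, 1]]. *)
pose al : R := (M + 1)^-1; pose be : R := M' + 1.
have M1 : 0 < M + 1 by rewrite ltr_wpDl.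
have al0 : 0 < al by rewrite invr_gt0.
have be0 : 0 < be by rewrite ltr_wpDl.
have sE x : U x -> riesz (-1) (x - y) = (dot (x - y) (x - y))^-1.
  by move=> Ux; rewrite /riesz powR_inv1// ltW// q0.
pose tau x := (riesz (-1) (x - y) - al) * be^-1.
have tauE x : al + be * tau x = riesz (-1) (x - y).
  by rewrite /tau; field; exact: lt0r_neq0.
have st : smooth_on U tau.
  apply: (smooth_onM oU); last exact: (smooth_on_cst be^-1 oU).
  exact: smooth_onB oU ss (smooth_on_cst al oU).
have K01 x : K x -> 0 <= tau x <= 1.
  move=> Kx; have Ux := KU Kx; rewrite /tau; apply/andP; split.
    apply: divr_ge0; last exact: ltW.
    rewrite subr_ge0 sE// /al lef_pV2 ?posrE ?q0//.
    by apply: le_trans (ler_norm _) _; apply: le_trans (HM x Kx) _; rewrite lerDl.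
  rewrite ler_pdivrMr// mul1r /be.
  have := le_trans (ler_norm _) (HM' x Kx); lra.
(* With [s = |x - y|^(-2)], the even power [|x - y|^(2m)] is [|x - y|^(2a)] times [s ^ (a - m)]. *)
have dF := deriv_seq_affine (al := al) (be := be) (deriv_seq_powR (a - m%:R)).
rewrite -(lf_kills_comp HL (W := fun x => riesz a (x - y)) _ st _ K01 _ dF).
- apply: (eq_lf HL).
    apply: (eq_smooth_on oU (f := fun x => \prod_(i < m) dot (x - y) (x - y))).
      by move=> x _; rewrite prodr_const card_ord.
    exact: (smooth_on_prod (index_enum 'I_m) oU (fun _ => soq)).
  move=> x Ux; rewrite expr0 mul1r /powR_seq big_ord0 mul1r subr0 tauE /riesz -powRrM.
  rewrite -powRD; last by apply/implyP => _; rewrite gt_eqF ?q0.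
  by rewrite (_ : a + _ = m%:R) ?powR_mulrn ?ltW ?q0//; ring.
- exact: sT (smooth_on_riesz a) By.
- by move=> x Ux /=; rewrite tauE sE// invr_gt0 q0.
- move=> t /= /andP[t0 t1]; rewrite ltr_pwDl// mulr_ge0// ltW//.
(* [q] turns [p] of [tau] into a polynomial in [|x - y|^(-2)]; its monomial of degree [l] times
   [|x - y|^(2a)] is the kernel of exponent [a - l]. *)
move=> p; pose q := p \Po (be^-1%:P * ('X - al%:P)).
rewrite (_ : (fun x => _) = fun x => riesz a (x - y) * q.[riesz (-1) (x - y)]); last first.
  apply/funext => x; rewrite /q horner_comp !hornerE /tau; congr (_ * horner p _).
  by rewrite mulrC.
have sj (j : nat) : smooth_on U (fun x => q`_j * riesz (a - j%:R) (x - y)).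
  exact: smooth_onZ oU (sT (smooth_on_riesz _) By).
rewrite -(@lf_sum0 _ _ _ _ _ HL _ (index_enum 'I_(size q))
  (fun (l : 'I_(size q)) x => q`_l * riesz (a - l%:R) (x - y))).
- apply/esym/(eq_lf HL).
    exact: (smooth_on_sum (index_enum 'I_(size q)) oU (fun l => sj l)).
  move=> x Ux; rewrite horner_coef mulr_sumr; apply: eq_bigr => l _.
  rewrite [RHS]mulrCA; congr (_ * _).
  rewrite /riesz -[X in _ = _ * X]powR_mulrn ?powR_ge0// -powRrM -powRD.
    by congr (_ `^ _); ring.
  by apply/implyP => _; rewrite gt_eqF ?q0.
- by move=> l; exact: sj.
- by move=> l; rewrite (lf_scale HL _ (sT (smooth_on_riesz _) By)) La// mulr0.
Qed.

(** Differentiating [x^s |x|^(2(m + 1))] along [i] gives [2 (m + 1) x_i x^s |x|^(2m)] plus terms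
    with shorter words. Induction on the length of the word, for all [m] together, disposes of
    everything but the wanted term. *)
Lemma kills_mono_dot : (forall m : nat, kills_translates L B (fun x => dot x x ^+ m)) ->
  forall s (m : nat), kills_translates L B (fun x => mono s x * dot x x ^+ m).
Proof.
move=> Lm s; move: {2}(size s) (leqnn (size s)) => n; elim: n s => [|n IH] s sn m.
  move=> y By; case: s sn => // _; rewrite -(Lm m y By); congr L.
  by apply/funext => x; rewrite /mono big_nil mul1r.
case: s sn => [_|i s]; first exact: (IH [::]).
rewrite ltnS => sn.
have sdm k : smooth_on away0 (fun x => dot x x ^+ k).
  apply: (eq_smooth_on open_away0 (f := fun x => \prod_(i < k) dot x x)).
    by move=> x _; rewrite prodr_const card_ord.
  by apply: (smooth_on_prod _ open_away0) => _; exact: smooth_on_dot0 open_away0.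
have sg t k : smooth_on away0 (fun x => mono t x * dot x x ^+ k).
  exact: smooth_onM open_away0 (smooth_on_mono t open_away0) (sdm k).
have D := kills_translates_derive HL i open_away0 oB UB (sg s m.+1) (IH s sn m.+1).
have DE x : 'D_(delta_mx 0 i) (fun x => mono s x * dot x x ^+ m.+1) x =
   (2 * m.+1%:R) * (mono (i :: s) x * dot x x ^+ m) +
   \sum_(t <- deriv_mono i s) (mono t x * dot x x ^+ m.+1).
  have D1 := is_derive_mono i s x.
  have DX : is_derive (dot x x) (1:R) (fun t => t ^+ m.+1) (m.+1%:R * dot x x ^+ m).
    rewrite (_ : (fun t => _) = horner ('X^(m.+1) : {poly R})); last first.
      by apply/funext => t; rewrite hornerXn.
    apply: (is_derive_eq (is_derive_poly _ _)).
    by rewrite derivXn hornerMn hornerXn mulr_natl.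
  have [_ DM] := is_deriveM D1 (@is_derive_comp1 _ _ _ (fun y : V => dot y y) x _ _ _ DX (is_derive_dot i x)).
  rewrite -[LHS]/('D_(delta_mx 0 i) (mono s * ((fun t => t ^+ m.+1) \o (fun y => dot y y))) x).
  have mE : mono (i :: s) x = x 0 i * mono s x by rewrite /mono big_cons.
  by rewrite DM /GRing.scale /= mE -mulr_suml; ring.
have sr : smooth_on away0 (fun x => \sum_(t <- deriv_mono i s) (mono t x * dot x x ^+ m.+1)).
  exact: smooth_on_sum open_away0 (fun t => sg t m.+1).
move=> y By.
have c0 : 2 * m.+1%:R != 0 :> R by rewrite mulf_neq0// pnatr_eq0.
apply: (mulfI c0); rewrite mulr0 -(lf_scale HL _ (sT (sg _ _) By)).
have Lr : L (fun x => \sum_(t <- deriv_mono i s) (mono t (x - y) * dot (x - y) (x - y) ^+ m.+1)) = 0.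
  have : forall t, t \in deriv_mono i s -> (size t <= n)%N.
    by move=> t /size_deriv_mono /ltnW; move/leq_trans; apply.
  elim: (deriv_mono i s) => [_|t ts IHt tn].
    rewrite (_ : (fun _ => _) = fun=> 0 * 0); last first.
      by apply/funext => x; rewrite big_nil mulr0.
    by rewrite (lf_scale HL 0 (smooth_on_cst 0 oU)) mul0r.
  rewrite (_ : (fun _ => _) = fun x => mono t (x - y) * dot (x - y) (x - y) ^+ m.+1 +
    \sum_(t <- ts) (mono t (x - y) * dot (x - y) (x - y) ^+ m.+1)); last first.
    by apply/funext => x; rewrite big_cons.
  have st := sT (sg t m.+1) By.
  have sts : smooth_on U (fun x => \sum_(t <- ts) (mono t (x - y) * dot (x - y) (x - y) ^+ m.+1)).
    exact: smooth_on_sum oU (fun t => sT (sg t m.+1) By).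
  rewrite (lf_add HL st sts) IHt ?addr0; last by move=> t' t'ts; apply: tn; rewrite inE t'ts orbT.
  by apply: (IH t _ m.+1 y By); apply: tn; rewrite mem_head.
have := D y By.
rewrite (_ : (fun x => _) = fun x => 2 * m.+1%:R * (mono (i :: s) (x - y) * dot (x - y) (x - y) ^+ m) +
    \sum_(t <- deriv_mono i s) (mono t (x - y) * dot (x - y) (x - y) ^+ m.+1)); last first.
  by apply/funext => x; exact: DE.
by rewrite (lf_add HL (smooth_onZ _ oU (sT (sg _ _) By)) (sT sr By)) Lr addr0.
Qed.

Theorem lf_riesz_kills_smooth : (2 <= d)%N -> B 0 ->
  kills_translates L B (riesz (- (d%:R - 1) / 2)) ->
  forall phi, smooth_on setT phi -> L phi = 0.
Proof.
move=> d2 B0 L0; have d2' : 2 <= d%:R :> R by rewrite ler_nat.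
apply: (lf_kills_smooth HL) => s.
have Lj (j : nat) : kills_translates L B (riesz (- (d%:R - 1) / 2 - j%:R)).
  elim: j => [|j IH]; first by rewrite subr0.
  rewrite (_ : _ - j.+1%:R = - (d%:R - 1) / 2 - j%:R - 1); last first.
    by rewrite -[j.+1]addn1 natrD; ring.
  (* At [a = (1 - d) / 2 - j] the two factors are [2 a = 1 - d - 2 j] and [d + 2 a - 2 = - 1 - 2 j].
     Both are negative; for [j = 0] the first one would vanish in dimension 1. *)
  apply: kills_riesz_pred IH.
  have j0 : 0 <= j%:R :> R by [].
  rewrite mulf_neq0//; first by rewrite mulf_neq0// lt_eqF//; lra.
  by rewrite lt_eqF//; lra.
(* The pole [y = 0] and the power [m = 0] leave the bare monomial. *)
have := kills_mono_dot (fun m => kills_riesz_nat m Lj) s 0 B0.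
by move=> <-; congr L; apply/funext => x; rewrite subr0 expr0 mulr1.
Qed.

End fixed_functional.
End riesz_kernel.

(** * A flat function and smooth steps *)

Section flat_function.
Context {R : realType}.
Implicit Types (x y t : R).

(** With [w = 1 / x], the derivative in [x] of [p(w) exp(- w)] is [w^2 (p(w) - p'(w)) exp(- w)]. *)
Fixpoint flat_poly k : {poly R} :=
  if k is k'.+1 then 'X^2 * (flat_poly k' - (flat_poly k')^`()) else 1.

(* The successive derivatives of the function equal to [exp (- 1 / x)] for
   [0 < x] and to [0] elsewhere. *)
Definition flat_seq k x : R :=
  if 0 < x then (flat_poly k).[x^-1] * expR (- x^-1) else 0.

(** From [exp w >= w^(n + 1) / (n + 1)!] with [n] the size of [p]. With [w = 1 / h] the bound
    [C / w] becomes [C h], which gives differentiability at 0. *)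
Lemma poly_expR_le (p : {poly R}) : exists2 C : R, 0 <= C &
  forall w, 1 <= w -> `|p.[w] * expR (- w)| <= C / w.
Proof.
pose S : R := \sum_(i < size p) `|p`_i|; pose n := size p.
have S0 : 0 <= S by apply: sumr_ge0.
exists (S * (n.+1)`!%:R) => [|w w1]; first by rewrite mulr_ge0.
have w0 : 0 < w by exact: lt_le_trans w1.
have pw : `|p.[w]| <= S * w ^+ n.
  rewrite horner_coef; apply: le_trans (ler_norm_sum _ _ _) _.
  rewrite mulr_suml; apply: ler_sum => i _; rewrite normrM ler_wpM2l//.
  rewrite ger0_norm ?exprn_ge0 ?(ltW w0)//; apply: ler_weXn2l => //.
  exact: ltnW (ltn_ord i).
have we : w ^+ n * w <= (n.+1)`!%:R * expR w.
  have H := expR_ge1Dxn n (ltW w0).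
  have f0 : 0 < (n.+1)`!%:R :> R by rewrite ltr0n fact_gt0.
  rewrite -exprSr mulrC -ler_pdivrMr//; apply: le_trans H; by rewrite lerDr.
rewrite normrM (ger0_norm (expR_ge0 _)) ler_pdivlMr// expRN.
rewrite -mulrA [_^-1 * w]mulrC mulrA ler_pdivrMr ?expR_gt0// -mulrA.
apply: le_trans (ler_wpM2r (ltW w0) pw) _; rewrite -!mulrA.
by apply: ler_wpM2l.
Qed.

Lemma deriv_seq_flat : deriv_seq setT flat_seq.
Proof.
move=> k x _; have [x0|x0|->] := ltgtP x 0.
- have E : flat_seq k.+1 x = 0 by rewrite /flat_seq ltNge (ltW x0).
  rewrite E; apply: near_eq_is_derive (is_derive_cst (0:R) x (1:R)).
  have nx : \forall y \near x, y < 0 by apply: open_nbhs_nbhs; split; [exact: open_lt|].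
  apply: filterS nx => y y0.
  by rewrite /flat_seq ltNge (ltW y0).
- have xn0 : x != 0 by rewrite gt_eqF.
  have dV : is_derive x (1:R) (fun y : R => y^-1) (- (x ^- 2)).
    apply: (is_derive_eq (is_deriveV xn0 (is_derive_id x (1:R)))).
    by rewrite [_ *: _]mulr1.
  have dN (w : R) : is_derive w (1:R) (fun w : R => expR (- w)) (- expR (- w)).
    apply: (is_derive_eq (@is_derive1_comp _ expR (fun w : R => - w) w _ _ (is_derive_expR _) _)).
    by rewrite mulrN1.
  have dp (w : R) := is_deriveM (is_derive_poly (flat_poly k) w) (dN w).
  have D := @is_derive1_comp _ _ (fun y : R => y^-1) x _ _ (dp x^-1) dV.
  apply: (@near_eq_is_derive _ _ _ (fun y => (flat_poly k).[y^-1] * expR (- y^-1))).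
    have nx : \forall y \near x, 0 < y by apply: open_nbhs_nbhs; split; [exact: open_gt|].
    apply: filterS nx => y y0.
    by rewrite /flat_seq y0.
  apply: (is_derive_eq D); rewrite /flat_seq x0 /= /GRing.scale /= !hornerE -exprVn; ring.
(* The factor ['X] stands for the [h^-1] of the difference quotient at 0. *)
have [C C0 HC] := poly_expR_le ('X * flat_poly k).
have E m : flat_seq m 0 = 0 by rewrite /flat_seq ltxx.
rewrite E.
have cvl : (fun h : R => h^-1 *: ((flat_seq k \o shift 0) (h *: (1:R)) - flat_seq k 0)) @ 0^'
    --> (0 : R).
  apply/cvgrPdist_le => e e0; near=> h; rewrite sub0r normrN E subr0 /= addr0 [_%:A]mulr1.
  have h1 : `|h| <= 1 by near: h; apply: dnbhs0_le.
  have he : `|h| <= e / (C + 1) by near: h; apply: dnbhs0_le; rewrite divr_gt0// ltr_wpDl.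
  rewrite /flat_seq; case: ifPn => h0; last by rewrite scaler0 normr0 ltW.
  have hV : 1 <= h^-1 by rewrite invf_ge1//; apply: le_trans (ler_norm _) h1.
  have := HC _ hV; rewrite hornerM hornerX -mulrA invrK; move=> /le_trans; apply.
  move: he; rewrite gtr0_norm// ler_pdivlMr ?ltr_wpDl// mulrDr mulr1 mulrC.
  by apply: le_trans; rewrite lerDl ltW.
by split; [exact: (cvgP _ cvl)|exact: cvg_lim cvl].
Unshelve. all: by end_near. Qed.

Lemma flat_gt0 x : 0 < x -> 0 < flat_seq 0 x.
Proof. by move=> x0; rewrite /flat_seq x0 hornerC mul1r expR_gt0. Qed.

Lemma flat_eq0 x : x <= 0 -> flat_seq 0 x = 0.
Proof. by move=> x0; rewrite /flat_seq ltNge x0. Qed.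

Lemma flat_ge0 x : 0 <= flat_seq 0 x.
Proof. by have [/flat_gt0/ltW//|/flat_eq0->] := ltP 0 x. Qed.

Definition smooth_step t := flat_seq 0 t * (flat_seq 0 t + flat_seq 0 (1 - t))^-1.

Lemma smooth_step0 t : t <= 0 -> smooth_step t = 0.
Proof. by move=> t0; rewrite /smooth_step flat_eq0// mul0r. Qed.

Lemma smooth_step1 t : 1 <= t -> smooth_step t = 1.
Proof.
move=> t1; rewrite /smooth_step (flat_eq0 (x := 1 - t)) ?subr_le0// addr0 mulfV// gt_eqF//.
by apply: flat_gt0; exact: lt_le_trans t1.
Qed.

Lemma smooth_on_step (V : normedModType R) (U : set V) (u : V -> R) : open U ->
  smooth_on U u -> smooth_on U (fun z => smooth_step (u z)).
Proof.
move=> oU su.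
have s1 := smooth_on_comp 0 oU deriv_seq_flat su (fun z _ => I).
have s2 := smooth_on_comp 0 oU deriv_seq_flat (smooth_onB oU (smooth_on_cst 1 oU) su) (fun z _ => I).
have sp := smooth_onD oU s1 s2.
(* A number [t] and [1 - t] are never both nonpositive, so the denominator of [smooth_step] stays
   positive. *)
have p0 z : U z -> 0 < flat_seq 0 (u z) + flat_seq 0 (1 - u z).
  move=> _; have [u0|u0] := ltP 0 (u z).
    by rewrite ltr_pwDl ?flat_gt0 ?flat_ge0.
  by rewrite ltr_wpDl ?flat_ge0// flat_gt0// subr_gt0 (le_lt_trans u0).
apply: (smooth_onM oU s1).
apply: (eq_smooth_on oU _ (smooth_on_comp 0 oU (deriv_seq_powR (-1)) sp p0)) => z Uz.
by rewrite /powR_seq big_ord0 mul1r subr0 powR_inv1// ltW// p0.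
Qed.

End flat_function.

(** * Euclidean balls and bump functions *)

Section euclidean_balls.
Context {R : realType} {d : nat}.
Local Notation V := 'rV[R]_d.
Implicit Types (x y a : V) (c : R).

Lemma dot_ge0 x : 0 <= dot x x.
Proof. by apply: sumr_ge0 => i _; rewrite -expr2 sqr_ge0. Qed.

Lemma enorm_ge0 x : 0 <= enorm x.
Proof. exact: sqrtr_ge0. Qed.

Lemma sqr_enorm x : enorm x ^+ 2 = dot x x.
Proof. by rewrite sqr_sqrtr// dot_ge0. Qed.

Lemma enorm_lt x c : 0 < c -> (enorm x < c) = (dot x x < c ^+ 2).
Proof. by move=> c0; rewrite -sqr_enorm ltr_sqr ?nnegrE ?enorm_ge0 ?ltW. Qed.

Lemma norm_le_enorm x : `|x| <= enorm x.
Proof.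
apply: row_norm_le; first exact: enorm_ge0.
move=> j; rewrite -sqrtr_sqr; apply: ler_wsqrtr; rewrite /dot (bigD1 j)//= expr2 lerDl.
by apply: sumr_ge0 => i _; rewrite -expr2 sqr_ge0.
Qed.

(** Closed balls by squared radius, so that membership is a polynomial inequality. *)
Definition sqball a c : set V := [set x | dot (x - a) (x - a) <= c].

Lemma dot_sub_continuous a : continuous (fun x : V => dot (x - a) (x - a)).
Proof. by move=> x; exact: smooth_on_continuous (smooth_on_dot a openT) I. Qed.

Lemma closed_sqball a c : closed (sqball a c).
Proof.
apply: (@closed_comp _ _ (fun x : V => dot (x - a) (x - a)) [set t | t <= c]).
  by move=> x _; exact: dot_sub_continuous.
exact: closed_le.
Qed.

Lemma compact_sqball a c : compact (sqball a c).
Proof.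
apply: bounded_closed_compact; last exact: closed_sqball.
exists (`|a| + Num.sqrt c); split; first by rewrite num_real.
move=> M aM x /= xc; apply: le_trans (ltW aM).
rewrite -[x](subrK a) addrC; apply: le_trans (ler_normD _ _) _; rewrite lerD2l.
by apply: le_trans (norm_le_enorm _) _; exact: ler_wsqrtr.
Qed.

Lemma open_sqball a c : open [set x : V | dot (x - a) (x - a) < c].
Proof.
apply: (@open_comp _ _ (fun x : V => dot (x - a) (x - a)) [set t | t < c]).
  by move=> x _; exact: dot_sub_continuous.
exact: open_lt.
Qed.

Lemma sqball_nbhs (U : set V) a : open U -> U a -> exists2 c : R, 0 < c & sqball a c `<=` U.
Proof.
move=> oU Ua.
have /nbhs_normP[e /= e0 He] : nbhs a U by apply: open_nbhs_nbhs.
exists ((e / 2) ^+ 2); first by rewrite exprn_gt0// divr_gt0.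
move=> x /= xa; apply: He; rewrite /ball_/= distrC.
apply: le_lt_trans (norm_le_enorm _) _.
rewrite enorm_lt//; apply: le_lt_trans xa _.
by rewrite ltr_sqr ?nnegrE ?divr_ge0 ?ltW// ltr_pdivrMr// mulr_natr mulr2n ltrDl.
Qed.

Definition bump a c x : R := 1 - smooth_step (dot (x - a) (x - a) / c - 1).

Lemma smooth_on_bump a c : smooth_on setT (bump a c).
Proof.
apply: (smooth_onB openT (smooth_on_cst 1 openT)); apply: (smooth_on_step openT).
apply: (smooth_onB openT _ (smooth_on_cst 1 openT)).
exact: (smooth_onM openT (smooth_on_dot a openT) (smooth_on_cst c^-1 openT)).
Qed.

Lemma bump1 a c x : 0 < c -> dot (x - a) (x - a) <= c -> bump a c x = 1.
Proof.
by move=> c0 xc; rewrite /bump smooth_step0 ?subr0// subr_le0 ler_pdivrMr// mul1r.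
Qed.

Lemma bump0 a c x : 0 < c -> 2 * c <= dot (x - a) (x - a) -> bump a c x = 0.
Proof.
by move=> c0 xc; rewrite /bump smooth_step1 ?subrr// lerBrDr ler_pdivlMr.
Qed.

End euclidean_balls.

(** * Pairing with real functions, and vanishing off the support *)

Section real_pairing.
Context {R : realType} {d : nat}.
Local Notation V := 'rV[R]_d.
Local Open Scope complex_scope.
Variable f : compact_distribution R d.
Implicit Types (g h : V -> R) (x y a : V).

Definition rpair g : R[i] := f (fun x => (g x)%:C).

Lemma smooth_fun_real g : smooth_on setT g -> smooth_fun (fun x => (g x)%:C).
Proof. by move=> sg; split; [exact: sg|exact: (smooth_on_cst 0 openT)]. Qed.

Lemma rpair_lin (c : R) g h : smooth_on setT g -> smooth_on setT h ->
  rpair (fun x => c * g x + h x) = c%:C * rpair g + rpair h.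
Proof.
move=> sg sh; rewrite /rpair.
rewrite -(pairing_linear f _ (smooth_fun_real sg) (smooth_fun_real sh)).
by congr (pairing f _); apply/funext => x; rewrite rmorphD rmorphM.
Qed.

Lemma rpairD g h : smooth_on setT g -> smooth_on setT h ->
  rpair (fun x => g x + h x) = rpair g + rpair h.
Proof.
move=> sg sh; have := rpair_lin 1 sg sh; rewrite mul1r => <-.
by congr rpair; apply/funext => x; rewrite mul1r.
Qed.

Lemma rpair0 : rpair (fun=> 0) = 0.
Proof.
have s0 : smooth_on setT (fun=> 0 : R) := smooth_on_cst 0 (@openT V).
apply: (addrI (rpair (fun=> 0))); rewrite addr0 -(rpairD s0 s0).
by congr rpair; apply/funext => x; rewrite addr0.
Qed.

Lemma rpairZ (c : R) g : smooth_on setT g -> rpair (fun x => c * g x) = c%:C * rpair g.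
Proof.
move=> sg; have := rpair_lin c sg (smooth_on_cst 0 openT); rewrite rpair0 addr0 => <-.
by congr rpair; apply/funext => x; rewrite addr0.
Qed.

Lemma rpairB g h : smooth_on setT g -> smooth_on setT h ->
  rpair (fun x => g x - h x) = rpair g - rpair h.
Proof.
move=> sg sh; have := rpair_lin (-1) sh sg; rewrite rmorphN1 mulN1r addrC => <-.
by congr rpair; apply/funext => x; rewrite mulN1r addrC.
Qed.

Lemma pairing_ReIm phi : smooth_fun phi ->
  f phi = rpair (fun x => complex.Re (phi x)) + 'i * rpair (fun x => complex.Im (phi x)).
Proof.
move=> [sr si]; rewrite /rpair addrC.
rewrite -(pairing_linear f 'i (smooth_fun_real si) (smooth_fun_real sr)).
by congr (pairing f _); apply/funext => x; rewrite addrC [LHS]complexE.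
Qed.

Lemma rpair_bound : exists K N (c : R), [/\ compact K, 0 <= c &
  forall g M, smooth_on setT g -> 0 <= M -> CN_le K N g M ->
    Normc.normc (rpair g) <= c * M].
Proof.
have [K [N [c [cK Hc]]]] := pairing_continuous f.
exists K, N, `|c|; split => // g M sg M0 gM.
apply: le_trans (Hc _ (smooth_fun_real sg)) _.
set S := seminorm K N _.
have : 0 <= S <= M.
  have PE s x : Normc.normc (partial s (fun x => (g x)%:C) x) = `|pd s g x|.
    rewrite /partial (_ : iter_derive _ (fun y => complex.Im _) x = 0).
      by rewrite /= expr0n addr0 sqrtr_sqr.
    elim: s x => [//|i s IH] x /=.
    rewrite (_ : iter_derive _ _ = fun=> 0); last by apply/funext => y; exact: IH.
    exact: derive_cst.
  rewrite /S /seminorm; set A := [set r | _].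
  (* [K] may be empty; the supremum of the empty set is 0. *)
  have [A0|/set0P/negP/negPn/eqP->] := pselect (A !=set0); last by rewrite sup0 lexx.
  have AM : ubound A M by move=> _ [s [x [sN Kx ->]]]; rewrite PE; exact: gM.
  rewrite ge_sup// andbT; have [a Aa] := A0.
  apply: le_trans (ub_le_sup _ Aa); last by exists M.
  by case: Aa => [s [x [_ _ ->]]]; rewrite PE.
move=> /andP[S0 SM]; apply: le_trans (ler_norm _) _; rewrite normrM (ger0_norm S0).
exact: ler_wpM2l.
Qed.

Lemma rpair_supp (S U : set V) g : smooth_on setT g -> compact S -> S `<=` U ->
  (forall x, ~ S x -> g x = 0) -> dist_vanishes_on f U -> rpair g = 0.
Proof.
move=> sg cS SU gS fU.
have supS : support (fun x => (g x)%:C) `<=` S.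
  have clS : closed S by apply: compact_closed => //; exact: norm_hausdorff.
  rewrite [X in _ `<=` X](proj1 (closure_id S) clS); apply: closure_subset => x /= gx.
  by apply: contrapT => /gS g0; rewrite g0 eqxx in gx.
apply: fU; last exact: subset_trans supS SU.
split; first exact: smooth_fun_real.
by apply: subclosed_compact cS supS; exact: closed_closure.
Qed.

(** A partition of unity in product form. Around each point of [S] there is a bump whose product
    with any smooth function is killed by [f]; hence a factor [1 - bump] does not change the pairing
    with [g], and after finitely many such factors the product vanishes on all of [S]. *)
Lemma rpair_vanish (S O : set V) g : smooth_on setT g -> compact S -> S `<=` O ->
  (forall x, O x -> ~ spt f x) -> (forall x, ~ S x -> g x = 0) -> rpair g = 0.
Proof.
move=> sg cS SO Of gS.
have /choice[c Hc] : forall a : V, exists c : R, S a ->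
    0 < c /\ forall h, smooth_on setT h -> rpair (fun x => h x * bump a c x) = 0.
  move=> a; have [Sa|nSa] := pselect (S a); last by exists 0.
  have := Of a (SO a Sa); move=> /contrapT[U [/= oU fU] Ua].
  have [c c0 cU] := sqball_nbhs oU Ua.
  (* [bump a (c / 2)] vanishes beyond squared radius [c], thus outside a ball contained in [U]. *)
  exists (c / 2) => _; split; first by rewrite divr_gt0.
  move=> h sh; apply: (@rpair_supp (sqball a c) U (fun x => h x * bump a (c / 2) x)
    _ _ cU _ fU); [|exact: compact_sqball|].
    exact: smooth_onM openT sh (smooth_on_bump a _).
  move=> x /= /negP; rewrite -ltNge => cx; rewrite bump0 ?mulr0//; first by rewrite divr_gt0.
  by rewrite mulrC divfK// ltW.
have := cS; rewrite compact_cover => /(_ V S (fun a => [set x | dot (x - a) (x - a) < c a])).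
case.
- by move=> a _; exact: open_sqball.
- move=> x Sx; exists x => //=; rewrite subrr.
  have [c0 _] := Hc x Sx; apply: le_lt_trans c0; rewrite /dot big1// => i _.
  by rewrite mxE mul0r.
move=> D DS SD.
pose prod (l : seq V) x := \prod_(a <- l) (1 - bump a (c a) x).
have sprod l : smooth_on setT (prod l).
  apply: (smooth_on_prod l openT) => a.
  exact: smooth_onB openT (smooth_on_cst 1 openT) (smooth_on_bump a (c a)).
have E (l : seq V) : {subset l <= D} -> rpair g = rpair (fun x => g x * prod l x).
  elim: l => [_|a l IH al].
    by congr rpair; apply/funext => x; rewrite /prod big_nil mulr1.
  rewrite IH; last by move=> b bl; apply: al; rewrite inE bl orbT.
  have Sa : S a by apply/set_mem/DS/al; rewrite mem_head.
  have [_ Ha] := Hc a Sa.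
  have sgp := smooth_onM openT sg (sprod l).
  rewrite -[LHS]subr0 -(Ha _ sgp) -(rpairB sgp).
    by congr rpair; apply/funext => x; rewrite /prod big_cons; ring.
  exact: smooth_onM openT sgp (smooth_on_bump a (c a)).
rewrite (E (enum_fset D)) => [|//]; rewrite -[RHS]rpair0; congr rpair; apply/funext => x.
have [Sx|nSx] := pselect (S x); last by rewrite gS// mul0r.
have [a /= aD xa] := SD x Sx.
have Sa : S a by exact/set_mem/DS.
have [ca _] := Hc a Sa.
rewrite /prod (perm_big _ (perm_to_rem aD)) big_cons /= bump1 ?ltW// subrr mul0r mulr0//.
Qed.

End real_pairing.

(** * Affine substitutions in Lebesgue integrals *)

Section affine_substitution.
Context {R : realType}.
Local Notation T := (measurableTypeR R).
Local Notation lambda := (@lebesgue_measure R).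
Implicit Types (s a : R).
Local Open Scope ereal_scope.

Lemma measurable_affine s a : measurable_fun setT (fun t : T => (s * t + a)%R : T).
Proof.
by apply: measurable_funD => //; apply: measurable_funM.
Qed.

Lemma affine_itv_measure s a (x y : R) : s != 0%R ->
  lambda `]x, y]%classic =
  `|s|%:E * lambda ((fun t => (s * t + a)%R) @^-1` `]x, y]%classic).
Proof.
move=> s0; have [s_gt0|s_lt0|/esym/eqP] := ltgtP 0%R s; last by rewrite (negPf s0).
- rewrite (_ : _ @^-1` _ = `]((x - a) / s)%R, ((y - a) / s)%R]%classic); last first.
    apply/seteqP; split => t /=; rewrite !in_itv /= ltr_pdivrMr// ler_pdivlMr//;
    by rewrite (mulrC t) ltrBlDr lerBrDr.
  rewrite !lebesgue_measure_itv /= !lte_fin ltr_pM2r ?invr_gt0// ltrD2r.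
  case: ifPn => _; last by rewrite mule0.
  rewrite gtr0_norm// -!EFinD -EFinM; congr (_%:E).
  by field.
- rewrite (_ : _ @^-1` _ = `[((y - a) / s)%R, ((x - a) / s)%R[%classic); last first.
    apply/seteqP; split => t /=; rewrite !in_itv /= ltr_ndivlMr// ler_ndivrMr//;
    by rewrite (mulrC t) ltrBlDr lerBrDr andbC.
  rewrite !lebesgue_measure_itv /= !lte_fin ltr_nM2r ?invr_lt0// ltrD2r.
  case: ifPn => _; last by rewrite mule0.
  rewrite ltr0_norm// -!EFinD -EFinM; congr (_%:E).
  by field.
Qed.

Lemma ge0_integral_affine s a (F : T -> \bar R) : s != 0%R ->
  measurable_fun setT F -> (forall t, 0 <= F t) ->
  \int[lambda]_t F t = `|s|%:E * \int[lambda]_t F (s * t + a)%R.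
Proof.
move=> s0 mF F0.
pose k : {nonneg R} := NngNum (normr_ge0 s).
pose phi (t : T) : T := (s * t + a)%R.
have mphi : measurable_fun setT phi by exact: measurable_affine.
(* By uniqueness of the measure with given values on half-open intervals, [lambda] is [|s|] times
   its image under the affine map. *)
pose nu : {measure set T -> \bar R} := mscale k (pushforward lambda phi).
rewrite (eq_measure_integral (nu mphi)).
  rewrite /nu ge0_integral_mscale//.
  by rewrite ge0_integral_pushforward.
move=> A mA _; apply: (@lebesgue_measure_unique R (nu mphi)) => // X [[x y] _ <-].
exact: affine_itv_measure.
Qed.

End affine_substitution.

Section tuple_integrals.
Context {R : realType}.
Local Notation T := (measurableTypeR R).
Local Notation lambda := (@lebesgue_measure R).
Local Open Scope ereal_scope.

Lemma measurable_tcons n : measurable_fun setT (@tcons R n).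
Proof. exact: measurable_cons. Qed.

Lemma integral_lebesgue_tupleS n (F : n.+1.-tuple T -> \bar R) :
  measurable_fun setT F -> (forall t, 0 <= F t) ->
  \int[lebesgue_tuple R n.+1]_t F t =
  \int[lambda]_x \int[lebesgue_tuple R n]_t F (tcons (x, t)).
Proof.
move=> mF F0.
rewrite /= /cons_measure ge0_integral_pushforward//; last exact: measurable_tcons.
rewrite preimage_setT fubini_tonelli1//; last by move=> x; exact: F0.
by apply: measurableT_comp => //; exact: measurable_tcons.
Qed.

Definition affine_tuple n (s : R) (a t : n.-tuple T) : n.-tuple T :=
  [tuple (s * tnth t i + tnth a i)%R | i < n].

Lemma measurable_affine_tuple n s a : measurable_fun setT (@affine_tuple n s a).
Proof.
apply/measurable_fun_tnthP => i.
rewrite (_ : _ \o _ = fun t : n.-tuple T => (s * tnth t i + tnth a i)%R : T).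
  apply: (@measurableT_comp _ _ _ _ _ _ (fun u : T => (s * u + tnth a i)%R : T)).
    exact: measurable_affine.
  exact: measurable_tnth.
by apply/funext => t /=; rewrite tnth_mktuple.
Qed.

(** Tonelli splits off the first coordinate, and each coordinate contributes a factor [|s|]. *)
Lemma ge0_integral_affine_tuple n (s : R) a (F : n.-tuple T -> \bar R) : s != 0%R ->
  measurable_fun setT F -> (forall t, 0 <= F t) ->
  \int[lebesgue_tuple R n]_t F t =
  (`|s| ^+ n)%:E * \int[lebesgue_tuple R n]_t F (affine_tuple s a t).
Proof.
move=> s0; elim: n a F => [|n IH] a F mF F0.
  rewrite expr0 mul1e; apply: eq_integral => t _; congr F.
  by rewrite (tuple0 t) [RHS]tuple0.
have mtc (x : T) : measurable_fun setT (fun t : n.-tuple T => tcons (x, t)).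
  by apply: measurable_cons; [exact: measurable_cst|exact: measurable_id].
have mFx x : measurable_fun setT (fun t => F (tcons (x, t))).
  by apply: measurableT_comp => //; exact: mtc.
have [a0 [a' aE]] : exists (a0 : T) (a' : n.-tuple T), a = [tuple of a0 :: a'].
  by case/tupleP: a => a0 a'; exists a0, a'.
have tE x t : affine_tuple s a (tcons (x, t)) =
    tcons ((s * x + a0)%R, affine_tuple s a' t).
  apply: eq_from_tnth => i; rewrite tnth_mktuple aE /tcons /=.
  by have [j ->|->] := unliftP ord0 i; rewrite ?tnthS ?tnth0 ?tnth_mktuple.
rewrite integral_lebesgue_tupleS// [in RHS]integral_lebesgue_tupleS//; last first.
  by apply: measurableT_comp => //; exact: measurable_affine_tuple.
have mFT : measurable_fun setT (fun p : T * n.-tuple T => F (tcons p)).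
  by apply: measurableT_comp => //; exact: measurable_tcons.
pose H x := \int[lebesgue_tuple R n]_t F (tcons (x, t)).
have mH : measurable_fun setT H.
  exact: (measurable_fun_fubini_tonelli_F (m2 := lebesgue_tuple R n) _ mFT (fun p => F0 (tcons p))).
have H0 x : 0 <= H x by apply: integral_ge0.
rewrite (ge0_integral_affine (a0) s0 mH H0).
rewrite exprS EFinM -muleA; congr (_ * _).
rewrite -ge0_integralZl_EFin//.
- apply: eq_integral => x _; rewrite /H (IH a' _ (mFx _))//; congr (_ * _).
  by apply: eq_integral => t _; rewrite tE.
- by move=> x _; apply: integral_ge0.
- have maT : measurable_fun setT (fun p : T * n.-tuple T =>
      F (tcons ((s * p.1 + a0)%R, affine_tuple s a' p.2))).
    apply: measurableT_comp => //; apply: measurable_cons.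
      apply: (@measurableT_comp _ _ _ _ _ _ (fun u : T => (s * u + a0)%R : T)) => //.
      exact: measurable_affine.
    apply: (@measurableT_comp _ _ _ _ _ _ (affine_tuple s a')) => //.
    exact: measurable_affine_tuple.
  have := measurable_fun_fubini_tonelli_F (m2 := lebesgue_tuple R n) _ maT (fun p => F0 _).
  rewrite /fubini_F /=; congr (measurable_fun _ _); apply/funext => x.
  by apply: eq_integral => t _; rewrite tE.
Qed.

(** Cubes have an explicit measure; they bound balls from outside for finiteness and from inside for
    positivity. *)
Definition tcube n (a : n.-tuple T) (c : R) : set (n.-tuple T) :=
  [set t | forall i, (`|tnth t i - tnth a i| <= c)%R].

Lemma measurable_tcube n a (c : R) : measurable (@tcube n a c).
Proof.
rewrite (_ : tcube a c =
    \bigcap_(i in [set: 'I_n]) (fun t => tnth t i) @^-1` `[(tnth a i - c)%R, (tnth a i + c)%R]%classic).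
  apply: fin_bigcap_measurable => [|i _]; first exact: finite_finset.
  by rewrite -[X in measurable X]setTI; apply: measurable_tnth => //; exact: measurable_itv.
apply/seteqP; split => t /= tc i; have := tc i.
  by rewrite ler_distl => ? _; rewrite /= in_itv.
by move=> /(_ I); rewrite /= in_itv /= ler_distl.
Qed.

Lemma lebesgue_tcube n a (c : R) : (0 <= c)%R ->
  lebesgue_tuple R n (tcube a c) = ((2 * c) ^+ n)%:E.
Proof.
move=> c0; elim: n a => [|n IH] a.
  have -> : tcube a c = setT by apply/seteqP; split => // t _ [].
  by rewrite /= diracT expr0.
case/tupleP: a => a0 a'.
rewrite /= /cons_measure /pushforward.
rewrite (_ : tcons @^-1` _ = `[(a0 - c)%R, (a0 + c)%R]%classic `*` tcube a' c).
  rewrite product_measure1E//; last exact: measurable_tcube.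
  rewrite IH -[X in X * _]/(lebesgue_measure `[(a0 - c)%R, (a0 + c)%R]%classic).
  rewrite lebesgue_measure_itv /= lte_fin.
  move: c0; rewrite le_eqVlt => /orP[/eqP<-|c0].
    by rewrite subr0 addr0 ltxx mul0e mulr0 expr0n.
  rewrite (_ : (a0 - c < a0 + c)%R); last by lra.
  by rewrite -EFinD -EFinM exprS; congr (_%:E); congr (_ * _)%R; ring.
apply/seteqP; split => -[x t] /= H.
  split; first by have := H ord0; rewrite in_itv /= !tnth0 ler_distl.
  by move=> i; have := H (lift ord0 i); rewrite !tnthS.
move=> i; have [j ->|->] := unliftP ord0 i; rewrite ?tnthS ?tnth0; case: H => //.
by rewrite in_itv /= ler_distl.
Qed.

End tuple_integrals.

(** * Polar coordinates *)

Section polar_coordinates.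
Context {R : realType} {d : nat}.
Local Notation V := 'rV[R]_d.
Local Notation T := (measurableTypeR R).
Local Notation lambda := (@lebesgue_measure R).
Local Notation mu := (lebesgue_tuple R d).
Local Notation rho := (@row_of_tuple R d).
Implicit Types (x y : V) (G : R -> R) (s : R).

Definition tuple_of_row x : d.-tuple T := [tuple x 0 i | i < d].

Lemma row_affine_tuple s x t : rho (affine_tuple s (tuple_of_row x) t) = s *: rho t + x.
Proof. by apply/rowP => i; rewrite !mxE !tnth_mktuple. Qed.

Lemma dotZ s x : dot (s *: x) (s *: x) = s ^+ 2 * dot x x.
Proof. by rewrite /dot mulr_sumr; apply: eq_bigr => i _; rewrite !mxE; ring. Qed.

Lemma enormZ s x : enorm (s *: x) = `|s| * enorm x.
Proof. by rewrite /enorm dotZ sqrtrM ?sqr_ge0// sqrtr_sqr. Qed.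

Lemma measurable_dot dd (X : measurableType dd) (u v : X -> V) :
  (forall i, measurable_fun setT (fun p => u p 0 i)) ->
  (forall i, measurable_fun setT (fun p => v p 0 i)) ->
  measurable_fun setT (fun p => dot (u p) (v p)).
Proof.
move=> mu' mv; rewrite /dot; apply: measurable_sum => i.
by apply: measurable_funM; [exact: mu'|exact: mv].
Qed.

Lemma measurable_row dd (X : measurableType dd) (u : X -> d.-tuple T) i :
  measurable_fun setT u -> measurable_fun setT (fun p => rho (u p) 0 i).
Proof.
move=> mu'; rewrite (_ : (fun p => _) = (fun t => tnth t i) \o u).
  by apply: measurableT_comp => //; exact: measurable_tnth.
by apply/funext => p; rewrite mxE.
Qed.

Lemma measurable_enorm dd (X : measurableType dd) (u : X -> V) :
  (forall i, measurable_fun setT (fun p => u p 0 i)) ->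
  measurable_fun setT (fun p => enorm (u p)).
Proof.
move=> mu'; rewrite /enorm (_ : (fun p => _) = (@Num.sqrt R) \o (fun p => dot (u p) (u p)))//.
apply: measurableT_comp; last exact: measurable_dot.
by apply: continuous_measurable_fun; exact: sqrt_continuous.
Qed.

Lemma measurable_dist dd (X : measurableType dd) (u : X -> V) x :
  (forall i, measurable_fun setT (fun p => u p 0 i)) ->
  forall i, measurable_fun setT (fun p => (u p - x)%R 0 i).
Proof.
move=> mu' i; rewrite (_ : (fun p => _) = (fun p => u p 0 i - x 0 i)%R).
  by apply: measurable_funB => //; exact: measurable_cst.
by apply/funext => p; rewrite !mxE.
Qed.

Lemma measurable_invnorm dd (X : measurableType dd) (u : X -> R) n :
  measurable_fun setT u -> measurable_fun setT (fun p => `|u p|^-1 ^+ n).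
Proof.
move=> mu'; apply: (measurable_funX n).
rewrite (_ : (fun p => _) = (@powR R ^~ (-1)) \o (@Num.norm R R \o u)).
  by apply: measurableT_comp; [exact: measurable_powR|exact: measurableT_comp].
by apply/funext => p /=; rewrite powR_inv1.
Qed.

(** The integral of [|s|^(- d - 1)] over [|s| >= 1], equal to [2 / d] for positive [d]; what matters
    is that it is positive and finite. *)
Definition polar_const : \bar R :=
  (\int[lambda]_s (if 1 <= s ^+ 2 then `|s|^-1 ^+ d.+1 else 0)%:E)%E.

Definition punctured_ball : set (d.-tuple T) := [set t | 0 < enorm (rho t) <= 1].

Local Open Scope ereal_scope.

Lemma polar_radial (q a : R) : (0 <= a)%R -> (0 <= q)%R ->
  \int[lambda]_s (if (0 < a ^+ 2 <= s ^+ 2)%R then `|s|^-1 ^+ d.+1 * (a * q) else 0)%:E =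
  (if (0 < a)%R then (a^-1 ^+ d * (a * q))%:E * polar_const else 0) :> \bar R.
Proof.
rewrite le_eqVlt => /orP[/eqP<- _|a0 q0].
  by rewrite integral0_eq ?ltxx// => s _; rewrite expr0n /= ltxx.
have mF : measurable_fun setT (fun s : T =>
    (if (1 <= s ^+ 2)%R then `|s|^-1 ^+ d.+1 else 0)%:E : \bar R).
  apply/measurable_EFinP/measurable_fun_ifT.
  - apply: measurable_fun_ler; first exact: measurable_cst.
    exact: (measurable_funX 2).
  - by apply: measurable_invnorm; exact: measurable_id.
  - exact: measurable_cst.
rewrite (ge0_integral_affine 0%R (lt0r_neq0 a0)); last 2 first.
- apply/measurable_EFinP/measurable_fun_ifT.
  + apply: measurable_and; first exact: measurable_cst.
    apply: measurable_fun_ler; first exact: measurable_cst.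
    exact: (measurable_funX 2).
  + by apply: measurable_funM => //; apply: measurable_invnorm; exact: measurable_id.
  + exact: measurable_cst.
- move=> s; rewrite lee_fin; case: ifP => // _.
  by rewrite !mulr_ge0 ?exprn_ge0 ?invr_ge0 ?(ltW a0).
rewrite a0 /polar_const (gtr0_norm a0).
rewrite -[X in _ = X]ge0_integralZl_EFin//; last 2 first.
- by move=> s _; rewrite lee_fin; case: ifP => // _; rewrite exprn_ge0// invr_ge0.
- by rewrite !mulr_ge0 ?exprn_ge0 ?invr_ge0 ?(ltW a0).
rewrite -[X in X = _]ge0_integralZl_EFin ?(ltW a0)//; last 2 first.
- move=> s _; rewrite lee_fin; case: ifP => // _.
  by rewrite !mulr_ge0 ?exprn_ge0 ?invr_ge0 ?(ltW a0).
- apply/measurable_EFinP/measurable_fun_ifT.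
  + apply: measurable_and; first exact: measurable_cst.
    apply: measurable_fun_ler; first exact: measurable_cst.
    by apply: (measurable_funX 2); exact: measurable_affine.
  + by apply: measurable_funM => //; apply: measurable_invnorm; exact: measurable_affine.
  + exact: measurable_cst.
apply: eq_integral => s _; rewrite -!EFinM addr0 exprn_gt0//= exprMn.
rewrite -[X in (X <= _)%R]mulr1 ler_pM2l ?exprn_gt0//.
case: ifP => s1; last by rewrite !mulr0.
rewrite normrM (gtr0_norm a0) invfM exprMn; congr (_%:E).
rewrite [in LHS]exprS; field; exact: lt0r_neq0.
Qed.

(* For fixed [s], substitute [w = s *: t + x] in the inner integral. *)
Lemma polar_integral x G : measurable_fun setT G -> (forall s, (0 <= G s)%R) ->
  G (dot x x) = 0%R ->
  \int[mu]_(t in punctured_ball) \int[lambda]_s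
     (G (dot (x + s *: ((enorm (rho t))^-1 *: rho t))
             (x + s *: ((enorm (rho t))^-1 *: rho t))))%:E =
  polar_const * \int[mu]_w (G (dot (rho w) (rho w)) *
     (enorm (rho w - x) * (enorm (rho w - x))^-1 ^+ d))%:E.
Proof.
move=> mG G0 Gx.
pose P t := (0 < enorm (rho t) <= 1)%R.
(* [f1] is the integrand after replacing [s] by [|t| s], which removes the normalization of [t].
   [f2] is the one after [w = s *: t + x], with Jacobian [|s|^(- d)] and [|t| = |w - x| / |s|]. *)
pose f1 (p : T * d.-tuple T) : R := if P p.2 then
  (enorm (rho p.2) * G (dot (p.1 *: rho p.2 + x) (p.1 *: rho p.2 + x)))%R else 0%R.
pose f2 (p : T * d.-tuple T) : R :=
  if (0 < enorm (rho p.2 - x) ^+ 2 <= p.1 ^+ 2)%R then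
  (`|p.1|^-1 ^+ d.+1 * (enorm (rho p.2 - x) * G (dot (rho p.2) (rho p.2))))%R else 0%R.
have mrho : forall i, measurable_fun setT (fun p : T * d.-tuple T => (rho p.2 0 i)%R).
  by move=> i; apply: measurable_row.
have mline : forall i, measurable_fun setT (fun p : T * d.-tuple T => ((p.1 *: rho p.2 + x) 0 i)%R).
  move=> i; rewrite (_ : (fun p => _) = (fun p : T * d.-tuple T => p.1 * rho p.2 0 i + x 0 i)%R).
    by apply: measurable_funD => //; apply: measurable_funM.
  by apply/funext => p; rewrite !mxE.
have mP2 : measurable_fun setT (fun p : T * d.-tuple T => P p.2).
  apply: measurable_and.
    by apply: measurable_fun_ltr; [exact: measurable_cst|exact: measurable_enorm].
  by apply: measurable_fun_ler; [exact: measurable_enorm|exact: measurable_cst].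
have mdist := measurable_enorm (measurable_dist x mrho).
have mf1 : measurable_fun setT f1.
  apply: measurable_fun_ifT => //.
  apply: measurable_funM; first exact: measurable_enorm.
  by apply: measurableT_comp => //; exact: measurable_dot.
have mf2 : measurable_fun setT f2.
  apply: measurable_fun_ifT => //.
    apply: measurable_and.
      by apply: measurable_fun_ltr; [exact: measurable_cst|exact: (measurable_funX 2)].
    by apply: measurable_fun_ler; apply: (measurable_funX 2).
  apply: measurable_funM; first exact: measurable_invnorm.
  by apply: measurable_funM => //; apply: measurableT_comp => //; exact: measurable_dot.
have sl1 s : measurable_fun setT (fun t => (f1 (s, t))%:E).
  exact/measurable_EFinP/(measurableT_comp mf1).
have sl1' t : measurable_fun setT (fun s => (f1 (s, t))%:E).
  exact/measurable_EFinP/(measurableT_comp mf1).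
have f10 p : (0 <= f1 p)%R.
  by rewrite /f1; case: ifP => // _; rewrite mulr_ge0 ?enorm_ge0.
have f20 p : (0 <= f2 p)%R.
  rewrite /f2; case: ifP => // _; apply: mulr_ge0.
    by rewrite exprn_ge0// invr_ge0.
  by rewrite mulr_ge0// enorm_ge0.
have sl2 s : measurable_fun setT (fun t => (f2 (s, t))%:E).
  exact/measurable_EFinP/(measurableT_comp mf2).
have mGl v : measurable_fun setT
    (fun s : T => (G (dot (x + s *: v) (x + s *: v)))%:E).
  have ml i : measurable_fun setT (fun s : T => ((x + s *: v) 0 i)%R).
    rewrite (_ : (fun s => _) = (fun s : T => v 0 i * s + x 0 i)%R).
      exact: measurable_affine.
    by apply/funext => s; rewrite !mxE addrC mulrC.
  apply/measurable_EFinP/(measurableT_comp mG)/measurable_dot; exact: ml.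
transitivity (\int[mu]_t \int[lambda]_s (f1 (s, t))%:E).
  rewrite integral_mkcond; apply: eq_integral => t _; rewrite patchE.
  case: ifPn => [/set_mem tP|tP]; last first.
    rewrite integral0_eq// => s _; rewrite /f1 /= (_ : P t = false)//.
    by apply/negP => Pt; move/negP: tP; apply; apply/mem_set.
  rewrite /= in tP; case/andP: (tP) => t0 t1.
  have t0' : (enorm (rho t) != 0)%R by rewrite gt_eqF.
  rewrite (ge0_integral_affine 0 t0'); last 2 first.
  - exact: mGl.
  - by move=> s; rewrite lee_fin.
  rewrite ger0_norm ?enorm_ge0// -ge0_integralZl_EFin ?enorm_ge0//; last 2 first.
  - by move=> s _; rewrite lee_fin.
  - exact: (measurableT_comp (mGl _) (measurable_affine _ _)).
  apply: eq_integral => s _; rewrite /f1 /= /P tP -EFinM addr0; congr (_ * G (dot _ _))%:E.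
    by rewrite scalerA mulrAC mulfV// mul1r addrC.
  by rewrite scalerA mulrAC mulfV// mul1r addrC.
rewrite -(fubini_tonelli (m1 := lambda) (m2 := mu) (EFin \o f1)); last 2 first.
- exact/measurable_EFinP.
- by move=> p; rewrite lee_fin.
transitivity (\int[lambda]_s \int[mu]_w (f2 (s, w))%:E).
  (* The substitution degenerates at [s = 0]; there the left integrand is a multiple of
     [G (dot x x) = 0], and the condition in [f2] fails. *)
  apply: eq_integral => s _; have [->|s0] := eqVneq s 0%R.
    rewrite [LHS]integral0_eq ?[RHS]integral0_eq// => t _.
      rewrite /f2 /= expr0n /=; case: ifP => // /andP[a b].
      by have := lt_le_trans a b; rewrite ltxx.
    by rewrite /f1 /=; case: ifP => // _; rewrite scale0r add0r Gx mulr0.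
  rewrite [RHS](ge0_integral_affine_tuple (tuple_of_row x) s0); last 2 first.
  - exact: sl2.
  - by move=> t; rewrite lee_fin.
  rewrite -ge0_integralZl_EFin ?exprn_ge0//; last 2 first.
  - by move=> t _; rewrite lee_fin.
  - exact: (measurableT_comp (sl2 _) (measurable_affine_tuple _ _)).
  apply: eq_integral => t _; rewrite -EFinM /= /f1 /f2 /= row_affine_tuple addrK enormZ.
  have s20 : (0 < s ^+ 2)%R by rewrite exprn_even_gt0.
  have -> : (0 < (`|s| * enorm (rho t)) ^+ 2 <= s ^+ 2)%R = P t.
    rewrite exprMn real_normK ?num_real// pmulr_rgt0// ger_pMr// /P.
    by rewrite exprn_even_gt0//= expr_le1 ?enorm_ge0// (lt0r (enorm _)) enorm_ge0 andbT.
  case: ifP => _; last by rewrite mulr0.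
  have : (`|s| != 0)%R by rewrite normr_eq0.
  move: (`|s|%R) (G _) (enorm _) => a g e a0; congr (_%:E).
  by rewrite exprS exprVn; field; rewrite a0 expf_neq0.
rewrite (fubini_tonelli (m1 := lambda) (m2 := mu) (EFin \o f2)); last 2 first.
- exact/measurable_EFinP.
- by move=> p; rewrite lee_fin.
have mrho' : forall i, measurable_fun setT (fun t : d.-tuple T => (rho t 0 i)%R).
  by move=> i; apply: measurable_row.
have mdist' := measurable_enorm (measurable_dist x mrho').
rewrite -ge0_integralZl//; last 3 first.
- apply/measurable_EFinP/measurable_funM.
    by apply: measurableT_comp => //; exact: measurable_dot.
  apply: measurable_funM => //.
  rewrite (_ : (fun t => _) = (fun t => `|enorm (rho t - x)|^-1 ^+ d)%R); last first.
    by apply/funext => t; rewrite ger0_norm ?enorm_ge0.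
  exact: measurable_invnorm.
- move=> w _; rewrite lee_fin; apply: mulr_ge0 => //.
  by rewrite mulr_ge0 ?exprn_ge0 ?invr_ge0 ?enorm_ge0.
- apply: integral_ge0 => s _; rewrite lee_fin; case: ifP => //.
(* Integration over [|s| >= |w - x|] produces [polar_const] times [|w - x|^(- d)]. *)
apply: eq_integral => w _; rewrite /f2 /= polar_radial ?enorm_ge0//.
have := enorm_ge0 (rho w - x); rewrite le_eqVlt => /orP[/eqP<-|a0].
  by rewrite ltxx mul0r mulr0 mule0.
by rewrite a0 muleC; congr (_ * _%:E); ring.
Qed.

Let polar_kernel (s : T) : \bar R := (if (1 <= s ^+ 2)%R then `|s|^-1 ^+ d.+1 else 0)%:E.

Let polar_kernel_ge0 s : 0 <= polar_kernel s.
Proof. by rewrite lee_fin; case: ifP => // _; rewrite exprn_ge0// invr_ge0. Qed.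

Let measurable_polar_kernel : measurable_fun setT polar_kernel.
Proof.
apply/measurable_EFinP/measurable_fun_ifT.
- apply: measurable_fun_ler; first exact: measurable_cst.
  exact: (measurable_funX 2).
- by apply: measurable_invnorm; exact: measurable_id.
- exact: measurable_cst.
Qed.

Lemma polar_const_gt0 : 0 < polar_const.
Proof.
apply: (@lt_le_trans _ _ ((2^-1 ^+ d.+1)%:E * lambda `[1%R, 2%R]%classic)).
  rewrite -[X in _ * X]/(lebesgue_measure `[1%R, 2%R]%classic) lebesgue_measure_itv /=.
  rewrite lte_fin ltr1n -EFinD -EFinM lte_fin mulr_gt0 ?exprn_gt0 ?invr_gt0// subr_gt0 ltr1n//.
rewrite -integral_cst//.
apply: (@le_trans _ _ (\int[lambda]_(s in `[1%R, 2%R]) polar_kernel s)); last first.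
  exact: ge0_subset_integral.
apply: ge0_le_integral => //.
- by move=> s _; rewrite lee_fin exprn_ge0// invr_ge0.
- exact: measurable_funTS.
- move=> s /=; rewrite in_itv /= => /andP[s1 s2]; rewrite lee_fin exprn_ege1//.
  rewrite ger0_norm ?(le_trans _ s1)// lerXn2r ?nnegrE ?invr_ge0 ?(le_trans _ s1)//.
  by rewrite lef_pV2 ?posrE ?(lt_le_trans _ s1).
Qed.

(** For positive [d] the integrand is at most [|s|^(-2)], hence at most [2 / (1 + s^2)], which
    integrates to an arctangent. *)
Lemma polar_const_lty : (0 < d)%N -> polar_const < +oo.
Proof.
move=> d0; apply: (@le_lt_trans _ _ (2%:E * \int[lambda]_s ((oneDsqr s)^-1)%:E)).
  rewrite -ge0_integralZl//; last first.
    apply/measurable_EFinP; apply: continuous_measurable_fun.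
    exact: continuous_oneDsqrV.
  apply: ge0_le_integral => //.
    + by move=> s _; exact: polar_kernel_ge0.
    + apply: measurable_funeM; apply/measurable_EFinP; apply: continuous_measurable_fun.
      exact: continuous_oneDsqrV.
    + move=> s _; rewrite -EFinM lee_fin; case: ifP => s1; last by rewrite mulr_ge0// invr_ge0.
      have s0 : (1 <= `|s|)%R by rewrite -(@ler_sqr R) ?nnegrE// expr1n real_normK// num_real.
      apply: (@le_trans _ _ (`|s|^-1 ^+ 2)%R).
        by apply: ler_wiXn2l => //; rewrite ?invr_ge0// invf_le1// (lt_le_trans _ s0).
      rewrite exprVn real_normK ?num_real// -ler_pdivrMl// -invfM.
      have s2 : (0 < s ^+ 2)%R := lt_le_trans ltr01 s1.
      have o0 : (0 < 2^-1 * oneDsqr s)%R by rewrite mulr_gt0// (lt_le_trans ltr01).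
      by rewrite lef_pV2 ?posrE// /oneDsqr; lra.
rewrite (@ge0_symfun_integralT _ (fun s : R => (oneDsqr s)^-1)%R).
- rewrite (_ : [set x | _] = `[0%R, +oo[%classic); last first.
    by apply/seteqP; split => s /=; rewrite in_itv/= andbT.
  rewrite integral0y_oneDsqr -!EFinM ltry//.
- by move=> s; rewrite invr_ge0.
- by move=> s; exact: continuous_oneDsqrV.
- by move=> s; rewrite /oneDsqr /= sqrrN.
Qed.

End polar_coordinates.

(** * Differentiation under the integral sign *)

Section parametric_integrals.
Context {R : realType} {V W : normedModType R} {dT : measure_display} {T : measurableType dT}.
Variables (nu : {measure set T -> \bar R}) (D : set T) (theta : T -> W) (C : set W).
Variables (U : set V) (O : set (V * W)).
Hypotheses (mD : measurable D) (Dfin : (nu D < +oo)%E).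
Hypotheses (cC : compact C) (thC : forall t, D t -> C (theta t)).
Hypotheses (oU : open U) (oO : open O) (UCO : forall x w, U x -> C w -> O (x, w)).
Implicit Types (x v : V) (w : W) (H : V * W -> R).

Lemma line_slice (h : R) v x w : h *: ((v, 0) : V * W) + (x, w) = (h *: v + x, w).
Proof. by apply: injective_projections => //=; rewrite scaler0 add0r. Qed.

Lemma derive_slice H v x w : 'D_((v, 0) : V * W) H (x, w) = 'D_v (fun x => H (x, w)) x.
Proof.
rewrite /derive; set F1 := (X in X @ _); set F2 := (X in _ = lim (X @ _)).
suff -> : F1 = F2 by []; apply/funext => h /=; rewrite /F1 /F2 /=.
by rewrite line_slice.
Qed.

Lemma iter_derive_slice H vs x w :
  iter_derive [seq ((v, 0) : V * W) | v <- vs] H (x, w) =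
  iter_derive vs (fun x => H (x, w)) x.
Proof.
elim: vs x => [//|v vs IH] x /=; rewrite derive_slice; congr ('D_v _ x).
by apply/funext => y; exact: IH.
Qed.

(** Joint smoothness on an open set around [U] times [C], with [C] compact, makes all estimates
    uniform in [t]. Measurability is asked slice by slice, since [theta] takes values in a bare
    normed space. *)
Definition parametric H := smooth_on O H /\
  forall x, U x -> measurable_fun D (fun t => H (x, theta t)).

Definition pint H x : R := \int[nu]_(t in D) H (x, theta t).

Let slab x : set (V * W) := [set x] `*` C.

Let slab_sub x : U x -> slab x `<=` O.
Proof. by move=> Ux [y w] [] /= -> Cw; exact: UCO. Qed.

Let compact_slab x : compact (slab x).
Proof. by apply: compact_setX => //; exact: compact_set1. Qed.

Let slab_near H x (e : R) : smooth_on O H -> U x -> 0 < e ->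
  exists2 r : R, 0 < r & forall v t, `|v| < r -> D t -> U (v + x) /\
    `|H (v + x, theta t) - H (x, theta t)| < e.
Proof.
move=> sH Ux e0.
have cH p : O p -> {for p, continuous H} by exact: smooth_on_continuous.
have [r r0 Hr] := uniform_continuity_compact oO (@compact_slab x) (slab_sub Ux) cH e0.
have /nbhs_normP[r' /= r'0 Hr'] : nbhs x U by apply: open_nbhs_nbhs.
exists (Num.min r r') => [|v t]; first by rewrite lt_min r0.
rewrite lt_min => /andP[vr vr'] Dt; split.
  by apply: Hr'; rewrite /= opprD addrCA subrr addr0 normrN.
have [] := Hr (x, theta t) (v, 0).
- by split => //; exact: thC.
- by rewrite prod_normE /= normr0 gt_max// vr.
- rewrite (_ : (v, 0) + _ = (v + x, theta t)) => [_ //|].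
  by apply: injective_projections => //=; rewrite add0r.
Qed.

Let slab_bound H x : smooth_on O H -> U x ->
  exists2 M : R, 0 <= M & exists2 r : R, 0 < r &
    forall v t, `|v| < r -> D t -> U (v + x) /\ `|H (v + x, theta t)| <= M.
Proof.
move=> sH Ux.
have [M M0 HM] := compact_smooth_bound (@compact_slab x) (slab_sub Ux) sH.
have [r r0 Hr] := slab_near sH Ux ltr01.
exists (M + 1); first by rewrite addr_ge0.
exists r => // v t vr Dt; have [Uv /ltW Hv] := Hr v t vr Dt; split => //.
rewrite -[X in `|X|](subrK (H (x, theta t))) addrC; apply: le_trans (ler_normD _ _) _.
by apply: lerD => //; apply: HM; split => //=; exact: thC.
Qed.

Lemma integrable_parametric H x : parametric H -> U x ->
  nu.-integrable D (EFin \o (fun t => H (x, theta t))).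
Proof.
move=> [sH mH] Ux; apply: measurable_bounded_integrable => //; first exact: mH.
have [M M0 HM] := compact_smooth_bound (@compact_slab x) (slab_sub Ux) sH.
exists M; split; first by rewrite num_real.
move=> M' MM t /= Dt; apply: le_trans (ltW MM); apply: HM; split => //=; exact: thC.
Qed.

Let is_derive_slab H x v t (h : R) : smooth_on O H -> U (h *: v + x) -> D t ->
  is_derive h 1 (fun s : R => H (s *: v + x, theta t))
    ('D_((v, 0) : V * W) H (h *: v + x, theta t)).
Proof.
move=> sH Uh Dt.
have E (s : R) := line_slice s v x (theta t).
have Oh : O (h *: ((v, 0) : V * W) + (x, theta t)) by rewrite E; apply: UCO => //; exact: thC.
have := is_derive_line (smooth_on_is_derive (v, 0) sH Oh); rewrite E.
by rewrite (_ : (fun s : R => H (s *: _ + _)) = (fun s : R => H (s *: v + x, theta t)));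
  last by apply/funext => s; rewrite E.
Qed.

Let line_near v (r : R) : 0 < r -> exists2 a : R, 0 < a & forall h : R, `|h| < a ->
  `|h *: v| < r.
Proof.
move=> r0; exists (r / (`|v| + 1)); first by rewrite divr_gt0// ltr_wpDl.
move=> h; rewrite ltr_pdivlMr ?ltr_wpDl// => hr; rewrite normrZ.
by apply: le_lt_trans hr; apply: ler_wpM2l => //; rewrite lerDl.
Qed.

(** The point is measurability of the derivative in [t]: it is a pointwise limit of difference
    quotients along a sequence of steps. *)
Lemma parametric_derive H v : parametric H -> parametric ('D_((v, 0) : V * W) H).
Proof.
move=> [sH mH]; split; first exact: smooth_on_derive.
move=> x Ux.
have [M _ [r r0 Hr]] := slab_bound sH Ux.
have [a a0 Ha] := line_near v r0.
(* Nonzero steps tending to 0; the shift in [harmonic n.+1] makes even the first one smaller than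
   [a]. *)
pose h (n : nat) : R := a * harmonic n.+1.
have h0 n : h n != 0 by rewrite mulf_neq0 ?gt_eqF// /harmonic /=.
have ha n : `|h n| < a.
  rewrite gtr0_norm ?mulr_gt0//= -[X in _ < X]mulr1 ltr_pM2l//.
  by rewrite invf_lt1// ltr1n.
have hc : h n @[n --> \oo] --> (0 : R).
  rewrite -(mulr0 a); apply: cvgM; first exact: cvg_cst.
  by have := @cvg_harmonic R; rewrite -cvg_shiftS.
apply: (@measurable_fun_cvg _ _ _ _ (fun n t => (h n)^-1 * (H (h n *: v + x, theta t) - H (x, theta t)))).
  move=> n; apply: measurable_funM; first exact: measurable_cst.
  apply: measurable_funB; last exact: mH.
  apply: (@eq_measurable_fun _ _ _ _ _ (fun t => if `[< D t >] then H (h n *: v + x, theta t) else 0)).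
    by move=> t /set_mem Dt; rewrite asboolT.
  (* [slab_bound] yields points of [U] only in the presence of a point of [D], whence a separate
     case for empty [D]. *)
  have [[t Dt]|D0] := pselect (exists t, D t); last first.
    have -> : D = set0 by apply/seteqP; split => // t Dt; case: D0; exists t.
    exact: measurable_fun_set0.
  apply: (@eq_measurable_fun _ _ _ _ _ (fun t => H (h n *: v + x, theta t))).
    by move=> t' /set_mem Dt'; rewrite asboolT.
  by apply: mH; have [] := Hr _ t (Ha _ (ha n)) Dt.
move=> t Dt /=.
have Ux0 : U (0 *: v + x) by rewrite scale0r add0r.
have [d1 d2] := is_derive_slab sH Ux0 Dt.
rewrite scale0r add0r in d2; rewrite -d2.
set q := (X in X @ _ --> _).
have := d1; rewrite /derivable => /cvgr_dnbhsP/(_ h (conj h0 hc)).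
set q' := (X in X @ _ --> _) => qc.
suff -> : q = q' by exact: qc.
apply/funext => n.
by rewrite /q /q' /= !addr0 scale0r add0r [(h n)%:A]mulr1.
Qed.

(** Near [x] the derivative is bounded by a constant uniformly on [D], and constants are integrable
    since [D] has finite measure. *)
Lemma is_derive_pint H x v : parametric H -> U x ->
  is_derive x v (pint H) (pint ('D_((v, 0) : V * W) H) x).
Proof.
move=> pH Ux; have [sH mH] := pH; have pH' := parametric_derive v pH.
have [M M0 [r r0 Hr]] := slab_bound pH'.1 Ux.
have [[t0 Dt0]|D0] := pselect (exists t, D t); last first.
  have D00 : D = set0 by apply/seteqP; split => // t Dt; case: D0; exists t.
  rewrite /pint D00 Rintegral_set0.
  rewrite (_ : (fun x0 : V => _) = cst 0); first exact: is_derive_cst.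
  by apply/funext => y; rewrite Rintegral_set0.
have [a a0 Ha] := line_near v r0.
have I h : `]- a, a[%classic h -> `|h *: v| < r.
  by rewrite /= in_itv /= => ha; apply: Ha; rewrite ltr_norml.
have Uh h : `]- a, a[%classic h -> U (h *: v + x).
  by move=> /I /Hr /(_ Dt0)[].
have dE h t : `]- a, a[%classic h -> D t -> partial1of2 (fun h t => H (h *: v + x, theta t)) h t =
    'D_((v, 0) : V * W) H (h *: v + x, theta t).
  move=> Ih Dt; rewrite partial1of2E.
  by have [_] := is_derive_slab sH (Uh _ Ih) Dt.
have I0 : `]- a, a[%classic (0 : R) by rewrite /= in_itv /= oppr_lt0 a0.
have derf h t : `]- a, a[%classic h -> D t -> derivable ((fun h t => H (h *: v + x, theta t)) ^~ t) h 1.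
  by move=> Ih Dt; have [] := is_derive_slab sH (Uh _ Ih) Dt.
have dM h t : `]- a, a[%classic h -> D t ->
    `|partial1of2 (fun h t => H (h *: v + x, theta t)) h t| <= cst M t.
  move=> Ih Dt; rewrite dE//.
  by have [] := Hr (h *: v) t (I _ Ih) Dt.
have intM : nu.-integrable D (EFin \o cst M).
  apply: measurable_bounded_integrable => //.
  by exists M; split; [rewrite num_real|move=> M' MM' t /= _; rewrite ger0_norm// ltW].
have intf h : `]- a, a[%classic h -> nu.-integrable D (EFin \o (fun t => H (h *: v + x, theta t))).
  by move=> Ih; apply: integrable_parametric => //; exact: Uh.
have cv := @cvg_differentiation_under_integral _ _ _ nu
  (fun h t => H (h *: v + x, theta t)) D mD 0 (- a) a I0 intf derf (cst M) (fun=> M0) intM dM.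
have E0 : \int[nu]_(t in D) partial1of2 (fun h t => H (h *: v + x, theta t)) 0 t =
    pint ('D_((v, 0) : V * W) H) x.
  apply: eq_Rintegral => t /set_mem Dt; rewrite dE//.
  by rewrite scale0r add0r.
rewrite E0 in cv.
set q := (X in X @ _ --> _) in cv.
have E1 : q = (fun h => h^-1 *: ((pint H \o shift x) (h *: v) - pint H x)).
  by apply/funext => h; rewrite /q /pint /= addr0 scale0r add0r.
rewrite E1 in cv.
by split; [exact: (cvgP _ cv)|exact: cvg_lim cv].
Qed.

Lemma pint_continuous H x : parametric H -> U x -> {for x, continuous (pint H)}.
Proof.
move=> pH Ux; apply/cvgrPdist_lt => e e0.
have [sH mH] := pH.
have m0 : 0 < fine (nu D) + 1 by rewrite ltr_wpDl// fine_ge0.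
have [r r0 Hr] := slab_near sH Ux (divr_gt0 e0 m0).
apply/nbhs_normP; exists r => //= y yr.
have {}yr : `|y - x| < r by rewrite distrC.
have [[t0 Dt0]|D0] := pselect (exists t, D t); last first.
  have D00 : D = set0 by apply/seteqP; split => // t Dt; case: D0; exists t.
  by rewrite /pint D00 !Rintegral_set0 subrr normr0.
have Uy : U y by have [] := Hr _ _ yr Dt0; rewrite subrK.
have ix := integrable_parametric pH Ux; have iy := integrable_parametric pH Uy.
rewrite /pint -RintegralB//.
have ixy : nu.-integrable D (EFin \o (fun t => H (x, theta t) - H (y, theta t))).
  by rewrite /comp; under eq_fun do rewrite EFinB; apply: integrableB.
apply: le_lt_trans (le_normr_Rintegral mD ixy) _.
apply: (@le_lt_trans _ _ (\int[nu]_(t in D) (e / (fine (nu D) + 1)))).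
  apply: le_Rintegral => //.
  - exact: integrable_norm.
  - apply: measurable_bounded_integrable => //.
    exists (e / (fine (nu D) + 1)); split; first by rewrite num_real.
    by move=> M' MM' t /= _; rewrite ger0_norm ?(ltW MM')// divr_ge0// ?(ltW m0) ?(ltW e0).
  - move=> t Dt; rewrite distrC; apply/ltW.
    by have [_] := Hr _ _ yr Dt; rewrite subrK.
rewrite Rintegral_cst// mulrAC ltr_pdivrMr// ltr_pM2l// ltrDl//.
Qed.

Lemma smooth_on_pint H : parametric H -> smooth_on U (pint H).
Proof.
move=> pH; apply: (smooth_on_coind oU (C := [set h | exists2 H, parametric H & h = pint H])).
- by move=> g [H' pH' ->] x; exact: pint_continuous.
- move=> g [H' pH' ->] v; exists (pint ('D_((v, 0) : V * W) H')).
    by exists ('D_((v, 0) : V * W) H') => //; exact: parametric_derive.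
  by move=> x; exact: is_derive_pint.
- by exists H.
Qed.

Lemma parametric_iter_derive H vs : parametric H ->
  parametric (iter_derive [seq ((v, 0) : V * W) | v <- vs] H).
Proof. by move=> pH; elim: vs => [//|v vs IH]; exact: parametric_derive. Qed.

Lemma integrable_iter_derive H vs x : parametric H -> U x ->
  nu.-integrable D (EFin \o (fun t => iter_derive vs (fun x => H (x, theta t)) x)).
Proof.
move=> pH Ux; have := integrable_parametric (parametric_iter_derive vs pH) Ux.
by under [X in EFin \o X]eq_fun do rewrite iter_derive_slice.
Qed.

Lemma iter_derive_pint H vs x : parametric H -> U x ->
  iter_derive vs (pint H) x =
  \int[nu]_(t in D) iter_derive vs (fun x => H (x, theta t)) x.
Proof.
move=> pH Ux.
transitivity (pint (iter_derive [seq ((v, 0) : V * W) | v <- vs] H) x); last first.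
  by apply: eq_Rintegral => t _; rewrite iter_derive_slice.
elim: vs x Ux => [//|v vs IH] x Ux /=.
have [_ <-] := is_derive_pint v (parametric_iter_derive vs pH) Ux; apply: near_eq_derive.
by apply: filterS (open_nbhs_nbhs (conj oU Ux)) => z /IH.
Qed.

End parametric_integrals.

(** * Line integrals of a radial bump *)

Section chord_profile.
Context {R : realType}.
Local Notation T := (measurableTypeR R).
Local Notation lambda := (@lebesgue_measure R).
Implicit Types (c u s : R).

(** A radial bump supported in squared radius [c], as a function of the squared distance to its
    centre. *)
Definition cap c u : R := flat_seq 0 (1 - u / c).

Lemma cap_ge0 c u : 0 <= cap c u.
Proof. exact: flat_ge0. Qed.

Lemma cap_eq0 c u : 0 < c -> c <= u -> cap c u = 0.
Proof. by move=> c0 uc; apply: flat_eq0; rewrite subr_le0 ler_pdivlMr// mul1r. Qed.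

Lemma smooth_on_cap (V : normedModType R) (U : set V) c (u : V -> R) : open U ->
  smooth_on U u -> smooth_on U (fun x => cap c (u x)).
Proof.
move=> oU su.
have su1 := smooth_onB oU (smooth_on_cst 1 oU) (smooth_onM oU su (smooth_on_cst c^-1 oU)).
exact: (smooth_on_comp 0 oU deriv_seq_flat su1 (fun _ _ => I)).
Qed.

Lemma continuous_cap c : continuous (cap c).
Proof.
have si : smooth_on (@setT R) (fun u : R => u).
  by apply: (smooth_on_affine (l := fun v : R => v) openT) => // x; exact: cvg_id.
by move=> u; exact: (smooth_on_continuous (smooth_on_cap c openT si) I).
Qed.

Lemma measurable_cap c dd (X : measurableType dd) (u : X -> R) D : measurable D ->
  measurable_fun D u -> measurable_fun D (fun p => cap c (u p)).
Proof.
move=> mD mu; apply: (@measurableT_comp _ _ _ _ _ _ (cap c)) => //.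
by apply: continuous_measurable_fun; exact: continuous_cap.
Qed.

(** Contains every [s] with [s ^+ 2 <= c], without square roots. Because the range is fixed and
    compact, [chord c] is smooth at all real [u], negative ones included. *)
Definition chord_range c : set T := `[- (c + 1), c + 1]%classic.

(** For [u >= 0], the integral of the bump along a line at squared distance [u] from its centre. *)
Definition chord c u : R := \int[lambda]_(s in chord_range c) cap c (u + s ^+ 2).

Lemma smooth_chord c : 0 < c -> smooth_on setT (chord c).
Proof.
move=> c0.
have c1 : - (c + 1) <= c + 1 by rewrite -subr_ge0 opprK; lra.
apply: (@smooth_on_pint _ _ _ _ _ lambda (chord_range c) id (chord_range c) setT setT
   _ _ _ _ openT openT _ (fun p : R * R => cap c (p.1 + p.2 ^+ 2))) => //.
- exact: measurable_itv.
- rewrite -[X in (X < _)%E]/(lebesgue_measure (chord_range c)) lebesgue_measure_itv /=.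
  by case: ifP => _; rewrite ?ltry// -EFinD ltry.
- exact: segment_compact.
- have s1 : smooth_on (@setT (R * R)) (fun p : R * R => p.1).
    apply: (smooth_on_affine (l := fun p : R * R => p.1) openT) => //.
    by move=> x; exact: cvg_fst.
  have s2 : smooth_on (@setT (R * R)) (fun p : R * R => p.2).
    apply: (smooth_on_affine (l := fun p : R * R => p.2) openT) => //.
    by move=> x; exact: cvg_snd.
  split.
    exact: (smooth_on_cap c openT (smooth_onD openT s1 (smooth_onM openT s2 s2))).
  move=> x _; apply: measurable_cap; first exact: measurable_itv.
  apply: measurable_funD; first exact: measurable_cst.
  by apply: (measurable_funX 2); exact: measurable_id.
Qed.

Lemma smooth_on_chord (V : normedModType R) (U : set V) c (u : V -> R) : 0 < c -> open U ->
  smooth_on U u -> smooth_on U (fun x => chord c (u x)).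
Proof.
move=> c0 oU su.
have dF : deriv_seq setT (fun k => iter_derive (nseq k (1 : R)) (chord c)).
  by move=> k s _; apply: (smooth_on_is_derive _ (smooth_on_iter _ (smooth_chord c0))).
exact: (smooth_on_comp 0 oU dF su).
Qed.

Lemma continuous_chord c : 0 < c -> continuous (chord c).
Proof. by move=> c0 u; exact: smooth_on_continuous (smooth_chord c0) I. Qed.

Lemma chord_eq0 c u : 0 < c -> c <= u -> chord c u = 0.
Proof.
move=> c0 cu; rewrite /chord /Rintegral integral0_eq// => s _.
by rewrite cap_eq0// (le_trans cu)// lerDl sqr_ge0.
Qed.

Lemma chordE c u : 0 < c -> 0 <= u ->
  (chord c u)%:E = (\int[lambda]_s (cap c (u + s ^+ 2))%:E)%E.
Proof.
move=> c0 u0.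
have mc D : measurable D -> measurable_fun D (fun s : T => (cap c (u + s ^+ 2))%:E).
  move=> mD; apply/measurable_EFinP/measurable_cap => //.
  apply: measurable_funD; first exact: measurable_cst.
  by apply: (measurable_funX 2); exact: measurable_id.
have mr : measurable (chord_range c) by exact: measurable_itv.
rewrite /chord /Rintegral fineK.
  rewrite integral_mkcond; apply: eq_integral => s _; rewrite patchE.
  case: ifPn => // /negP sc; rewrite cap_eq0//.
  rewrite leNgt; apply/negP => us; apply: sc; apply/mem_set.
  rewrite /chord_range /= in_itv /= -ler_norml.
  rewrite -(@ler_sqr R) ?nnegrE ?addr_ge0 ?(ltW c0)// real_normK ?num_real//.
  by nra.
suff: (lambda.-integrable (chord_range c) (EFin \o (fun s => cap c (u + s ^+ 2)))).
  by move=> /integrable_fin_num; apply.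
apply: continuous_compact_integrable; first exact: segment_compact.
apply: continuous_subspaceT => s.
apply: (@continuous_comp _ _ _ (fun s : R => u + s ^+ 2) (cap c)); last exact: continuous_cap.
apply: cvgD; first exact: cvg_cst.
exact: (@exprn_continuous _ 2).
Qed.

End chord_profile.

Section chord_integrals.
Context {R : realType} {d : nat}.
Local Notation V := 'rV[R]_d.
Local Notation T := (measurableTypeR R).
Local Notation lambda := (@lebesgue_measure R).
Local Notation mu := (lebesgue_tuple R d).
Local Notation rho := (@row_of_tuple R d).
Implicit Types (x y z th : V) (p : V * V) (c u s : R).

Lemma dotDl x y z : dot (x + y) z = dot x z + dot y z.
Proof. by rewrite /dot -big_split; apply: eq_bigr => i _; rewrite !mxE mulrDl. Qed.

Lemma dotC x y : dot x y = dot y x.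
Proof. by apply: eq_bigr => i _; rewrite mulrC. Qed.

Lemma dotZl s x y : dot (s *: x) y = s * dot x y.
Proof. by rewrite /dot mulr_sumr; apply: eq_bigr => i _; rewrite !mxE mulrA. Qed.

Lemma dotDr x y z : dot x (y + z) = dot x y + dot x z.
Proof. by rewrite dotC dotDl !(dotC x). Qed.

Lemma dotZr s x y : dot x (s *: y) = s * dot x y.
Proof. by rewrite dotC dotZl (dotC x). Qed.

(* On unit directions, the squared distance of y to the line x + R theta. *)
Definition line_dist2 y p : R := dot (p.1 - y) (p.1 - y) - dot (p.1 - y) p.2 ^+ 2.

Lemma dot_line x th s : dot th th = 1 ->
  dot (x + s *: th) (x + s *: th) = dot x x - dot x th ^+ 2 + (s + dot x th) ^+ 2.
Proof. by move=> t1; rewrite !(dotDl, dotDr, dotZl, dotZr) t1 (dotC th x); ring. Qed.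

Lemma line_dist2_min y p : dot p.2 p.2 = 1 ->
  line_dist2 y p = dot (p.1 - y - dot (p.1 - y) p.2 *: p.2) (p.1 - y - dot (p.1 - y) p.2 *: p.2).
Proof. by move=> t1; rewrite -scaleNr dot_line// addNr expr0n /= addr0. Qed.

Lemma line_dist2_ge0 y p : dot p.2 p.2 = 1 -> 0 <= line_dist2 y p.
Proof. by move=> t1; rewrite line_dist2_min// dot_ge0. Qed.

Lemma line_dist2_shift y x th s : dot th th = 1 ->
  line_dist2 y (x + s *: th, th) = line_dist2 y (x, th).
Proof.
move=> t1; rewrite /line_dist2 /= addrAC; move: (x - y) => w.
by rewrite dot_line// dotDl dotZl t1; ring.
Qed.

Lemma chord_line c x th : 0 < c -> dot th th = 1 ->
  (chord c (dot x x - dot x th ^+ 2))%:E =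
  (\int[lambda]_s (cap c (dot (x + s *: th) (x + s *: th)))%:E)%E.
Proof.
move=> c0 t1.
have u0 : 0 <= dot x x - dot x th ^+ 2.
  by have := line_dist2_ge0 0 (p := (x, th)) t1; rewrite /line_dist2 /= subr0.
rewrite (chordE c0 u0).
rewrite (ge0_integral_affine (dot x th) (oner_neq0 R)); last 2 first.
- apply/measurable_EFinP/measurable_cap => //.
  apply: measurable_funD; first exact: measurable_cst.
  by apply: (measurable_funX 2); exact: measurable_id.
- by move=> s; rewrite lee_fin cap_ge0.
rewrite normr1 mul1e; apply: eq_integral => s _.
by rewrite mul1r dot_line.
Qed.

Definition unit_row (t : d.-tuple T) : V := (enorm (rho t))^-1 *: rho t.

Lemma unit_rowE t : punctured_ball t -> dot (unit_row t) (unit_row t) = 1.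
Proof.
move=> /andP[t0 _]; rewrite /unit_row dotZ -sqr_enorm -exprMn mulVf ?expr1n//.
by rewrite gt_eqF.
Qed.

Lemma measurable_punctured_ball : measurable (@punctured_ball R d).
Proof.
have me : measurable_fun setT (fun t : d.-tuple T => enorm (rho t)).
  by apply: measurable_enorm => i; apply: measurable_row; exact: measurable_id.
rewrite (_ : punctured_ball = (fun t => enorm (rho t)) @^-1` `]0, 1]%classic).
  by rewrite -[X in measurable X]setTI; apply: me => //; exact: measurable_itv.
by apply/seteqP; split => t /=; rewrite in_itv.
Qed.

Lemma measurable_unit_row i : measurable_fun setT (fun t => unit_row t 0 i).
Proof.
rewrite (_ : (fun t => _) = (fun t => `|enorm (rho t)|^-1 ^+ 1 * rho t 0 i)).
  apply: measurable_funM; last by apply: measurable_row; exact: measurable_id.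
  apply: measurable_invnorm.
  by apply: measurable_enorm => j; apply: measurable_row; exact: measurable_id.
by apply/funext => t; rewrite !mxE expr1 ger0_norm// enorm_ge0.
Qed.

Definition ball_tuple c : set (d.-tuple T) := [set t | dot (rho t) (rho t) <= c].

Lemma measurable_ball_tuple c : measurable (ball_tuple c).
Proof.
have me : measurable_fun setT (fun t : d.-tuple T => dot (rho t) (rho t)).
  by apply: measurable_dot => i; apply: measurable_row; exact: measurable_id.
rewrite (_ : ball_tuple c = (fun t => dot (rho t) (rho t)) @^-1` `]-oo, c]%classic).
  by rewrite -[X in measurable X]setTI; apply: me => //; exact: measurable_itv.
by apply/seteqP; split => t /=; rewrite in_itv.
Qed.

Lemma ball_tuple_lty c : (mu (ball_tuple c) < +oo)%E.
Proof.
have c0 := sqrtr_ge0 c.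
apply: (@le_lt_trans _ _ (mu (tcube (tuple_of_row (0 : V)) (Num.sqrt c)))); last first.
  by rewrite lebesgue_tcube// ltry.
apply: le_measure.
- by rewrite inE; exact: measurable_ball_tuple.
- by rewrite inE; exact: measurable_tcube.
move=> t /= tc i; rewrite tnth_mktuple mxE subr0.
have := coord_norm_le (rho t) i; rewrite mxE => /le_trans; apply.
apply: le_trans (norm_le_enorm _) _; exact: ler_wsqrtr.
Qed.

Lemma punctured_ball_lty : (mu punctured_ball < +oo)%E.
Proof.
apply: le_lt_trans (ball_tuple_lty 1); apply: le_measure.
- by rewrite inE; exact: measurable_punctured_ball.
- by rewrite inE; exact: measurable_ball_tuple.
move=> t /andP[_ t1]; rewrite /ball_tuple /= -sqr_enorm.
by rewrite expr_le1// enorm_ge0.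
Qed.

(** Up to the factor [d], the value at [x] of [X^*] applied to the test function centred at [y]. *)
Definition chord_integral y c x : R :=
  \int[mu]_(t in punctured_ball) chord c (line_dist2 y (x, unit_row t)).

Lemma smooth_on_dot_of (W : normedModType R) (U : set W) (u v : W -> V) : open U ->
  (forall i, smooth_on U (fun q => u q 0 i)) -> (forall i, smooth_on U (fun q => v q 0 i)) ->
  smooth_on U (fun q => dot (u q) (v q)).
Proof.
by move=> oU su sv; apply: (smooth_on_sum _ oU) => i; exact: (smooth_onM oU (su i) (sv i)).
Qed.

Lemma smooth_fst_coord y i : smooth_on (@setT (V * V)) (fun p => (p.1 - y) 0 i).
Proof.
apply: (eq_smooth_on openT (f := fun p : V * V => p.1 0 i - y 0 i)).
  by move=> p _; rewrite !mxE.
apply: (smooth_onB openT _ (smooth_on_cst _ openT)).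
apply: (smooth_on_affine (l := fun p : V * V => p.1 0 i) openT).
  move=> p; apply: (@continuous_comp _ _ _ (fun p : V * V => p.1) (fun x : V => x 0 i)).
    exact: cvg_fst.
  exact: (smooth_on_continuous (smooth_on_coord i openT) I).
by move=> p v h; rewrite !mxE.
Qed.

Lemma smooth_snd_coord i : smooth_on (@setT (V * V)) (fun p => p.2 0 i).
Proof.
apply: (smooth_on_affine (l := fun p : V * V => p.2 0 i) openT).
  move=> p; apply: (@continuous_comp _ _ _ (fun p : V * V => p.2) (fun x : V => x 0 i)).
    exact: cvg_snd.
  exact: (smooth_on_continuous (smooth_on_coord i openT) I).
by move=> p v h; rewrite !mxE.
Qed.

Lemma smooth_dot_fst_snd y : smooth_on (@setT (V * V)) (fun p => dot (p.1 - y) p.2).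
Proof.
apply: (smooth_on_dot_of openT); [exact: smooth_fst_coord|exact: smooth_snd_coord].
Qed.

Lemma smooth_line_dist2 y : smooth_on (@setT (V * V)) (line_dist2 y).
Proof.
have d1 := smooth_on_dot_of openT (@smooth_fst_coord y) (@smooth_fst_coord y).
have d2 := @smooth_dot_fst_snd y.
exact: (smooth_onB openT d1 (smooth_onM openT d2 d2)).
Qed.

Lemma smooth_chord_integral y c : 0 < c -> smooth_on setT (chord_integral y c).
Proof.
move=> c0.
apply: (@smooth_on_pint _ _ _ _ _ mu punctured_ball unit_row (sqball 0 1) setT setT
   _ _ _ _ openT openT _ (fun p => chord c (line_dist2 y p))) => //.
- exact: measurable_punctured_ball.
- exact: punctured_ball_lty.
- exact: compact_sqball.
- by move=> t tP; rewrite /sqball /= subr0 unit_rowE.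
- split; first exact: (smooth_on_chord c0 openT (@smooth_line_dist2 y)).
  move=> x _; apply: (@measurableT_comp _ _ _ _ _ _ (chord c)).
    by apply: continuous_measurable_fun; exact: continuous_chord.
  apply: measurable_funTS; rewrite /line_dist2 /=.
  apply: measurable_funB; first exact: measurable_cst.
  apply: (measurable_funX 2); apply: measurable_dot; last exact: measurable_unit_row.
  by move=> i; exact: measurable_cst.
Qed.

End chord_integrals.

Lemma continuous_subr (R : realType) (V : normedModType R) (y : V) :
  continuous (fun x : V => x - y).
Proof. by move=> x; apply: cvgB; [exact: cvg_id|exact: cvg_cst]. Qed.

(** * Bumps convolved with powers of the distance *)

Section riesz_potential.
Context {R : realType} {d : nat}.
Local Notation V := 'rV[R]_d.
Local Notation T := (measurableTypeR R).
Local Notation lambda := (@lebesgue_measure R).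
Local Notation mu := (lebesgue_tuple R d).
Local Notation rho := (@row_of_tuple R d).
Implicit Types (x y z : V) (U K : set V) (c a : R) (s : seq 'I_d).

Definition cap_weight c (t : d.-tuple T) : R := cap c (dot (rho t) (rho t)).

Definition cap_mass c : R := \int[mu]_(t in ball_tuple c) cap_weight c t.

(** The convolution, evaluated at [x - y], of the bump with [|x|^(2a)]. *)
Definition cap_riesz a c y x : R :=
  \int[mu]_(t in ball_tuple c) (cap_weight c t * riesz a (x - y - rho t)).

Lemma measurable_cap_weight c : measurable_fun setT (cap_weight c).
Proof.
apply: measurable_cap => //; apply: measurable_dot => i;
by apply: measurable_row; exact: measurable_id.
Qed.

Lemma flat_ge (t : R) : 2^-1 <= t -> expR (- 2) <= flat_seq 0 t.
Proof.
move=> t2; have t0 : 0 < t by exact: lt_le_trans t2.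
rewrite /flat_seq t0 hornerC mul1r ler_expR lerN2.
by rewrite -[leRHS]invrK lef_pV2 ?posrE.
Qed.

Lemma cap_weight_bounded c t : 0 < c -> 0 <= cap_weight c t <= 1.
Proof.
move=> c0; rewrite cap_ge0 /=; rewrite /cap_weight /cap /flat_seq; case: ifP => // t0.
by rewrite hornerC mul1r -[leRHS]expR0 ler_expR oppr_le0 invr_ge0 ltW.
Qed.

Lemma integrable_cap_weight c : 0 < c ->
  mu.-integrable (ball_tuple c) (EFin \o cap_weight c).
Proof.
move=> c0; apply: measurable_bounded_integrable.
- exact: measurable_ball_tuple.
- exact: ball_tuple_lty.
- exact: measurable_funTS (measurable_cap_weight c).
exists 1; split; first by rewrite num_real.
move=> M M1 t _ /=; have /andP[h0 h1] := cap_weight_bounded t c0.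
by rewrite ger0_norm// (le_trans h1)// ltW.
Qed.

Lemma cap_mass_gt0 c : 0 < c -> 0 < cap_mass c.
Proof.
move=> c0.
(* The cube of half side [dl] lies in the ball of squared radius [c / 2], where [cap c] is at least
   [exp(- 2)]; [d.+1] keeps the quotient meaningful in dimension 0. *)
pose e : R := c / 2 / d.+1%:R; pose dl : R := Num.sqrt e.
have e0 : 0 < e by rewrite !divr_gt0// ltr0n.
have dl0 : 0 < dl by rewrite sqrtr_gt0.
pose Q := tcube (tuple_of_row (0 : V)) dl.
have QB t : Q t -> dot (rho t) (rho t) <= c / 2.
  move=> Qt; apply: (@le_trans _ _ (\sum_(i < d) e)).
    apply: ler_sum => i _; rewrite mxE.
    have := Qt i; rewrite tnth_mktuple mxE subr0 -expr2 => h.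
    rewrite -real_normK ?num_real// -(sqr_sqrtr (ltW e0)).
    by rewrite ler_sqr ?nnegrE// ltW.
  have -> : \sum_(i < d) e = e * d%:R by rewrite sumr_const card_ord mulr_natr.
  have -> : e * d%:R = c / 2 * (d%:R / d.+1%:R) by rewrite /e mulrAC mulrA.
  rewrite ler_piMr ?divr_ge0 ?(ltW c0)//.
  by rewrite ler_pdivrMr ?ltr0n// mul1r ler_nat.
have QB' : Q `<=` ball_tuple c.
  by move=> t /QB h; apply: le_trans h _; rewrite ler_pdivrMr// ler_peMr ?(ltW c0)// ler1n.
have mQ : measurable Q by exact: measurable_tcube.
have mB := @measurable_ball_tuple R d c.
rewrite -lte_fin /cap_mass /Rintegral fineK; last first.
  exact: (integrable_fin_num mB (integrable_cap_weight c0)).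
have mw D : measurable_fun D (EFin \o cap_weight c).
  by apply: measurable_funTS; apply/measurable_EFinP; exact: measurable_cap_weight.
apply: (@lt_le_trans _ _ ((expR (- 2))%:E * mu Q)%E).
  rewrite /Q lebesgue_tcube ?(ltW dl0)// -EFinM lte_fin mulr_gt0 ?expR_gt0// exprn_gt0//.
  by rewrite mulr_gt0.
rewrite -integral_cst//.
apply: (@le_trans _ _ (\int[mu]_(t in Q) (cap_weight c t)%:E)%E); last first.
  apply: ge0_subset_integral => //.
  by move=> t _; rewrite lee_fin; exact: cap_ge0.
apply: ge0_le_integral => //.
- by move=> t _; rewrite lee_fin expR_ge0.
- move=> t Qt; rewrite lee_fin; apply: flat_ge.
  rewrite lerBrDr -lerBrDl ler_pdivrMr//.
  by apply: le_trans (QB t Qt) _; nra.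
Qed.

Lemma smooth_dot_diff y :
  smooth_on (@setT (V * V)) (fun p : V * V => dot (p.1 - y - p.2) (p.1 - y - p.2)).
Proof.
have s1 i : smooth_on (@setT (V * V)) (fun p : V * V => (p.1 - y - p.2) 0 i).
  apply: (eq_smooth_on openT (f := fun p : V * V => (p.1 - y) 0 i - p.2 0 i)).
    by move=> p _; rewrite !mxE.
  exact: (smooth_onB openT (@smooth_fst_coord R d y i) (@smooth_snd_coord R d i)).
exact: (smooth_on_dot_of openT s1 s1).
Qed.

Lemma smooth_dot_snd : smooth_on (@setT (V * V)) (fun p : V * V => dot p.2 p.2).
Proof. exact: (smooth_on_dot_of openT (@smooth_snd_coord R d) (@smooth_snd_coord R d)). Qed.

(** Despite the name, the complement of the pole: the pairs near which the kernel is smooth. *)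
Let pole y : set (V * V) := [set p | 0 < dot (p.1 - y - p.2) (p.1 - y - p.2)].

Let open_pole y : open (pole y).
Proof.
apply: (@open_comp _ _ (fun p : V * V => dot (p.1 - y - p.2) (p.1 - y - p.2)) [set t | 0 < t]).
  by move=> x _; exact: smooth_on_continuous (@smooth_dot_diff y) I.
exact: open_gt.
Qed.

Let kernel a c y (p : V * V) : R := cap c (dot p.2 p.2) * riesz a (p.1 - y - p.2).

Lemma dist_pole x z c : dot z z <= c -> c < dot x x -> 0 < dot (x - z) (x - z).
Proof.
move=> zc cx; rewrite lt_neqAle dot_ge0 andbT eq_sym; apply/negP => /eqP h.
have xz : enorm (x - z) = 0 by rewrite /enorm h sqrtr0.
have : x - z = 0.
  by apply/eqP; rewrite -normr_eq0 eq_le normr_ge0 andbT -xz norm_le_enorm.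
by move/subr0_eq => xE; move: (le_lt_trans zc cx); rewrite xE ltxx.
Qed.

Section fixed_scale.
Variables (U : set V) (a c : R) (y : V).
Hypotheses (oU : open U) (Uc : forall x, U x -> c < dot (x - y) (x - y)).

Let Upole x w : U x -> sqball 0 c w -> pole y (x, w).
Proof. by move=> /Uc Ux; rewrite /sqball /= subr0 => wc; exact: dist_pole Ux. Qed.

Let mB := @measurable_ball_tuple R d c.
Let fB := @ball_tuple_lty R d c.
Let cC := @compact_sqball R d 0 c.
Let thC t : ball_tuple c t -> sqball 0 c (rho t).
Proof. by rewrite /sqball /= subr0. Qed.

Let param : parametric (ball_tuple c) rho U (pole y) (kernel a c y).
Proof.
have oP := @open_pole y.
have sT : forall g, smooth_on (@setT (V * V)) g -> smooth_on (pole y) g.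
  by move=> g; exact: smooth_onS.
split.
  apply: (smooth_onM oP); first exact: (smooth_on_cap c oP (sT _ smooth_dot_snd)).
  have := smooth_on_comp 0 oP (deriv_seq_powR a) (sT _ (@smooth_dot_diff y)) (fun _ h => h).
  apply: (eq_smooth_on oP) => p _.
  by rewrite /powR_seq big_ord0 mul1r subr0.
move=> x _; apply: measurable_funTS; apply: measurable_funM; first exact: measurable_cap_weight.
rewrite /riesz; apply: (@measurableT_comp _ _ _ _ _ _ (@powR R ^~ a)); first exact: measurable_powR.
have md i : measurable_fun setT (fun t => (x - y - rho t) 0 i).
  rewrite (_ : (fun t => _) = (fun t => (x - y) 0 i - rho t 0 i)).
    by apply: measurable_funB; [exact: measurable_cst|apply: measurable_row; exact: measurable_id].
  by apply/funext => t; rewrite !mxE.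
by apply: measurable_dot.
Qed.

Lemma smooth_cap_riesz : smooth_on U (cap_riesz a c y).
Proof. exact: (smooth_on_pint mB fB cC thC oU (@open_pole y) Upole param). Qed.

Let kernel_derive s x t : U x -> ball_tuple c t ->
  iter_derive [seq delta_mx 0 i : V | i <- s] (fun x => kernel a c y (x, rho t)) x =
  cap_weight c t * pd s (riesz a) (x - y - rho t).
Proof.
move=> Ux Bt; pose z := y + rho t.
have E : (fun x => kernel a c y (x, rho t)) = (fun x => cap_weight c t * riesz a (x - z)).
  by apply/funext => x'; rewrite /kernel /= /z opprD addrA.
have oz : open [set x : V | away0 (x - z)].
  apply: (@open_comp _ _ (fun x : V => dot (x - z) (x - z)) [set t | 0 < t]); last exact: open_gt.
  by move=> x' _; exact: dot_sub_continuous.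
have xz : [set x : V | away0 (x - z)] x.
  by rewrite /= /z opprD addrA; apply: (Upole Ux); exact: thC.
rewrite E -/(pd s (fun x => cap_weight c t * riesz a (x - z)) x).
rewrite (pdZ _ _ oz (smooth_on_translate (a := z) (smooth_on_riesz a)) xz).
by rewrite pd_translate /z opprD addrA.
Qed.

Lemma pd_cap_riesz s x : U x -> pd s (cap_riesz a c y) x =
  \int[mu]_(t in ball_tuple c) (cap_weight c t * pd s (riesz a) (x - y - rho t)).
Proof.
move=> Ux.
have := iter_derive_pint mB fB cC thC oU (@open_pole y) Upole
  [seq delta_mx 0 i : V | i <- s] param Ux.
rewrite -[LHS]/(pd s (cap_riesz a c y) x) => ->.
by apply: eq_Rintegral => t /set_mem Bt; exact: kernel_derive.
Qed.

Lemma integrable_pd_cap_riesz s x : U x -> mu.-integrable (ball_tuple c)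
  (EFin \o (fun t => cap_weight c t * pd s (riesz a) (x - y - rho t))).
Proof.
move=> Ux.
have := integrable_iter_derive mB fB cC thC oU (@open_pole y) Upole
  [seq delta_mx 0 i : V | i <- s] param Ux.
apply: (eq_integrable mB) => t /set_mem Bt /=.
by congr (_%:E); exact: kernel_derive.
Qed.

End fixed_scale.

(** An approximate identity: the normalized bump has mass 1, derivatives fall on the kernel, and
    they are uniformly continuous around the compact [Ky]. *)
Lemma cap_riesz_approx U K a y c0 N (e : R) : open U -> compact K -> K `<=` U -> 0 < c0 ->
  (forall x, U x -> c0 <= dot (x - y) (x - y)) -> 0 < e ->
  exists c : R, [/\ 0 < c, c < c0 & CN_le K N
    (fun x => (cap_mass c)^-1 * cap_riesz a c y x - riesz a (x - y)) e].
Proof.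
move=> oU cK KU c00 Uc e0.
pose Ky := (fun x => x - y) @` K.
have cKy : compact Ky.
  apply: continuous_compact => //; apply: continuous_subspaceT; exact: continuous_subr.
have Ky0 : Ky `<=` away0.
  by move=> _ [x /KU /Uc Kx <-]; exact: lt_le_trans Kx.
have [tau [tau0 Htau]] : exists tau : R, 0 < tau /\ forall s, (size s <= N)%N ->
    forall z w, Ky z -> `|w| < tau -> `|pd s (riesz a) (w + z) - pd s (riesz a) z| < e.
  have H : \forall tau \near (0 : R)^'+, forall s, (size s <= N)%N ->
      forall z w, Ky z -> `|w| < tau -> `|pd s (riesz a) (w + z) - pd s (riesz a) z| < e.
    apply: near_lists => s.
    have cont x : away0 x -> {for x, continuous (pd s (riesz a))}.
      by move=> x0; exact: (smooth_on_continuous (smooth_on_pd s (smooth_on_riesz a)) x0).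
    have [r r0 Hr] := uniform_continuity_compact open_away0 cKy Ky0 cont e0.
    apply: filterS (nbhs_right_lt r0) => tau tr z w Kz wtau.
    by have [] := Hr z w Kz (lt_trans wtau tr).
  have [tau [t1 t2]] := filter_ex (filterI (nbhs_right_gt (0 : R)) H).
  by exists tau.
(* Below [c0] the bump stays off the pole; below [tau ^+ 2] its support has radius less than
   [tau]. *)
pose c := Num.min c0 (tau ^+ 2) / 2.
have m0 : 0 < Num.min c0 (tau ^+ 2) by rewrite lt_min c00 exprn_gt0.
have c_gt0 : 0 < c by rewrite divr_gt0.
have cm : c < Num.min c0 (tau ^+ 2) by rewrite ltr_pdivrMr// ltr_pMr// ltr1n.
have cc0 : c < c0 by apply: lt_le_trans cm _; rewrite ge_min lexx.
have ct : c < tau ^+ 2 by apply: lt_le_trans cm _; rewrite ge_min lexx orbT.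
exists c; split => // s x sN Kx.
have Ux := KU _ Kx.
have Uc' x' : U x' -> c < dot (x' - y) (x' - y) by move=> /Uc; exact: lt_le_trans.
have scr := smooth_cap_riesz a oU Uc'.
have srz : smooth_on U (fun x => riesz a (x - y)).
  apply: smooth_onS (smooth_on_translate (a := y) (smooth_on_riesz a)).
  by move=> x' /Uc'; exact: lt_trans.
rewrite (pdB s oU (smooth_onZ _ oU scr) srz Ux) (pdZ s _ oU scr Ux).
rewrite (pd_cap_riesz a oU Uc' s Ux) pd_translate.
have M0 := cap_mass_gt0 c_gt0.
set k := pd s (riesz a).
have mB := @measurable_ball_tuple R d c.
have i1 := integrable_pd_cap_riesz a oU Uc' s Ux.
have i2 : mu.-integrable (ball_tuple c) (EFin \o (fun t => cap_weight c t * k (x - y))).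
  by rewrite /comp; under eq_fun do rewrite EFinM; exact: (integrableZr _ (k (x - y)) (integrable_cap_weight c_gt0)).
have i3 : mu.-integrable (ball_tuple c) (EFin \o (fun t => cap_weight c t * e)).
  by rewrite /comp; under eq_fun do rewrite EFinM; exact: (integrableZr _ e (integrable_cap_weight c_gt0)).
have -> : (cap_mass c)^-1 * \int[mu]_(t in ball_tuple c) (cap_weight c t * k (x - y - rho t)) - k (x - y) =
   (cap_mass c)^-1 * \int[mu]_(t in ball_tuple c)
     (cap_weight c t * k (x - y - rho t) - cap_weight c t * k (x - y)).
  rewrite RintegralB// RintegralZr//; last exact: integrable_cap_weight.
  by rewrite -/(cap_mass c) mulrBr mulKf// gt_eqF.
rewrite normrM gtr0_norm ?invr_gt0// ler_pdivrMl//.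
have i12 : mu.-integrable (ball_tuple c)
   (EFin \o (fun t => cap_weight c t * k (x - y - rho t) - cap_weight c t * k (x - y))).
  by rewrite /comp; under eq_fun do rewrite EFinB; apply: integrableB.
apply: le_trans (le_normr_Rintegral mB i12) _.
apply: (@le_trans _ _ (\int[mu]_(t in ball_tuple c) (cap_weight c t * e))); last first.
  by rewrite RintegralZr//; exact: integrable_cap_weight.
apply: le_Rintegral => //.
  exact: integrable_norm.
move=> t Bt; rewrite -mulrBr normrM ger0_norm; last exact: cap_ge0.
apply: ler_wpM2l; first exact: cap_ge0.
rewrite (addrC (x - y)); apply/ltW/Htau => //; first by exists x.
rewrite normrN; apply: le_lt_trans (norm_le_enorm _) _.
by rewrite enorm_lt//; exact: le_lt_trans ct.
Qed.

End riesz_potential.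

(** * Test functions on the manifold of lines *)

Section xray_test.
Context {R : realType} {d : nat}.
Local Notation V := 'rV[R]_d.
Local Notation T := (measurableTypeR R).
Local Notation lambda := (@lebesgue_measure R).
Local Notation mu := (lebesgue_tuple R d).
Local Notation rho := (@row_of_tuple R d).
Implicit Types (x y z : V) (p : V * V) (c : R).

Lemma riesz_kernelE (x : V) : 0 < dot x x ->
  enorm x * (enorm x)^-1 ^+ d = riesz (- (d%:R - 1) / 2) x.
Proof.
move=> x0; have e0 : 0 < enorm x by rewrite sqrtr_gt0.
rewrite /riesz -sqr_enorm -(powR_mulrn 2 (ltW e0)) -powRrM.
apply: (mulIf (expf_neq0 d (lt0r_neq0 e0))).
rewrite exprVn mulfVK ?expf_neq0 ?gt_eqF// -(powR_mulrn d (ltW e0)) -powRD; last first.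
  by rewrite (gt_eqF e0) implybT.
by rewrite (_ : _ + _ = 1) ?powRr1 ?(ltW e0)//; field.
Qed.

Lemma enormN x : enorm (- x) = enorm x.
Proof. by rewrite /enorm /dot; congr Num.sqrt; apply: eq_bigr => i _; rewrite !mxE mulrNN. Qed.

(** The polar formula for [G = cap c] at the point [x - y], which lies outside the bump: there [G]
    vanishes, as the formula requires, and the convolution avoids the pole. *)
Lemma chord_integral_riesz y c x : (0 < d)%N -> 0 < c -> c < dot (x - y) (x - y) ->
  chord_integral y c x =
  fine (@polar_const R d) * cap_riesz (- (d%:R - 1) / 2) c y x.
Proof.
move=> d0 c0 cx; set x' := x - y.
have mcap : measurable_fun setT (@cap R c).
  by apply: continuous_measurable_fun; exact: continuous_cap.
have polar := polar_integral mcap (fun s => cap_ge0 c s) (cap_eq0 c0 (ltW cx)).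
have E : (\int[mu]_(t in punctured_ball) (chord c (line_dist2 y (x, unit_row t)))%:E =
   @polar_const R d * \int[mu]_w (cap c (dot (rho w) (rho w)) *
     (enorm (rho w - x') * (enorm (rho w - x'))^-1 ^+ d))%:E)%E.
  rewrite -polar; apply: eq_integral => t /set_mem tP.
  by rewrite -(chord_line x' c0 (unit_rowE tP)).
rewrite /chord_integral /Rintegral E.
have F : (\int[mu]_w (cap c (dot (rho w) (rho w)) *
     (enorm (rho w - x') * (enorm (rho w - x'))^-1 ^+ d))%:E =
   \int[mu]_(t in ball_tuple c) (cap_weight c t * riesz (- (d%:R - 1) / 2) (x' - rho t))%:E)%E.
  rewrite [RHS]integral_mkcond; apply: eq_integral => t _; rewrite patchE.
  case: ifPn => [/set_mem tc|/negP tc].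
    rewrite -opprB enormN riesz_kernelE//.
    exact: dist_pole tc cx.
  rewrite cap_eq0 ?mul0r// leNgt; apply/negP => h; apply: tc.
  by apply/mem_set/ltW.
rewrite F /cap_riesz /Rintegral.
have I0 : (0 <= \int[mu]_(t in ball_tuple c)
    (cap_weight c t * riesz (- (d%:R - 1) / 2) (x' - rho t))%:E)%E.
  by apply: integral_ge0 => t _; rewrite lee_fin mulr_ge0 ?powR_ge0//; exact: cap_ge0.
have p0 := @polar_const_gt0 R d; have p1 := @polar_const_lty R d d0.
have pE : @polar_const R d \is a fin_num by rewrite gt0_fin_numE.
(* An infinite integral would be harmless: [fine] sends it to 0 on both sides. *)
move: I0; rewrite -(fineK pE); case: (integral _ _ _) => [i| |] //= _.
by rewrite gt0_muley ?mulr0// fineK.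
Qed.

(** The X-ray transform of the bump centred at [y], by a formula that is smooth on the whole ambient
    space. *)
Definition xray_test y c p : R[i] := (chord c (line_dist2 y p))%:C%C.

(** Replacing [x] by the foot of the perpendicular from the origin keeps the line, hence its
    distance to [y]; the surface measure supplies the factor [d]. *)
Lemma xray_adjoint_test y c x :
  xray_adjoint (xray_test y c) x = (d%:R * chord_integral y c x)%:C%C.
Proof.
have Re_test t : punctured_ball t ->
    complex.Re (xray_test y c (x - dot x (unit_row t) *: unit_row t, unit_row t)) =
    chord c (line_dist2 y (x, unit_row t)).
  by move=> tP; rewrite -scaleNr -(line_dist2_shift y x (- dot x (unit_row t)) (unit_rowE tP)).
have E1 : \int[mu]_(t in punctured_ball)
    complex.Re (xray_test y c (x - dot x (unit_row t) *: unit_row t, unit_row t)) =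
    chord_integral y c x.
  by rewrite /chord_integral; apply: eq_Rintegral => t /set_mem; exact: Re_test.
have E2 : \int[mu]_(t in punctured_ball)
    complex.Im (xray_test y c (x - dot x (unit_row t) *: unit_row t, unit_row t)) = 0.
  transitivity (\int[mu]_(t in punctured_ball) (0 : R)); first exact: eq_Rintegral.
  by rewrite (Rintegral_cst _ (@measurable_punctured_ball R d)) mul0r.
rewrite /xray_adjoint /sphere_integralC /sphere_integral.
rewrite -/punctured_ball -/unit_row.
by rewrite E1 E2 mulr0.
Qed.

Lemma closed_lines : closed (@lines R d).
Proof.
have -> : @lines R d = [set p | dot p.2 p.2 = 1] `&` [set p | dot p.1 p.2 = 0].
  apply/seteqP; split => p [h1 h2]; split => //.
    by rewrite /= -sqr_enorm h1 expr1n.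
  by rewrite /enorm h1 sqrtr1.
have c1 := smooth_on_continuous (@smooth_dot_snd R d).
have c2 (p : V * V) : {for p, continuous (fun p : V * V => dot p.1 p.2)}.
  have := smooth_on_continuous (@smooth_dot_fst_snd R d 0) (x := p) I.
  by under [X in {for _, continuous X}]eq_fun do rewrite subr0.
apply: closedI.
  apply: (@closed_comp _ _ (fun p : V * V => dot p.2 p.2) [set 1]); last exact: closed_eq.
  by move=> p _; exact: c1.
apply: (@closed_comp _ _ (fun p : V * V => dot p.1 p.2) [set 0]); last exact: closed_eq.
by move=> p _; exact: c2.
Qed.

Definition near_lines y c : set (V * V) := [set p | lines p /\ line_dist2 y p <= c].

(** As [p.1] is orthogonal to [p.2], the point of the line nearest to [y] is
    [p.1 + dot y p.2 *: p.2]. *)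
Lemma foot_point y p : lines p ->
  line_dist2 y p = dot (p.1 + dot y p.2 *: p.2 - y) (p.1 + dot y p.2 *: p.2 - y).
Proof.
move=> [p1 p2]; have t1 : dot p.2 p.2 = 1 by rewrite -sqr_enorm p1 expr1n.
rewrite line_dist2_min//.
suff -> : p.1 - y - dot (p.1 - y) p.2 *: p.2 = p.1 + dot y p.2 *: p.2 - y by [].
have -> : dot (p.1 - y) p.2 = - dot y p.2.
  by rewrite -(scaleN1r y) dotDl dotZl p2 add0r mulN1r.
by rewrite scaleNr opprK addrAC.
Qed.

Lemma dotD_le x y : dot (x + y) (x + y) <= 2 * dot x x + 2 * dot y y.
Proof.
have := dot_ge0 (x - y); rewrite -(scaleN1r y) !(dotDl, dotDr, dotZl, dotZr) (dotC y x); lra.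
Qed.

Lemma near_lines_foot y c p : near_lines y c p ->
  dot (p.1 + dot y p.2 *: p.2) (p.1 + dot y p.2 *: p.2) <= 2 * c + 2 * dot y y.
Proof.
move=> [lp]; rewrite (foot_point y lp); set q := p.1 + _ => qc.
by have := dotD_le (q - y) y; rewrite subrK => h; lra.
Qed.

(** The foot point is bounded, and [p.1], being orthogonal to the direction, is the point of the
    line nearest to the origin. *)
Lemma compact_near_lines y c : compact (near_lines y c).
Proof.
apply: (@subclosed_compact _ _ (sqball 0 (2 * c + 2 * dot y y) `*` sqball 0 1)).
- apply: (@closedI _ _ [set p | line_dist2 y p <= c]); first exact: closed_lines.
  apply: (@closed_comp _ _ (line_dist2 y) [set t | t <= c]); last exact: closed_le.
  by move=> p _; exact: (smooth_on_continuous (@smooth_line_dist2 R d y) I).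
- by apply: compact_setX; exact: compact_sqball.
- move=> p yp; have [[p1 p2] _] := yp.
  have t1 : dot p.2 p.2 = 1 by rewrite -sqr_enorm p1 expr1n.
  split; rewrite /sqball /= subr0 ?t1//; apply: le_trans (near_lines_foot yp).
  by rewrite dot_line// p2 expr0n /= subr0 lerDl sqr_ge0.
Qed.

Lemma xray_test_support y c : 0 < c -> lines_support (xray_test y c) `<=` near_lines y c.
Proof.
move=> c0 p [lp].
have : closed (near_lines y c).
  by apply: compact_closed; [exact: norm_hausdorff|exact: compact_near_lines].
move=> /closure_id -> ; apply: closure_subset => q [lq qn]; split => //.
rewrite leNgt; apply/negP => cq; move/negP: qn; apply; apply/eqP.
by rewrite /xray_test chord_eq0// ltW.
Qed.

Lemma test_on_lines_xray_test y c : 0 < c -> test_on_lines (xray_test y c).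
Proof.
move=> c0; split.
  move=> p _; exists setT, (xray_test y c); split => //; first exact: openT.
  split; last exact: (smooth_on_cst 0 openT).
  exact: (smooth_on_chord c0 openT (@smooth_line_dist2 R d y)).
apply: subclosed_compact (@xray_test_support y c c0); last exact: compact_near_lines.
by apply: closedI; [exact: closed_lines|exact: closed_closure].
Qed.

Lemma xray_test_meets y c (r : R) : 0 < c -> 0 < r -> 2 * c + 2 * dot y y < r ^+ 2 ->
  lines_support (xray_test y c) `<=` lines_meeting (eball 0 r).
Proof.
move=> c0 r0 cr p /(xray_test_support c0) yp; have [lp _] := yp; split => //.
exists (p.1 + dot y p.2 *: p.2); split; first by exists (dot y p.2).
by rewrite /eball /= subr0 enorm_lt//; exact: le_lt_trans (near_lines_foot yp) cr.
Qed.

End xray_test.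

(** * Localization of the distribution *)

Section cutoff.
Context {R : realType} {d : nat}.
Local Notation V := 'rV[R]_d.
Implicit Types (x y : V) (g G : V -> R) (s : seq 'I_d).
Variables (f : compact_distribution R d) (q : R).
Hypotheses (q0 : 0 < q).

(** With [q = r ^+ 2] the radii are [r / 8] for the poles [y], [r / 4] for [outer], and [r / 2] and
    [r / sqrt 2] for the start and end of the cutoff's transition. Poles thus stay at distance at
    least [r / 8] from [outer], and the cutoff is 1 near the support of [f]. *)
Definition outer : set V := [set x | q / 16 < dot x x].

Lemma open_outer : open outer.
Proof.
apply: (@open_comp _ _ (fun x : V => dot x x) [set t | q / 16 < t]); last exact: open_gt.
by move=> x _; exact: smooth_on_continuous (smooth_on_dot0 openT) I.
Qed.

Definition cutoff x : R := smooth_step (4 * (dot x x / q) - 1).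

Lemma smooth_cutoff : smooth_on setT cutoff.
Proof.
have s1 := smooth_onM openT (smooth_on_dot0 (@openT V)) (smooth_on_cst q^-1 openT).
exact: (smooth_on_step openT (smooth_onB openT (smooth_onZ 4 openT s1) (smooth_on_cst 1 openT))).
Qed.

Lemma cutoff0 x : dot x x <= q / 4 -> cutoff x = 0.
Proof.
by move=> xq; apply: smooth_step0; rewrite subr_le0 mulrA ler_pdivrMr//; lra.
Qed.

Lemma cutoff1 x : q / 2 <= dot x x -> cutoff x = 1.
Proof.
by move=> xq; apply: smooth_step1; rewrite lerBrDr mulrA ler_pdivlMr//; lra.
Qed.

(* The cutoff already vanishes off [outer], where [g] may be singular. *)
Definition extend g x : R := if q / 16 < dot x x then cutoff x * g x else 0.

Lemma extend_outer g x : outer x -> extend g x = cutoff x * g x.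
Proof. by rewrite /outer /extend /= => ->. Qed.

Definition inner : set V := [set x | dot x x < q / 4].

Lemma open_inner : open inner.
Proof.
apply: (@open_comp _ _ (fun x : V => dot x x) [set t | t < q / 4]); last exact: open_lt.
by move=> x _; exact: smooth_on_continuous (smooth_on_dot0 openT) I.
Qed.

Lemma extend_inner g x : inner x -> extend g x = 0.
Proof. by move=> /ltW xq; rewrite /extend cutoff0// mul0r if_same. Qed.

Lemma smooth_extend g : smooth_on outer g -> smooth_on setT (extend g).
Proof.
move=> sg; have oO := open_outer; have oI := open_inner.
have -> : setT = outer `|` inner.
  apply/seteqP; split => // x _; have [h|h] := ltP (q / 16) (dot x x); first by left.
  by right; rewrite /inner /=; move: h q0; lra.
apply: smooth_onU.
  have sc : smooth_on outer cutoff by exact: smooth_onS smooth_cutoff.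
  by apply: (eq_smooth_on oO _ (smooth_onM oO sc sg)) => x /extend_outer ->.
by apply: (eq_smooth_on oI _ (smooth_on_cst 0 oI)) => x /extend_inner ->.
Qed.

Lemma pd0 s x : pd s (fun=> 0 : R) x = 0 :> R.
Proof.
have := pdZ s 0 openT (smooth_on_cst 0 openT) (I : setT x).
by rewrite !mul0r.
Qed.

Section real_part.
Variable P : R[i] -> R.
Hypotheses (PD : forall z w, P (z + w) = P z + P w)
  (PZ : forall (c : R) z, P (c%:C%C * z) = c * P z)
  (P_le : forall z, `|P z| <= Normc.normc z).

(** [f] on functions that need be smooth on [outer] only; [P] will be the real or the imaginary
    part. *)
Definition outer_pairing g : R := P (rpair f (extend g)).

Lemma local_outer_pairing : exists K, local_functional outer K outer_pairing.
Proof.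
have oO := open_outer; have oI := open_inner.
have [K [N [c [cK c0 Hc]]]] := rpair_bound f.
(* [K] may leave [outer]; where [dot x x < q / 4] the extension is identically 0, so only this part
   of [K] counts. *)
pose K' := K `&` [set x | q / 4 <= dot x x].
have cK' : compact K'.
  apply: (@subclosed_compact _ K' K) => //; last by move=> x [].
  apply: closedI; first by apply: compact_closed => //; exact: norm_hausdorff.
  apply: (@closed_comp _ _ (fun x : V => dot x x) [set t | q / 4 <= t]); last exact: closed_ge.
  by move=> x _; exact: smooth_on_continuous (smooth_on_dot0 openT) I.
have K'O : K' `<=` outer by move=> x [_ /=]; rewrite /outer /=; move: q0; lra.
have sc : smooth_on outer cutoff by exact: smooth_onS smooth_cutoff.
exists K'; split.
- exact: oO.
- exact: cK'.
- exact: K'O.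
- move=> g h sg sh; rewrite /outer_pairing -PD -rpairD; [|exact: smooth_extend..].
  congr (P (rpair f _)); apply/funext => x; rewrite /extend.
  by case: ifP => _; rewrite ?mulrDr ?addr0.
- move=> k g sg; rewrite /outer_pairing -PZ -rpairZ; last exact: smooth_extend.
  congr (P (rpair f _)); apply/funext => x; rewrite /extend.
  by case: ifP => _; rewrite ?mulr0// mulrCA.
have [C C0 HC] := CN_le_product N oO cK' K'O sc.
exists N, (c * C); split; first by rewrite mulr_ge0.
move=> g M sg M0 gM; apply: le_trans (P_le _) _; rewrite -mulrA.
apply: Hc; [exact: smooth_extend|exact: mulr_ge0|].
move=> s x sN Kx; have [h|h] := leP (q / 4) (dot x x).
  have K'x : K' x by [].
  rewrite (eq_pd s oO (g := fun x => cutoff x * g x) _ (K'O _ K'x)).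
    exact: HC.
  by move=> y /extend_outer.
rewrite (eq_pd s oI (g := fun=> 0) (@extend_inner g) h) pd0 normr0.
exact: mulr_ge0.
Qed.

Variable r : R.
Hypotheses (r0 : 0 < r) (rq : q = r ^+ 2) (d2 : (2 <= d)%N).
Hypotheses (Hspt : forall x, eball 0 r x -> ~ spt f x)
  (hX : xray_vanishes_on_lines_meeting f (eball 0 r)).

(** [g] and its extension differ only in the ball of squared radius [q / 2], a compact subset of
    [B(0, r)], which misses the support of [f]. *)
Lemma outer_pairingE g : smooth_on setT g -> outer_pairing g = P (rpair f g).
Proof.
move=> sg.
have sE : smooth_on setT (extend g) by apply: smooth_extend; exact: smooth_onS sg.
have : rpair f (fun x => g x - extend g x) = 0.
  apply: (rpair_vanish (S := sqball 0 (q / 2)) (O := eball 0 r)).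
  - exact: (smooth_onB openT sg sE).
  - exact: compact_sqball.
  - move=> x; rewrite /sqball /eball /= subr0 enorm_lt// -rq => h.
    by apply: le_lt_trans h _; move: q0; lra.
  - exact: Hspt.
  - move=> x /negP; rewrite /= subr0 -ltNge => h.
    rewrite extend_outer; last by rewrite /outer /=; move: h q0; lra.
    by rewrite cutoff1 ?mul1r ?subrr// ltW.
by rewrite (rpairB f sg sE) => /subr0_eq; rewrite /outer_pairing => ->.
Qed.

(** From [|x|^2 <= 2 |x - y|^2 + 2 |y|^2]: of [q / 16] at most [q / 32] is lost, and half of the
    rest is [q / 64]. *)
Lemma outer_dist x y : outer x -> dot y y < q / 64 -> q / 64 <= dot (x - y) (x - y).
Proof.
rewrite /outer /= => xq yq; have := dotD_le (x - y) y; rewrite subrK => h.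
lra.
Qed.

(** The hypothesis on [X f] enters here. The bounds on [c] and [y] give [2 c + 2 |y|^2 < q / 16], so
    the lines in the support of the test function meet [B(0, r)], and they keep the bump around [y]
    away from [outer], where the chord integral becomes the smoothed kernel. *)
Lemma outer_pairing_cap_riesz c y : 0 < c -> c < q / 64 -> dot y y < q / 64 ->
  outer_pairing (cap_riesz (- (d%:R - 1) / 2) c y) = 0.
Proof.
move=> c0 cq yq; have d0 : (0 < d)%N by exact: ltnW.
have [K HL] := local_outer_pairing.
have oO := open_outer.
have Uc x : outer x -> c < dot (x - y) (x - y).
  by move=> Ux; apply: lt_le_trans cq _; exact: outer_dist.
have scr := smooth_cap_riesz (- (d%:R - 1) / 2) oO Uc.
have sci := @smooth_chord_integral R d y c c0.
have sdci := smooth_onZ d%:R openT sci.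
pose p := fine (@polar_const R d).
have p0 : 0 < p.
  by apply: fine_gt0; rewrite polar_const_gt0 polar_const_lty.
have dp : d%:R * p != 0 by rewrite mulf_neq0 ?gt_eqF// ltr0n.
have L0 : outer_pairing (fun x => d%:R * chord_integral y c x) = 0.
  rewrite (outer_pairingE sdci).
  have -> : rpair f (fun x => d%:R * chord_integral y c x) = xray f (xray_test y c).
    by rewrite /xray /rpair; congr (f _); apply/funext => x; rewrite xray_adjoint_test.
  rewrite hX.
  - by have := PZ 0 0; rewrite mulr0 mul0r.
  - exact: test_on_lines_xray_test.
  - by apply: xray_test_meets => //; rewrite -rq; lra.
have sdciU : smooth_on outer (fun x => d%:R * chord_integral y c x).
  exact: smooth_onS sdci.
have E x : outer x -> d%:R * chord_integral y c x =
    (d%:R * p) * cap_riesz (- (d%:R - 1) / 2) c y x.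
  by move=> /Uc xc; rewrite (chord_integral_riesz d0 c0 xc) mulrA.
move: L0; rewrite (eq_lf HL sdciU E) (lf_scale HL _ scr) => /eqP.
by rewrite mulf_eq0 (negPf dp) => /eqP.
Qed.

Lemma outer_pairing_riesz : kills_translates outer_pairing [set y | dot y y < q / 64]
  (riesz (- (d%:R - 1) / 2)).
Proof.
move=> y /= yq; have [K HL] := local_outer_pairing.
have oO := open_outer.
have q64 : 0 < q / 64 by rewrite divr_gt0.
have Uc x : outer x -> q / 64 <= dot (x - y) (x - y) by move=> Ux; exact: outer_dist.
apply: (lf_cvg0 HL).
  apply: smooth_onS (smooth_on_translate (a := y) (smooth_on_riesz (- (d%:R - 1) / 2))).
  by move=> x /Uc h; apply: lt_le_trans h.
move=> N e e0.
have [c [c0 cq Hc]] := cap_riesz_approx (- (d%:R - 1) / 2) N oO (lf_compact HL) (lf_sub HL) q64 Uc e0.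
have scr : smooth_on outer (cap_riesz (- (d%:R - 1) / 2) c y).
  by apply: (smooth_cap_riesz _ oO) => x /Uc; exact: lt_le_trans.
exists (fun x => (@cap_mass R d c)^-1 * cap_riesz (- (d%:R - 1) / 2) c y x).
split; [exact: (smooth_onZ _ oO scr)| |exact: Hc].
by rewrite (lf_scale HL _ scr) outer_pairing_cap_riesz// mulr0.
Qed.

Lemma real_part_vanishes g : smooth_on setT g -> P (rpair f g) = 0.
Proof.
move=> sg; rewrite -outer_pairingE//; have [K HL] := local_outer_pairing.
apply: (lf_riesz_kills_smooth HL (B := [set y | dot y y < q / 64])) => //.
- apply: (@open_comp _ _ (fun x : V => dot x x) [set t | t < q / 64]); last exact: open_lt.
  by move=> x _; exact: smooth_on_continuous (smooth_on_dot0 openT) I.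
- move=> x y Ux yq; have := outer_dist Ux yq; rewrite /away0 /=.
  by move: q0; lra.
- by rewrite /= /dot big1 => [|i _]; rewrite ?mxE ?mul0r//; move: q0; lra.
- exact: outer_pairing_riesz.
Qed.

End real_part.

End cutoff.

Theorem corollary1p3 (R : realType) (d : nat) (hd : (2 <= d)%N)
  (rho r : R) (hr : 0 < r) (hrho : r < rho)
  (f : compact_distribution R d)
  (hspt : spt f `<=` eclosed_ball 0 rho `\` eball 0 r)
  (hX : xray_vanishes_on_lines_meeting f (eball 0 r)) :
  dist_eq0 f.
Proof.
have Hspt x : eball 0 r x -> ~ spt f x by move=> xr /hspt[].
have q0 : 0 < r ^+ 2 by rewrite exprn_gt0.
have rpair_eq0 g : smooth_on setT g -> rpair f g = 0.
  (* Equality in [R[i]] is tested by taking for [P] first the real part, then the imaginary part. *)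
  move=> sg; apply/eqP; rewrite eq_complex; apply/andP; split; apply/eqP.
  - apply: (real_part_vanishes q0 _ _ _ hr erefl hd Hspt hX sg) => //.
    + by move=> [a b] [a' b'].
    + by move=> c [a b] /=; rewrite mul0r subr0.
    + move=> [a b] /=; rewrite -sqrtr_sqr; apply: ler_wsqrtr.
      by rewrite lerDl sqr_ge0.
  - apply: (real_part_vanishes q0 _ _ _ hr erefl hd Hspt hX sg) => //.
    + by move=> [a b] [a' b'].
    + by move=> c [a b] /=; rewrite mul0r addr0.
    + move=> [a b] /=; rewrite -sqrtr_sqr; apply: ler_wsqrtr.
      by rewrite lerDr sqr_ge0.
move=> phi sphi; rewrite (pairing_ReIm f sphi); case: sphi => sRe sIm.
by rewrite (rpair_eq0 _ sRe) (rpair_eq0 _ sIm) mulr0 addr0.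
Qed.
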